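(* Let $W=W(n,p)$ be the number of isolated vertices in the Erdős–Rényi random graph $G(n,p)$ (on $n$ vertices, each edge present independently with probability $p=p(n)$), and let $\mu_n=\mathbb{E}W$, $\sigma_n^2=\mathrm{Var}(W)$. (i) If $\lim_{n\to\infty}(\log(n)-np)=\infty$ and either $\lim_{n\to\infty}np=\infty$ or $\lim_{n\to\infty}np=c>0$, then $\sigma_n^2\asymp ne^{-np}$ and \[ d_{\mathrm{loc}}\bigl(\mathcal{L}(W),\mathrm{TP}(\mu_n,\sigma_n^2)\bigr)=O(\sigma_n^{-3/2}). \] (ii) If $\lim_{n\to\infty}np=0$ and $\lim_{n\to\infty}n^2p=\infty$, then $\sigma_n^2\asymp n^2p$ and \[ d_{\mathrm{loc}}\bigl(\mathcal{L}(W),\mathrm{TP}(\mu_n,\sigma_n^2)\bigr)=O\bigl(\sigma_n^{-1}(np^{3/4})^{-1}\bigr),\qquad d_{\mathrm{loc}}^{(2)}\bigl(\mathcal{L}(W),\mathrm{TP}(\mu_n,\sigma_n^2)\bigr)=O(\sigma_n^{-3/2}). \]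
   Context: For $f:\mathbb{Z}\to\mathbb{R}$, $\|f\|_\infty=\sup|f(i)|$ and $\Delta f(j)=f(j+1)-f(j)$. For an integer-supported law with distribution function $F(j)=\mathbb{P}[X\le j]$ and positive integer $m$, $\bar F^m(j)=\frac{F(j)+\dots+F(j-m+1)}{m}$. For two such laws with distribution functions $F,G$: $d_{\mathrm{loc}}^{(m)}(F,G)=\|\Delta\bar F^m-\Delta\bar G^m\|_\infty$ and $d_{\mathrm{loc}}=d_{\mathrm{loc}}^{(1)}$. Translated Poisson: for $\mu\in\mathbb{R}$, $s^2>0$, $Z\sim\mathrm{TP}(\mu,s^2)$ means $Z-\lfloor\mu-s^2\rfloor\sim\mathrm{Po}(s^2+\gamma)$ with $\gamma=\mu-s^2-\lfloor\mu-s^2\rfloor$. *)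

(* Defs.v *)
From HB Require Import structures.
From mathcomp Require Import all_boot all_order all_algebra.
From mathcomp Require Import all_classical all_reals all_analysis.
Set Implicit Arguments. Unset Strict Implicit. Unset Printing Implicit Defensive.
Import Order.TTheory GRing.Theory Num.Theory numFieldNormedType.Exports.
Local Open Scope ring_scope.
Local Open Scope classical_set_scope.

Section Defs.
Variable R : realType.

Definition edges (n : nat) : {set {set 'I_n}} := [set e : {set 'I_n} | #|e| == 2%N].

(* A graph is an edge set E \subset edges n. Number of isolated vertices. *)
Definition isolated (n : nat) (E : {set {set 'I_n}}) : nat :=
  #|[set v : 'I_n | [forall e in E, v \notin e]]|.

Definition gnp_weight (n : nat) (p : R) (E : {set {set 'I_n}}) : R :=
  p ^+ #|E| * (1 - p) ^+ (#|edges n| - #|E|).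

Definition meanW (n : nat) (p : R) : R :=
  \sum_(E in powerset (edges n)) gnp_weight p E * (isolated E)%:R.

Definition varW (n : nat) (p : R) : R :=
  \sum_(E in powerset (edges n)) gnp_weight p E * ((isolated E)%:R - meanW n p) ^+ 2.

Definition distW (n : nat) (p : R) (j : int) : R :=
  \sum_(E in powerset (edges n) | ((isolated E)%:Z <= j)%R) gnp_weight p E.

Definition poisson_pmf (lam : R) (k : nat) : R :=
  expR (- lam) * lam ^+ k / (k`!)%:R.

(* Translated Poisson TP(mu, s2): Z - floor(mu - s2) ~ Po(s2 + gamma),
   gamma = mu - s2 - floor(mu - s2).  Distribution function P[Z <= j]. *)
Definition tp_shift (mu s2 : R) : int := Num.floor (mu - s2).
Definition tp_param (mu s2 : R) : R :=
  s2 + (mu - s2 - (tp_shift mu s2)%:~R).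
Definition distTP (mu s2 : R) (j : int) : R :=
  if (tp_shift mu s2 <= j)%R
  then \sum_(k < (absz (j - tp_shift mu s2)).+1) poisson_pmf (tp_param mu s2) k
  else 0.

Definition Delta (f : int -> R) (j : int) : R := f (j + 1) - f j.
Definition Fbar (m : nat) (F : int -> R) (j : int) : R :=
  (\sum_(i < m) F (j - i%:Z)) / m%:R.

Definition dloc (m : nat) (F G : int -> R) : R :=
  sup (range (fun j : int => `|Delta (Fbar m F) j - Delta (Fbar m G) j|)).

Definition seq_Theta (a b : nat -> R) : Prop :=
  exists c1 c2 : R, 0 < c1 /\ 0 < c2 /\
    \forall n \near \oo, c1 * b n <= a n /\ a n <= c2 * b n.
Definition seq_O (a b : nat -> R) : Prop :=
  exists C : R, 0 < C /\ \forall n \near \oo, `|a n| <= C * b n.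

End Defs.

(* Main.v *)
Require Import Defs.
From HB Require Import structures.
From mathcomp Require Import all_boot all_order all_algebra.
From mathcomp Require Import zify ring lra.
From mathcomp Require Import all_classical all_reals all_analysis.
From mathcomp Require Import fintype finset.
Import Order.TTheory GRing.Theory Num.Theory numFieldNormedType.Exports.

(** The proof compares characteristic functions. Let s^2 = Var W and
    phi(t) = E cos(theta + t W); all bounds are uniform in the phase theta, which
    replaces complex numbers. Deleting the edges at a random vertex gives Stein's
    identity for W, hence phi' = - s^2 t phi + O(s^2 t^2 + s t) after centering.
    The (truncated) Poisson law satisfies the same equation, so by Gronwall the
    two characteristic functions differ by O(t + 1/s). Away from 0 both decay.
    For W this is seen by conditioning: given the edges inside one half of the
    vertices and some of the others, W is a constant plus a binomial variable,
    coming from the vertices of the other half whose only possible neighbours are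
    already known not to be isolated. When np -> 0 jumps of size two dominate:
    G(n,p) is a fair thinning of G(n,2p), and every isolated edge of the latter
    contributes 0 or 2 independently. Fourier inversion, cut at t = s^(-3/4),
    gives the rates; with a nearly 2-periodic law the neighbourhood of t = pi is
    damped by the averaging factor cos(t/2) for m = 2 and by the jumps of size
    one for m = 1. *)

Set Implicit Arguments. Unset Strict Implicit. Unset Printing Implicit Defensive.
Local Open Scope ring_scope.

(** The scale is z = V^(-1/8), where V = s^2: then s = z^(-4), the cut s^(-3/4) is z^3 and the rate
    s^(-3/2) is z^6, so all estimates compare integer powers of z. The Stein remainder s^2 t^2 + s
    t, divided by the damping s^2 t of the equation, explains O(t + 1/s); integrated up to z^3 this
    costs z^6 + z^7, and z^3 is the longest range for which it is still O(z^6). Beyond the cut only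
    decay helps; there t^2 s^2 >= z^(-2), and the polynomial bound exp(-x) <= 2/x^2 already gives
    z^7. Exceptional configurations in the conditioning add O(1/s^2) = O(z^8) to the decay bound,
    for every t. Over a bounded interval this stays below z^6, so second moments (Efron-Stein,
    Chebyshev) are enough to control them. The Poisson law is truncated to keep all sums finite:
    derivatives are then taken termwise, and integrals are replaced by mean value estimates with
    explicit antiderivatives. *)

(** * Expectations over random subsets of a finite set *)

Section Bernoulli.
Variables (R : realType) (T : finType).
Implicit Types (p : R) (D E U S : {set T}) (F G : {set T} -> R).

(** The mean of F over a p-random subset of D. As a plain weighted sum it makes sense for every real
    p: the identities of this section hold unconditionally, and the inequalities ask for 0 <= p <=
    1. *)
Definition bern p D F : R :=
  \sum_(E in powerset D) p ^+ #|E| * (1 - p) ^+ (#|D| - #|E|) * F E.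

Lemma set_induction (P : {set T} -> Prop) :
  P set0 -> (forall e D, e \notin D -> P D -> P (e |: D)) -> forall D, P D.
Proof.
move=> P0 PU D; move: {2}#|D| (erefl #|D|) => k; elim: k D => [|k IH] D cD.
  by rewrite (cards0_eq cD).
have [e eD] : exists e, e \in D by apply/card_gt0P; rewrite cD.
rewrite -(setD1K eD); apply: PU; first by rewrite !inE eqxx.
by apply: IH; move: cD; rewrite (cardsD1 e) eD => -[].
Qed.

Lemma eq_bern p D F G : (forall E, E \subset D -> F E = G E) ->
  bern p D F = bern p D G.
Proof. by move=> FG; apply: eq_bigr => E; rewrite powersetE => /FG ->. Qed.

(** Fubini for independent coordinates; conditioning on part of the edges always means applying
    this. *)
Lemma bern_split p D1 D2 F : [disjoint D1 & D2] ->
  bern p (D1 :|: D2) F =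
  bern p D1 (fun E1 => bern p D2 (fun E2 => F (E1 :|: E2))).
Proof.
move=> dD; rewrite /bern.
under [RHS]eq_bigr do rewrite big_distrr /=.
rewrite pair_big_dep /=.
rewrite (reindex_onto (fun u : {set T} * {set T} => u.1 :|: u.2)
  (fun E => (E :&: D1, E :&: D2))) /=; last first.
  by move=> E; rewrite powersetE => sE; rewrite -setIUr (setIidPl sE).
have dis (A B : {set T}) : A \subset D1 -> B \subset D2 ->
    (A :|: B) :&: D1 = A /\ (A :|: B) :&: D2 = B.
  move=> sA sB; rewrite !setIUl (setIidPl sA) (setIidPl sB).
  have -> : B :&: D1 = set0.
    by apply: disjoint_setI0; apply: disjointWl sB _; rewrite disjoint_sym.
  have -> : A :&: D2 = set0 by apply: disjoint_setI0; apply: disjointWl sA dD.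
  by rewrite setU0 set0U.
apply: eq_big => [[A B]|[A B]] /=.
  rewrite !powersetE; apply/andP/andP => [[sAB /eqP[eA eB]]|[sA sB]].
    by rewrite -eA -eB !subsetIr.
  have [-> ->] := dis _ _ sA sB.
  by split=> //; apply: setUSS.
rewrite !powersetE => /andP[sAB /eqP[eA eB]].
have sA : A \subset D1 by rewrite -eA subsetIr.
have sB : B \subset D2 by rewrite -eB subsetIr.
have cU (X Y : {set T}) : [disjoint X & Y] -> #|X :|: Y| = (#|X| + #|Y|)%N.
  by move=> d; rewrite cardsU (disjoint_setI0 d) cards0 subn0.
have dAB : [disjoint A & B] by apply: disjointW sA sB dD.
rewrite (cU A B) // (cU D1 D2) //.
have -> : (#|D1| + #|D2| - (#|A| + #|B|) = (#|D1| - #|A|) + (#|D2| - #|B|))%N.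
  by have := subset_leq_card sA; have := subset_leq_card sB; lia.
by rewrite !exprD; ring.
Qed.

Lemma bern_set0 p F : bern p set0 F = F set0.
Proof. by rewrite /bern powerset0 big_set1 cards0 !expr0 !mul1r. Qed.

Lemma bern_set1 p e F : bern p [set e] F = p * F [set e] + (1 - p) * F set0.
Proof.
rewrite /bern (big_setD1 [set e]) ?powersetE //=.
rewrite (big_setD1 set0) /=; last first.
  by rewrite !inE sub0set andbT eq_sym -cards_eq0 cards1.
rewrite big_pred0 => [|E].
  by rewrite cards1 cards0 !expr0 expr1; ring.
rewrite !inE subset1.
by case: (E == [set e]); case: (E == set0).
Qed.

Lemma bernU1 p e D F : e \notin D ->
  bern p (e |: D) F = p * bern p D (fun E => F (e |: E)) + (1 - p) * bern p D F.
Proof.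
move=> eD; rewrite bern_split ?disjoints1 // bern_set1.
by under [in X in _ + X]eq_bern do rewrite set0U.
Qed.

Lemma bernD p D F G : bern p D (fun E => F E + G E) = bern p D F + bern p D G.
Proof. by rewrite /bern -big_split; apply: eq_bigr => E _; rewrite mulrDr. Qed.

Lemma bernZ p D c F : bern p D (fun E => c * F E) = c * bern p D F.
Proof. by rewrite /bern big_distrr; apply: eq_bigr => E _ /=; rewrite mulrCA. Qed.

Lemma bernZr p D c F : bern p D (fun E => F E * c) = bern p D F * c.
Proof. by rewrite /bern big_distrl; apply: eq_bigr => E _ /=; rewrite mulrA. Qed.

Lemma bernN p D F : bern p D (fun E => - F E) = - bern p D F.
Proof. by rewrite -mulN1r -bernZ; apply: eq_bern => E _; rewrite mulN1r. Qed.

Lemma bernB p D F G : bern p D (fun E => F E - G E) = bern p D F - bern p D G.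
Proof. by rewrite bernD bernN. Qed.

Lemma bern_sum p D (I : finType) (P : pred I) (H : I -> {set T} -> R) :
  bern p D (fun E => \sum_(i | P i) H i E) = \sum_(i | P i) bern p D (H i).
Proof.
rewrite /bern exchange_big; apply: eq_bigr => E _ /=.
by rewrite big_distrr.
Qed.

Lemma bern_cst p D c : bern p D (fun=> c) = c.
Proof.
elim/set_induction: D => [|e D eD IH]; first by rewrite bern_set0.
by rewrite bernU1 // !IH; ring.
Qed.

Lemma ler_bern p D F G : 0 <= p <= 1 ->
  (forall E, E \subset D -> F E <= G E) -> bern p D F <= bern p D G.
Proof.
move=> /andP[p0 p1] FG; apply: ler_sum => E; rewrite powersetE => /FG FGE.
by apply: ler_wpM2l => //; rewrite mulr_ge0 ?exprn_ge0 ?subr_ge0.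
Qed.

Lemma bern_ge0 p D F : 0 <= p <= 1 ->
  (forall E, E \subset D -> 0 <= F E) -> 0 <= bern p D F.
Proof. by move=> hp F0; rewrite -(bern_cst p D 0); apply: ler_bern. Qed.

Lemma ler_norm_bern p D F : 0 <= p <= 1 ->
  `|bern p D F| <= bern p D (fun E => `|F E|).
Proof.
move=> hp; rewrite ler_norml; apply/andP; split; last first.
  by apply: ler_bern => // E _; apply: ler_norm.
by rewrite -bernN; apply: ler_bern => // E _; rewrite lerNl -normrN ler_norm.
Qed.

Lemma bern_point p D S : S \subset D ->
  bern p D (fun E => (E == S)%:R) = p ^+ #|S| * (1 - p) ^+ (#|D| - #|S|).
Proof.
move=> SD; rewrite /bern (bigD1 S) ?powersetE //= eqxx !mulr1.
rewrite big1 ?addr0 // => E /andP[_ /negbTE ->].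
by rewrite mulr0.
Qed.

(** The trace on U is independent of the rest. With U a star and S empty, it says that conditioning
    on an isolated vertex amounts to deleting its edges. *)
Lemma bern_trace_indep p D U S F : U \subset D -> S \subset U ->
  bern p D (fun E => (E :&: U == S)%:R * F (E :\: U)) =
  p ^+ #|S| * (1 - p) ^+ (#|U| - #|S|) * bern p D (fun E => F (E :\: U)).
Proof.
move=> UD SU.
have dU : [disjoint U & D :\: U] by rewrite -setI_eq0 setIDA setIC -setIDA setDv setI0.
have -> : D = U :|: (D :\: U) by rewrite -{1}(setID D U) (setIidPr UD).
rewrite !bern_split // -bern_point //.
have cut E1 E2 : E1 \subset U -> E2 \subset D :\: U ->
    (E1 :|: E2) :&: U = E1 /\ (E1 :|: E2) :\: U = E2.
  move=> s1 s2; have d2 : [disjoint E2 & U].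
    by rewrite disjoint_sym; apply: disjointWr s2 dU.
  rewrite setIUl (setIidPl s1) (disjoint_setI0 d2) setU0; split=> //.
  by rewrite setDUl (setDidPl d2); move: s1; rewrite -setD_eq0 => /eqP ->; rewrite set0U.
rewrite -bernZr; apply: eq_bern => E1 s1.
rewrite (@eq_bern _ _ _ (fun E2 => (E1 == S)%:R * F E2)); last first.
  by move=> E2 s2; have [-> ->] := cut _ _ s1 s2.
rewrite bernZ; congr (_ * _).
rewrite -[LHS](bern_cst p U); apply: eq_bern => E3 s3.
by apply: eq_bern => E2 s2; have [_ ->] := cut _ _ s3 s2.
Qed.

Lemma bern_trace p D U S : U \subset D -> S \subset U ->
  bern p D (fun E => (E :&: U == S)%:R) = p ^+ #|S| * (1 - p) ^+ (#|U| - #|S|).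
Proof.
move=> UD SU; rewrite -[RHS]mulr1 -{3}(bern_cst p D 1).
rewrite -(bern_trace_indep p (fun=> 1) UD SU).
by apply: eq_bern => E _; rewrite mulr1.
Qed.

(** A coordinate survives two independent stages with probability p q; this allows a random graph to
    be sampled from a denser one. *)
Lemma bern_thin p q D F :
  bern (p * q) D F = bern p D (fun C => bern q C F).
Proof.
elim/set_induction: D F => [|e D eD IH] F; first by rewrite !bern_set0.
rewrite !bernU1 // !IH.
rewrite (@eq_bern _ D (fun C => bern q (e |: C) F : R)
  (fun C => q * bern q C (fun E => F (e |: E)) + (1 - q) * bern q C F)); last first.
  by move=> C CD; rewrite bernU1 //; apply: contra eD; apply: (subsetP CD).
by rewrite bernD !bernZ; ring.
Qed.

Lemma bern_sqr_le p D F : 0 <= p <= 1 ->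
  bern p D F ^+ 2 <= bern p D (fun E => F E ^+ 2).
Proof.
move=> hp; set m := bern p D F.
have : 0 <= bern p D (fun E => (F E - m) ^+ 2).
  by apply: bern_ge0 => // E _; apply: sqr_ge0.
rewrite (@eq_bern _ _ _ (fun E => F E ^+ 2 + (- (2 * m) * F E + m ^+ 2))).
  by rewrite !bernD bernZ bern_cst -/m; lra.
by move=> E _; ring.
Qed.

Lemma bern_var p D F :
  bern p D (fun E => (F E - bern p D F) ^+ 2) =
  bern p D (fun E => F E ^+ 2) - bern p D F ^+ 2.
Proof.
set m := bern p D F.
rewrite (@eq_bern _ _ _ (fun E => F E ^+ 2 + (- (2 * m) * F E + m ^+ 2))).
  by rewrite !bernD bernZ bern_cst -/m; ring.
by move=> E _; ring.
Qed.

(* Efron-Stein, by conditioning on one coordinate at a time. *)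
Lemma bern_var_lipschitz p D F (K : R) : 0 <= p <= 1 -> 0 <= K ->
  (forall e E, e \in D -> e \notin E -> E \subset D ->
     `|F (e |: E) - F E| <= K) ->
  bern p D (fun E => (F E - bern p D F) ^+ 2) <= #|D|%:R * p * K ^+ 2.
Proof.
move=> hp K0; rewrite bern_var; have /andP[p0 p1] := hp.
elim/set_induction: D F => [|e D eD IH] F lipF.
  by rewrite !bern_set0 cards0 subrr !mul0r.
rewrite !bernU1 // cardsU1 eD natrD.
have s1 := IH F; have s2 := IH (fun E => F (e |: E)).
have {s1}h1 := s1 (fun f E fD fE ED => lipF f E (setU1r e fD) fE (subset_trans ED (subsetUr _ _))).
have {s2}h2 : bern p D (fun E => F (e |: E) ^+ 2) - bern p D (fun E => F (e |: E)) ^+ 2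
    <= #|D|%:R * p * K ^+ 2.
  apply: s2 => f E fD fE ED; rewrite setUCA; apply: lipF.
  - exact: setU1r.
  - by rewrite !inE negb_or fE andbT; apply: contraNneq eD => <-.
  - exact: setUS.
set a := bern p D (fun E => F (e |: E)) in h2 *.
set b := bern p D F in h1 *.
have hab : (a - b) ^+ 2 <= K ^+ 2.
  rewrite -real_normK ?num_real // lerXn2r ?nnegrE ?normr_ge0 // /a /b -bernB.
  apply: le_trans (ler_norm_bern _ _ hp) _; rewrite -(bern_cst p D K).
  apply: ler_bern => // E ED; apply: lipF; rewrite ?setU11 //.
    by apply: contra eD; apply: (subsetP ED).
  exact: subset_trans ED (subsetUr _ _).
(* Law of total variance: p (1 - p) (a - b)^2 is the variance of the conditional mean given the
   coordinate e. *)
have ppos : p * (1 - p) * (a - b) ^+ 2 <= p * K ^+ 2.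
  have := sqr_ge0 K; have := sqr_ge0 (a - b); nra.
set A := bern p D _ in h2 *; set B := bern p D _ in h1 *.
have : p * (A - a ^+ 2) <= p * (#|D|%:R * p * K ^+ 2) by exact: ler_wpM2l.
have : (1 - p) * (B - b ^+ 2) <= (1 - p) * (#|D|%:R * p * K ^+ 2).
  by apply: ler_wpM2l; rewrite ?subr_ge0.
have -> : true%:R = 1 :> R by [].
nra.
Qed.

(** Probabilities are written as [bern] of a boolean indicator. F < m/2 forces |F - m| > m/2, whence
    the factor 4. *)
Lemma bern_chebyshev p D F (m : R) : 0 <= p <= 1 -> 0 < m -> m = bern p D F ->
  bern p D (fun E => (F E < m / 2)%R%:R) <=
  4 * bern p D (fun E => (F E - m) ^+ 2) / m ^+ 2.
Proof.
move=> hp m0 mE.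
have -> : 4 * bern p D (fun E => (F E - m) ^+ 2) / m ^+ 2 =
   bern p D (fun E => 4 / m ^+ 2 * (F E - m) ^+ 2) by rewrite bernZ; ring.
apply: ler_bern => // E _; case: ltP => [h|_]; last first.
  by rewrite mulr_ge0 ?sqr_ge0 // divr_ge0 ?sqr_ge0.
have -> : 4 / m ^+ 2 * (F E - m) ^+ 2 = (2 * (m - F E) / m) ^+ 2.
  by field; rewrite gt_eqF.
by rewrite expr_ge1 ?divr_ge0 ?lerMDr ?ler_pdivlMr ?mul1r; try lra.
Qed.

End Bernoulli.

(** * Characteristic function of a binomial count *)

Section BernoulliDecay.
Variables (R : realType) (T I : finType) (Dv : I -> {set T}).

(** With sets of edges at a vertex this counts vertices still isolated; with singletons it counts
    absent edges. *)
Definition avoid_count (V : {set I}) (E : {set T}) : R :=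
  \sum_(i in V) (E :&: Dv i == set0)%:R.

Lemma bern_indicator (p : R) (U : {set T}) (h : R -> R) :
  bern p U (fun E => h (E == set0)%:R) =
  (1 - p) ^+ #|U| * h 1 + (1 - (1 - p) ^+ #|U|) * h 0.
Proof.
rewrite (@eq_bern _ _ _ _ _ (fun E => h 0 + (E == set0)%:R * (h 1 - h 0))).
  rewrite bernD bern_cst bernZr bern_point ?sub0set // cards0 expr0 subn0.
  ring.
by move=> E _; case: eqP => _ /=; ring.
Qed.

(** The two means are the coordinates of the characteristic function of a binomial law with success
    probability q = (1-p)^m, and |1 - q + q exp(it)|^2 = 1 - 2 q (1-q) (1 - cos t). Disjointness of
    the sets gives one such factor per element of V. *)
Lemma bern_cos_sin_sqr (p t : R) (V : {set I}) (D : {set T}) (m : nat) :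
  (forall i, i \in V -> Dv i \subset D) ->
  (forall i, i \in V -> #|Dv i| = m) ->
  (forall i j, i \in V -> j \in V -> i != j -> [disjoint Dv i & Dv j]) ->
  bern p D (fun E => cos (t * avoid_count V E)) ^+ 2 +
  bern p D (fun E => sin (t * avoid_count V E)) ^+ 2 =
  (1 - 2 * (1 - p) ^+ m * (1 - (1 - p) ^+ m) * (1 - cos t)) ^+ #|V|.
Proof.
elim/set_induction: V D => [|v V vV IH] D sD cD dD.
  rewrite cards0 expr0.
  rewrite (@eq_bern _ _ _ _ _ (fun=> 1)); last first.
    by move=> E _; rewrite /avoid_count big_set0 mulr0 cos0.
  rewrite (@eq_bern _ _ _ _ (fun E => sin _) (fun=> 0)); last first.
    by move=> E _; rewrite /avoid_count big_set0 mulr0 sin0.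
  by rewrite !bern_cst; ring.
have vVv : v \in v |: V by rewrite setU11.
have dsj i : i \in V -> [disjoint Dv i & Dv v].
  by move=> iV; apply: dD => //; [exact: setU1r | apply: contraNneq vV => <-].
have sV i : i \in V -> Dv i \subset D :\: Dv v.
  by move=> iV; rewrite subsetD dsj // sD // setU1r.
have dU : [disjoint D :\: Dv v & Dv v].
  by rewrite -setI_eq0 setIDAC -setIDA setDv setI0.
have DE : D = (D :\: Dv v) :|: Dv v.
  by rewrite setUC -{1}(setID D (Dv v)) (setIidPr (sD v vVv)).
have cntE (E1 E2 : {set T}) : E1 \subset D :\: Dv v -> E2 \subset Dv v ->
    avoid_count (v |: V) (E1 :|: E2) = avoid_count V E1 + (E2 == set0)%:R.
  move=> s1 s2; rewrite /avoid_count big_setU1 //= addrC; congr (_ + _).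
    apply: eq_bigr => i iV; rewrite setIUl.
    suff -> : E2 :&: Dv i = set0 by rewrite setU0.
    by apply: disjoint_setI0; rewrite disjoint_sym; apply: disjointWr s2 (dsj i iV).
  rewrite setIUl (setIidPl s2) (_ : E1 :&: Dv v = set0) ?set0U //.
  by apply: disjoint_setI0; apply: disjointWl s1 dU.
have IHV := IH (D :\: Dv v) sV (fun i iV => cD i (setU1r v iV))
  (fun i j iV jV => dD i j (setU1r v iV) (setU1r v jV)).
set q := (1 - p) ^+ m in IHV *.
set X := bern p (D :\: Dv v) (fun E => cos _) in IHV.
set Y := bern p (D :\: Dv v) (fun E => sin _) in IHV.
have -> : bern p D (fun E => cos (t * avoid_count (v |: V) E)) =
    q * (cos t * X - sin t * Y) + (1 - q) * X.
  rewrite DE bern_split // -/X.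
  rewrite (@eq_bern _ _ _ _ _ (fun E => (q * cos t + (1 - q)) * cos (t * avoid_count V E)
     + (- q * sin t) * sin (t * avoid_count V E))).
    by rewrite bernD !bernZ -/X -/Y; ring.
  move=> E1 s1; pose h x := cos (t * (avoid_count V E1 + x)).
  rewrite (@eq_bern _ _ _ _ _ (fun E2 => h (E2 == set0)%:R)).
    by rewrite bern_indicator /h cD // -/q addr0 mulrDr mulr1 cosD; ring.
  by move=> E2 s2; rewrite cntE.
have -> : bern p D (fun E => sin (t * avoid_count (v |: V) E)) =
    q * (cos t * Y + sin t * X) + (1 - q) * Y.
  rewrite DE bern_split // -/Y.
  rewrite (@eq_bern _ _ _ _ _ (fun E => (q * cos t + (1 - q)) * sin (t * avoid_count V E)
     + (q * sin t) * cos (t * avoid_count V E))).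
    by rewrite bernD !bernZ -/X -/Y; ring.
  move=> E1 s1; pose h x := sin (t * (avoid_count V E1 + x)).
  rewrite (@eq_bern _ _ _ _ _ (fun E2 => h (E2 == set0)%:R)).
    by rewrite bern_indicator /h cD // -/q addr0 mulrDr mulr1 sinD; ring.
  by move=> E2 s2; rewrite cntE.
rewrite cardsU1 vV add1n [RHS]exprS -IHV.
have := cos2Dsin2 t; set c := cos t; set s := sin t => cs.
have es : s ^+ 2 = 1 - c ^+ 2 by rewrite -cs; ring.
by ring: es.
Qed.

Lemma bern_cos_decay (p t theta : R) (V : {set I}) (D : {set T}) (m : nat) :
  0 <= p <= 1 ->
  (forall i, i \in V -> Dv i \subset D) ->
  (forall i, i \in V -> #|Dv i| = m) ->
  (forall i j, i \in V -> j \in V -> i != j -> [disjoint Dv i & Dv j]) ->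
  `|bern p D (fun E => cos (theta + t * avoid_count V E))| <=
  expR (- ((1 - p) ^+ m * (1 - (1 - p) ^+ m) * (1 - cos t) * #|V|%:R)).
Proof.
move=> hp sD cD dD; have := bern_cos_sin_sqr p t sD cD dD.
set X := bern _ _ _; set Y := bern _ _ _; set q := (1 - p) ^+ m => XY.
have -> : bern p D (fun E => cos (theta + t * avoid_count V E)) =
    cos theta * X - sin theta * Y.
  rewrite -!bernZ -bernB; apply: eq_bern => E _.
  by rewrite cosD.
rewrite -(@ler_pXn2r _ 2) ?nnegrE ?normr_ge0 ?expR_ge0 // real_normK ?num_real //.
have -> : expR (- (q * (1 - q) * (1 - cos t) * #|V|%:R)) ^+ 2 =
    expR (- (2 * q * (1 - q) * (1 - cos t))) ^+ #|V|.
  by rewrite -!expRM_natl; congr expR; ring.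
(* Cauchy-Schwarz with the unit vector (cos theta, sin theta). *)
have h1 : (cos theta * X - sin theta * Y) ^+ 2 <= X ^+ 2 + Y ^+ 2.
  have := cos2Dsin2 theta; set c := cos _; set s := sin _ => cs.
  have := sqr_ge0 (s * X + c * Y).
  have -> : X ^+ 2 + Y ^+ 2 = (c ^+ 2 + s ^+ 2) * (X ^+ 2 + Y ^+ 2) by rewrite cs mul1r.
  nra.
apply: le_trans h1 _; rewrite XY.
have q01 : 0 <= q <= 1.
  have /andP[p0 p1] := hp.
  by rewrite exprn_ge0 ?exprn_ile1 //; lra.
have := cos_le1 t; have := cos_geN1 t => c1 c2.
(* Comparing powers needs a nonnegative base: q (1-q) <= 1/4 and 1 - cos t <= 2. *)
apply: lerXn2r; rewrite ?nnegrE ?expR_ge0 //.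
  have : q * (1 - q) <= 1 / 4 by have := sqr_ge0 (q - 1 / 2); nra.
  have : 0 <= q * (1 - q) by move: q01 => /andP[]; nra.
  nra.
by apply: le_trans (expR_ge1Dx _); lra.
Qed.

End BernoulliDecay.

(** * Mean value estimates and elementary inequalities *)

Section RealAnalysis.
Local Open Scope classical_set_scope.
Variable R : realType.
Implicit Types (f g : R -> R) (a b t x : R).

Lemma derive_le f g f' g' a b : a <= b ->
  (forall x : R, a <= x <= b -> is_derive x 1 f (f' x)) ->
  (forall x : R, a <= x <= b -> is_derive x 1 g (g' x)) ->
  (forall x : R, a <= x <= b -> f' x <= g' x) ->
  f b - f a <= g b - g a.
Proof.
move=> ab df dg fg.
have dgf x : a <= x <= b -> is_derive x 1 (g - f) (g' x - f' x).
  by move=> xab; apply: is_deriveB; [exact: dg | exact: df].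
have gfc : {within `[a, b], continuous (g - f)}.
  apply: derivable_within_continuous => x; rewrite in_itv /= => xab.
  by have [] := dgf x xab.
have [x|c] := @MVT_segment R (g - f) (fun x => g' x - f' x) a b ab _ gfc.
  by rewrite in_itv /= => /andP[ax xb]; apply: dgf; rewrite !ltW.
rewrite in_itv /= => cab; rewrite !fctE => gf.
rewrite -subr_ge0 (_ : _ - _ = (g b - f b) - (g a - f a)); last by ring.
by rewrite gf mulr_ge0 ?subr_ge0 // fg.
Qed.

(** Takes the place of bounding an integral of |f'|: g is an explicit antiderivative of the
    majorant. *)
Lemma derive_norm_le f g f' g' a b : a <= b ->
  (forall x : R, a <= x <= b -> is_derive x 1 f (f' x)) ->
  (forall x : R, a <= x <= b -> is_derive x 1 g (g' x)) ->
  (forall x : R, a <= x <= b -> `|f' x| <= g' x) ->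
  `|f b - f a| <= g b - g a.
Proof.
move=> ab df dg fg; rewrite ler_norml; apply/andP; split; last first.
  by apply: derive_le df dg _ => // x /fg; apply: le_trans; apply: ler_norm.
have dNf x : a <= x <= b -> is_derive x 1 (- f) (- f' x).
  by move=> /df dfx; apply: is_deriveN.
have := derive_le ab dNf dg; rewrite !fctE => H.
rewrite lerNl; apply: le_trans (H _); first by rewrite opprB addrC opprK.
by move=> x /fg; apply: le_trans; rewrite -normrN ler_norm.
Qed.

Lemma is_derive_cos_affine theta x t :
  is_derive t 1 (fun t => cos (theta + t * x)) (- (x * sin (theta + t * x))).
Proof.
have h : is_derive t 1 (fun t => theta + t * x) x.
  by apply: is_derive_eq; rewrite add0r /GRing.scale /=; ring.
apply: is_derive_eq; by ring.
Qed.

Lemma is_derive_sin_affine theta x t :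
  is_derive t 1 (fun t => sin (theta + t * x)) (x * cos (theta + t * x)).
Proof.
have h : is_derive t 1 (fun t => theta + t * x) x.
  by apply: is_derive_eq; rewrite add0r /GRing.scale /=; ring.
apply: is_derive_eq; by ring.
Qed.

Lemma cos_lipschitz x a : 0 <= a -> `|cos (x + a) - cos x| <= a.
Proof.
move=> a0.
have := @derive_norm_le (fun a => cos (x + a * 1)) id
  (fun a => - (1 * sin (x + a * 1))) (fun=> 1) 0 a a0.
rewrite mul0r addr0 mulr1 subr0; apply=> [u _|u _].
- exact: is_derive_cos_affine.
- by rewrite mul1r normrN sin_max.
Qed.

Lemma sin_taylor2 x a : 0 <= a ->
  `|sin (x + a) - sin x - a * cos x| <= a ^+ 2 / 2.
Proof.
move=> a0.
have := @derive_norm_le (fun a => sin (x + a * 1) - a * cos x) (fun a => a ^+ 2 / 2)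
  (fun a => 1 * cos (x + a * 1) - cos x) id 0 a a0.
rewrite !mul0r !addr0 mulr1 subr0 expr0n /= !mul0r subr0 addrAC; apply=> [u _|u _|u u0].
- apply: is_deriveB; first exact: is_derive_sin_affine.
  by apply: is_derive_eq; rewrite /GRing.scale /=; ring.
- by apply: is_derive_eq; rewrite /GRing.scale /=; lra.
- by rewrite mulr1 mul1r; apply: cos_lipschitz; case/andP: u0.
Qed.

(** The condition on b makes it a supersolution of y' = - s u y + |e|. The integrating factor exp(s
    u^2 / 2) reduces the comparison to a mean value estimate. *)
Lemma gronwall_linear (D e b b' : R -> R) (s t : R) : 0 <= s -> 0 <= t ->
  (forall u : R, 0 <= u <= t -> is_derive u 1 D (- s * u * D u + e u)) ->
  (forall u : R, 0 <= u <= t -> is_derive u 1 b (b' u)) ->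
  (forall u : R, 0 <= u <= t -> `|e u| <= b' u + s * u * b u) ->
  `|D 0| <= b 0 -> `|D t| <= b t.
Proof.
move=> s0 t0 dD db ebb D0.
pose E u := expR (s * u ^+ 2 / 2).
have dE (u : R) : is_derive u 1 E (s * u * E u).
  have h : is_derive u 1 (fun u : R => s * u ^+ 2 / 2) (s * u).
    by apply: is_derive_eq; rewrite /GRing.scale /=; lra.
  apply: is_derive_eq; by rewrite mulrC.
have := @derive_norm_le (fun u => E u * D u) (fun u => E u * b u)
  (fun u => E u * e u) (fun u => E u * (b' u + s * u * b u)) 0 t t0.
have -> : E 0 = 1 by rewrite /E expr0n /= mulr0 mul0r expR0.
rewrite !mul1r => H.
have {}H : `|E t * D t - D 0| <= E t * b t - b 0.
  apply: H => [u ut|u ut|u ut].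
  - have dDu := dD u ut; have dEu := dE u.
    by apply: is_derive_eq; rewrite /GRing.scale /=; ring.
  - have dbu := db u ut; have dEu := dE u.
    by apply: is_derive_eq; rewrite /GRing.scale /=; ring.
  - by rewrite normrM ger0_norm ?expR_ge0 // ler_wpM2l ?expR_ge0 ?ebb.
have Et : 0 < E t := expR_gt0 _.
rewrite -(ler_pM2l Et) -{1}(gtr0_norm Et) -normrM.
have := ler_normD (E t * D t - D 0) (D 0); rewrite subrK; lra.
Qed.

Lemma expRN_le_inv x : 0 < x -> expR (- x) <= x^-1.
Proof.
move=> x0; rewrite expRN lef_pV2 ?posrE ?expR_gt0 //.
by apply: le_trans (expR_ge1Dx x); lra.
Qed.

Lemma expRN_le_inv2 x : 0 < x -> expR (- x) <= 2 / x ^+ 2.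
Proof.
move=> x0; rewrite expRN -[2 / _]invf_div lef_pV2 ?posrE ?expR_gt0 ?divr_gt0 ?exprn_gt0 //.
by apply: le_trans (expR_ge1Dxn 1 (ltW x0)); rewrite (_ : 2`!%:R = 2 :> R) //; lra.
Qed.

(** Jordan's inequality with a crude constant: sin y >= y/2 on [0, 1] because cos >= 1/2 there, and
    beyond 1 monotonicity gives sin x >= 1/2 >= x/4, as x <= pi/2 < 2. *)
Lemma sin_ge_quarter x : 0 <= x <= pi / 2 -> x / 4 <= sin x.
Proof.
move=> /andP[x0 xpi].
have pi2 := pihalf_lt2 R; have pi1 := pihalf_ge1 R.
have low (y : R) : 0 <= y <= 1 -> y / 2 <= sin y.
  move=> /andP[y0 y1].
  have := @derive_le (fun y => y / 2) sin (fun=> 1 / 2) cos 0 y y0.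
  rewrite mul0r !subr0 sin0 subr0; apply=> [u _|u /andP[u0 uy]].
  - by apply: is_derive_eq; rewrite /GRing.scale /=; lra.
  - have := @derive_norm_le cos (fun u => u ^+ 2 / 2) (fun u => - sin u) id 0 u u0.
    rewrite cos0 expr0n /= mul0r subr0 => H.
    have : `|cos u - 1| <= u ^+ 2 / 2.
      apply: H => [v _|v /andP[v0 _]].
      + by apply: is_derive_eq; rewrite /GRing.scale /=; lra.
      + have := @derive_norm_le sin id cos (fun=> 1) 0 v v0.
        rewrite sin0 !subr0 normrN; apply=> // w _.
        exact: cos_max.
    rewrite ler_norml => /andP[+ _].
    have : u ^+ 2 <= 1 by rewrite expr_le1 //; lra.
    lra.
have [x1|x1] := leP x 1; first by have := low x; lra.
have : sin 1 <= sin x.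
  by rewrite leNgt ltr_sin ?in_itv /= -?leNgt; lra.
have := low 1; lra.
Qed.

Lemma one_sub_cos_ge t : 0 <= t <= pi -> t ^+ 2 / 32 <= 1 - cos t.
Proof.
move=> t0; have -> : 1 - cos t = 2 * sin (t / 2) ^+ 2.
  rewrite {1}(_ : t = (t / 2) *+ 2); last by rewrite -mulr_natr divfK.
  by rewrite cos_mulr2n cos2sin2; ring.
have : t / 2 / 4 <= sin (t / 2) by apply: sin_ge_quarter; lra.
move=> h; have : (t / 8) ^+ 2 <= sin (t / 2) ^+ 2.
  by rewrite lerXn2r // ?nnegrE; lra.
by lra.
Qed.

Lemma one_sub_cos_ge_sin2 t : sin t ^+ 2 / 2 <= 1 - cos t.
Proof. by rewrite sin2cos2; have := cos_le1 t; have := cos_geN1 t; nra. Qed.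

End RealAnalysis.

(** * Signed measures with finitely many integer atoms, and Fourier inversion *)

Section FourierInversion.
Local Open Scope classical_set_scope.
Variable R : realType.
Implicit Types (s : seq (R * int)) (theta t x : R) (J : int).

(** A list of weights and positions encodes a signed measure, repeated positions adding up. [osc] is
    the real part of exp(i theta) times its characteristic function; letting theta vary recovers the
    modulus. *)
Definition osc s theta t : R := \sum_(c <- s) c.1 * cos (theta + t * c.2%:~R).

Definition mass s J : R := \sum_(c <- s | c.2 == J) c.1.

(** Antiderivative of the inversion integrand at J. On [0, pi] the terms with c.2 <> J vanish at
    both ends, sin being 0 at integer multiples of pi, so pi times the mass at J remains. *)
Definition osc_primitive s J t : R :=
  \sum_(c <- s) c.1 *
    (if c.2 == J then t else sin (t * (c.2 - J)%:~R) / (c.2 - J)%:~R).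

Lemma is_derive_osc_primitive s J t :
  is_derive t 1 (osc_primitive s J) (osc s (- (t * J%:~R)) t).
Proof.
rewrite /osc_primitive /osc; elim: s => [|c s IH].
  rewrite big_nil; have -> : (fun t : R => \sum_(c <- [::] : seq (R * int))
      c.1 * (if c.2 == J then t else sin (t * (c.2 - J)%:~R) / (c.2 - J)%:~R)) = cst 0.
    by apply/funext => u; rewrite big_nil.
  exact: is_derive_cst.
rewrite big_cons.
set f := fun t : R => \sum_(c <- s) _ in IH.
have -> : (fun t : R => \sum_(c <- c :: s)
      c.1 * (if c.2 == J then t else sin (t * (c.2 - J)%:~R) / (c.2 - J)%:~R)) =
    (fun t => c.1 * (if c.2 == J then t else sin (t * (c.2 - J)%:~R) / (c.2 - J)%:~R) + f t).
  by apply/funext => u; rewrite big_cons.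
apply: is_deriveD; case: eqP => [->|/eqP cJ].
  by apply: is_derive_eq; rewrite addNr cos0 /GRing.scale /=; ring.
have x0 : (c.2 - J)%:~R != 0 :> R by rewrite intr_eq0 subr_eq0.
have -> : - (t * J%:~R) + t * c.2%:~R = 0 + t * (c.2 - J)%:~R :> R.
  by rewrite intrB; ring.
have := is_derive_sin_affine 0 ((c.2 - J)%:~R : R) t.
have -> : (fun t : R => sin (0 + t * (c.2 - J)%:~R)) = (fun t => sin (t * (c.2 - J)%:~R)).
  by apply/funext => u; rewrite add0r.
move: ((c.2 - J)%:~R) x0 => x x0 h.
by apply: is_derive_eq; rewrite /GRing.scale /=; field.
Qed.

Lemma sin_int_pi (k : int) : sin (pi * k%:~R) = 0 :> R.
Proof.
have nat_case (n : nat) : sin (pi * n%:R) = 0 :> R.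
  have := alternatingn (@sinDpi R) n 0.
  by rewrite add0r sin0 mulr0 mulr_natr.
case: k => n; first exact: nat_case.
by rewrite NegzE intrN mulrN sinN nat_case oppr0.
Qed.

Lemma osc_primitive0 s J : osc_primitive s J 0 = 0.
Proof.
rewrite /osc_primitive big1 // => c _.
by rewrite mul0r sin0 mul0r if_same mulr0.
Qed.

Lemma osc_primitive_pi s J : osc_primitive s J pi = pi * mass s J.
Proof.
rewrite /osc_primitive /mass [in RHS]big_mkcond big_distrr /=; apply: eq_bigr => c _.
by case: eqP => _; rewrite ?sin_int_pi; ring.
Qed.

(** Averaging the inversion formulas at J and J - 1 shifts the phase by half a step and produces the
    factor cos(t/2), which vanishes at pi. *)
Definition osc_primitive2 s J t : R :=
  2^-1 * (osc_primitive s J t + osc_primitive s (J - 1) t).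

Lemma is_derive_osc_primitive2 s J t :
  is_derive t 1 (osc_primitive2 s J)
    (cos (t / 2) * osc s (- (t * J%:~R) + t / 2) t).
Proof.
have h1 := is_derive_osc_primitive s J t.
have h2 := is_derive_osc_primitive s (J - 1) t.
have -> : cos (t / 2) * osc s (- (t * J%:~R) + t / 2) t =
   (osc s (- (t * J%:~R)) t + osc s (- (t * (J - 1)%:~R)) t) / 2.
  rewrite /osc -big_split /= big_distrr big_distrl /=; apply: eq_bigr => c _.
  set u := - (t * J%:~R) + t / 2 + t * c.2%:~R.
  have -> : - (t * J%:~R) + t * c.2%:~R = u - t / 2 by rewrite /u; lra.
  have -> : - (t * (J - 1)%:~R) + t * c.2%:~R = u + t / 2.
    by rewrite /u intrB mulr1z; field.
  by rewrite (cosB u) (cosD u); lra.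
apply: (@is_derive_eq _ _ _ (2^-1 *: (osc_primitive s J + osc_primitive s (J - 1)))).
by rewrite /GRing.scale /=; lra.
Qed.

End FourierInversion.

(** * Estimates on the separate ranges of t *)

Section Pieces.
Local Open Scope classical_set_scope.
Variables (R : realType) (z : R).
Hypothesis z01 : 0 < z <= 1.
Implicit Types (P : R -> R) (C K c b : R).

(** Below the cut: C (t^2/2 + z^4 t) at t = z^3 is C (z^6/2 + z^7), and z <= 1. *)
Lemma piece_low P (P' : R -> R) C : 0 <= C ->
  (forall t : R, 0 <= t <= z ^+ 3 -> is_derive t 1 P (P' t)) ->
  (forall t : R, 0 <= t <= z ^+ 3 -> `|P' t| <= C * (t + z ^+ 4)) ->
  `|P (z ^+ 3) - P 0| <= 2 * C * z ^+ 6.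
Proof.
move=> C0 dP bP; have /andP[z0 z1] := z01.
have h := @derive_norm_le R P (fun t => C * (t ^+ 2 / 2 + z ^+ 4 * t)) P'
  (fun t => C * (t + z ^+ 4)) 0 (z ^+ 3) (exprn_ge0 3 (ltW z0)) dP _ bP.
apply: le_trans (h _) _ => [t _|].
  by apply: is_derive_eq; rewrite /GRing.scale /=; lra.
have : z ^+ 7 <= z ^+ 6 by rewrite exprS ler_piMl // exprn_ge0 // ltW.
have : 0 <= z ^+ 6 by rewrite exprn_ge0 // ltW.
rewrite expr0n /= mul0r mulr0 addr0 mulr0 subr0 -exprM -exprD; nra.
Qed.

(** From the cut to b: exp(-x) <= 2/x^2 turns the Gaussian into A/t^4, whose antiderivative at z^3
    is of order z^16/z^9 = z^7. The bound b <= 4 covers both pi and pi/2. *)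
Lemma piece_mid P (P' : R -> R) K c b : 0 <= K -> 0 < c -> z ^+ 3 <= b <= 4 ->
  (forall t : R, z ^+ 3 <= t <= b -> is_derive t 1 P (P' t)) ->
  (forall t : R, z ^+ 3 <= t <= b ->
     `|P' t| <= K * z ^+ 8 + K * expR (- (c * t ^+ 2 / z ^+ 8))) ->
  `|P b - P (z ^+ 3)| <= (4 * K + K / c ^+ 2) * z ^+ 6.
Proof.
move=> K0 c0 /andP[zb b4] dP bP; have /andP[z0 z1] := z01.
have z30 : 0 < z ^+ 3 by rewrite exprn_gt0.
pose A := 2 * z ^+ 16 / c ^+ 2.
have A0 : 0 <= A by rewrite /A divr_ge0 ?mulr_ge0 ?exprn_ge0 // ltW.
have h := @derive_norm_le R P (fun t => K * z ^+ 8 * t + K * (- (A / 3) * (t ^+ 3)^-1)) P'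
  (fun t => K * z ^+ 8 + K * (A * (t ^+ 4)^-1)) (z ^+ 3) b zb dP.
apply: le_trans (h _ _) _ => [t /andP[zt tb]|t ztb|].
- have t0 : 0 < t by apply: lt_le_trans zt.
  have t3 : t ^+ 3 != 0 by rewrite expf_neq0 // gt_eqF.
  have dX : is_derive t 1 (fun t : R => t ^+ 3) (3 * t ^+ 2).
    by apply: is_derive_eq; rewrite /GRing.scale /=; ring.
  have dv := @is_deriveV R (fun t => t ^+ 3) _ _ _ t3 dX.
  by apply: is_derive_eq; rewrite /GRing.scale /=; field; rewrite ?gt_eqF.
- apply: le_trans (bP t ztb) _; rewrite lerD2l ler_wpM2l //.
  have /andP[zt _] := ztb; have t0 : 0 < t by apply: lt_le_trans zt.
  apply: le_trans (expRN_le_inv2 _) _.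
    by rewrite divr_gt0 ?mulr_gt0 ?exprn_gt0.
  by rewrite le_eqVlt; apply/orP; left; apply/eqP; rewrite /A; field; rewrite ?gt_eqF.
have b0 : 0 < b by apply: lt_le_trans zb.
have e1 : K * (- (A / 3) * (b ^+ 3)^-1) <= 0.
  by rewrite mulNr mulrN oppr_le0 !mulr_ge0 // ?invr_ge0 ?exprn_ge0 // ltW.
have -> : K * z ^+ 8 * b + K * (- (A / 3) * (b ^+ 3)^-1) -
  (K * z ^+ 8 * z ^+ 3 + K * (- (A / 3) * ((z ^+ 3) ^+ 3)^-1)) =
  K * z ^+ 8 * (b - z ^+ 3) + K * (- (A / 3) * (b ^+ 3)^-1) + 2 / 3 * (K / c ^+ 2) * z ^+ 7.
  by rewrite /A; field; rewrite !gt_eqF.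
have z76 : z ^+ 7 <= z ^+ 6 by rewrite exprS ler_piMl // exprn_ge0 // ltW.
have z86 : z ^+ 8 <= z ^+ 6 by rewrite -[8%N]/(2 + 6)%N exprD ler_piMl ?exprn_ge0 ?exprn_ile1 // ltW.
have Kc : 0 <= K / c ^+ 2 by rewrite divr_ge0 // exprn_ge0 // ltW.
have z60 : 0 <= z ^+ 6 by rewrite exprn_ge0 // ltW.
have z70 : 0 <= z ^+ 7 by rewrite exprn_ge0 // ltW.
have i1 : K * z ^+ 8 * (b - z ^+ 3) <= K * z ^+ 6 * 4.
  by apply: ler_pM; [rewrite mulr_ge0 // exprn_ge0 // ltW | rewrite subr_ge0 | exact: ler_wpM2l | lra].
have i2 : K / c ^+ 2 * z ^+ 7 <= K / c ^+ 2 * z ^+ 6 by exact: ler_wpM2l.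
have i3 : 0 <= K / c ^+ 2 * z ^+ 7 by exact: mulr_ge0.
lra.
Qed.

(** For r = pi. The factor r - t makes the Gaussian term the exact derivative of K/(2a) exp(-a
    (r-t)^2), with 1/a of order z^8. *)
Lemma piece_high_smooth P (P' : R -> R) K c l r : 1 <= r - l <= 2 -> 0 <= K -> 0 < c ->
  (forall t : R, l <= t <= r -> is_derive t 1 P (P' t)) ->
  (forall t : R, l <= t <= r ->
     `|P' t| <= K * z ^+ 8 + K * (r - t) * expR (- (c * (r - t) ^+ 2 / z ^+ 8))) ->
  `|P r - P l| <= (2 * K + K / c) * z ^+ 6.
Proof.
move=> /andP[rl1 rl2] K0 c0 dP bP; have /andP[z0 z1] := z01.
have z86 : z ^+ 8 <= z ^+ 6 by rewrite -[8%N]/(2 + 6)%N exprD ler_piMl ?exprn_ge0 ?exprn_ile1 // ltW.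
have z80 : 0 < z ^+ 8 by rewrite exprn_gt0.
pose a := c / z ^+ 8.
have a0 : 0 < a by rewrite divr_gt0.
have h := @derive_norm_le R P (fun t => K * z ^+ 8 * t + K / (2 * a) * expR (- (a * (r - t) ^+ 2))) P'
  (fun t => K * z ^+ 8 + K * (r - t) * expR (- (a * (r - t) ^+ 2))) (l) r _ dP.
apply: le_trans (h _ _ _) _ => [|t _|t tp|].
- by lra.
- have d1 : is_derive t 1 (fun t : R => - (a * (r - t) ^+ 2)) (2 * a * (r - t)).
    by apply: is_derive_eq; rewrite /GRing.scale /=; lra.
  have d2 : is_derive t 1 (fun t : R => expR (- (a * (r - t) ^+ 2)))
      (expR (- (a * (r - t) ^+ 2)) * (2 * a * (r - t))) by apply: is_derive_eq.
  by apply: is_derive_eq; rewrite /GRing.scale /=; field; rewrite gt_eqF.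
- apply: le_trans (bP t tp) _; rewrite (_ : a * _ = c * (r - t) ^+ 2 / z ^+ 8) //.
  by rewrite /a mulrAC.
rewrite subrr expr0n /= mulr0 oppr0 expR0 mulr1.
set e := expR _; have e0 : 0 <= e by apply: expR_ge0.
have ka : K / (2 * a) = K / c * z ^+ 8 / 2 by rewrite /a; field; rewrite !gt_eqF.
have ka0 : 0 <= K / (2 * a) by rewrite divr_ge0 // mulr_ge0 // ltW.
have Kc : 0 <= K / c by rewrite divr_ge0 // ltW.
have i1 : K * z ^+ 8 <= K * z ^+ 6 by exact: ler_wpM2l.
have i2 : K / c * z ^+ 8 <= K / c * z ^+ 6 by exact: ler_wpM2l.
have i3 : 0 <= K / (2 * a) * e by exact: mulr_ge0.
have i4 : K * z ^+ 8 * (r - l) <= K * z ^+ 6 * 2.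
  by apply: ler_pM => //; [apply: mulr_ge0 => //; exact: ltW | lra].
have i5 : 0 <= K / c * z ^+ 8 by rewrite mulr_ge0 // ltW.
lra.
Qed.

(** Without the factor r - t the Gaussian contributes its width z^4; any further smallness must come
    from the damping E. *)
Lemma piece_high_rough P (P' : R -> R) K c (E l r : R) : 1 <= r - l <= 2 -> 0 <= K -> 0 <= E -> 0 < c ->
  (forall t : R, l <= t <= r -> is_derive t 1 P (P' t)) ->
  (forall t : R, l <= t <= r ->
     `|P' t| <= K * z ^+ 8 + K * E * expR (- (c * (r - t) ^+ 2 / z ^+ 8))) ->
  `|P r - P l| <= 4 * K * z ^+ 6 + (K + K / c) * E * z ^+ 4.
Proof.
move=> /andP[rl1 rl2] K0 E0 c0 dP bP; have /andP[z0 z1] := z01.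
have z86 : z ^+ 8 <= z ^+ 6 by rewrite -[8%N]/(2 + 6)%N exprD ler_piMl ?exprn_ge0 ?exprn_ile1 // ltW.
have z80 : 0 < z ^+ 8 by rewrite exprn_gt0.
have z40 : 0 < z ^+ 4 by rewrite exprn_gt0.
have z41 : z ^+ 4 <= 1 by rewrite exprn_ile1 // ltW.
(* Within one width z^4 of r the exponential is bounded by 1; farther away exp(-x) <= 1/x gives an
   inverse square with an explicit antiderivative. *)
set m := r - z ^+ 4.
have pm : l <= m <= r by rewrite /m; apply/andP; split; lra.
have KE : 0 <= K * E by rewrite mulr_ge0.
have near_pi : `|P r - P m| <= K * z ^+ 8 * (r - m) + K * E * z ^+ 4.
  have h := @derive_norm_le R P (fun t => (K * z ^+ 8 + K * E) * t) P'
    (fun t => K * z ^+ 8 + K * E) m r.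
  apply: le_trans (h _ _ _ _) _ => [|t tp|t tp|t tp|].
  - by lra.
  - by apply: dP; lra.
  - by apply: is_derive_eq; rewrite /GRing.scale /=; lra.
  - apply: le_trans (bP t _) _; first by lra.
    rewrite lerD2l ler_piMr // expR_le1 oppr_le0.
    by apply: divr_ge0; [apply: mulr_ge0; [exact: ltW | exact: sqr_ge0] | exact: ltW].
  by rewrite /m; lra.
have far : `|P m - P l| <= K * z ^+ 8 * (m - l) + K * E / c * z ^+ 4.
  have h := @derive_norm_le R P
    (fun t => K * z ^+ 8 * t + K * E * z ^+ 8 / c * (r - t)^-1) P'
    (fun t => K * z ^+ 8 + K * E * z ^+ 8 / c * ((r - t) ^+ 2)^-1) (l) m.
  apply: le_trans (h _ _ _ _) _ => [|t tp|t tp|t tp|].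
  - by lra.
  - by apply: dP; lra.
  - have t0 : r - t != 0 by rewrite gt_eqF // subr_gt0; rewrite /m in tp; lra.
    have dl : is_derive t 1 (fun t : R => r - t) (-1).
      by apply: is_derive_eq; rewrite /GRing.scale /=; ring.
    have dv := @is_deriveV R (fun t => r - t) _ _ _ t0 dl.
    by apply: is_derive_eq; rewrite /GRing.scale /=; field; rewrite t0 gt_eqF.
  - have t0 : 0 < r - t by rewrite subr_gt0; rewrite /m in tp; lra.
    apply: le_trans (bP t _) _; first by lra.
    have -> : K * E * z ^+ 8 / c * ((r - t) ^+ 2)^-1 =
        K * E * (c * (r - t) ^+ 2 / z ^+ 8)^-1 by field; rewrite !gt_eqF.
    rewrite lerD2l ler_wpM2l //; apply: expRN_le_inv.
    by apply: divr_gt0 => //; apply: mulr_gt0 => //; apply: exprn_gt0.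
  have -> : r - m = z ^+ 4 by rewrite /m; ring.
  have -> : K * E * z ^+ 8 / c * (z ^+ 4)^-1 = K * E / c * z ^+ 4.
    by field; rewrite !gt_eqF.
  have : 0 <= K * E * z ^+ 8 / c * (r - l)^-1.
    apply: mulr_ge0; last by rewrite invr_ge0; lra.
    apply: mulr_ge0; first by apply: mulr_ge0 => //; apply: ltW.
    by rewrite invr_ge0 ltW.
  lra.
have -> : P r - P l = (P r - P m) + (P m - P l) by ring.
apply: le_trans (ler_normD _ _) _.
have i4 : K * z ^+ 8 * (r - l) <= K * z ^+ 6 * 2.
  by apply: ler_pM => //; [apply: mulr_ge0 => //; exact: ltW | lra | exact: ler_wpM2l].
have i5 : 0 <= K * z ^+ 6 by rewrite mulr_ge0 // exprn_ge0 // ltW.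
have -> : (K + K / c) * E * z ^+ 4 = K * E * z ^+ 4 + K * E / c * z ^+ 4 by ring.
lra.
Qed.

End Pieces.

(** * Point mass bounds from bounds on the characteristic function *)

Section MassBounds.
Local Open Scope classical_set_scope.
Variables (R : realType) (z : R) (s : seq (R * int)) (C K c : R).
Hypotheses (z01 : 0 < z <= 1) (C0 : 0 <= C) (K0 : 0 <= K) (c0 : 0 < c).
Hypothesis osc_low : forall theta t : R, 0 <= t <= z ^+ 3 ->
  `|osc s theta t| <= C * (t + z ^+ 4).

Lemma cut_le1 : 0 < z ^+ 3 <= 1.
Proof. by case/andP: z01 => z0 z1; rewrite exprn_gt0 // exprn_ile1 // ltW. Qed.

(** With decay in t^2 on all of [0, pi], the low piece and the middle piece with b = pi cover
    everything. *)
Lemma mass_bound J :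
  (forall theta t : R, 0 <= t <= pi ->
    `|osc s theta t| <= K * z ^+ 8 + K * expR (- (c * t ^+ 2 / z ^+ 8))) ->
  `|mass s J| <= (2 * C + 4 * K + K / c ^+ 2) * z ^+ 6.
Proof.
move=> osc_mid.
have pi2 := pihalf_lt2 R; have pi1 := pihalf_ge1 R.
have /andP[z30 z31] := cut_le1.
have h1 := @piece_low _ _ z01 (osc_primitive s J) (fun t => osc s (- (t * J%:~R)) t)
  C C0 (fun t _ => is_derive_osc_primitive s J t) (fun t ht => osc_low _ ht).
have zpi : z ^+ 3 <= (pi : R) <= 4 by lra.
have h2 := @piece_mid _ _ z01 (osc_primitive s J) (fun t => osc s (- (t * J%:~R)) t)
  K c pi K0 c0 zpi (fun t _ => is_derive_osc_primitive s J t).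
have : `|osc_primitive s J pi - osc_primitive s J (z ^+ 3)| <= (4 * K + K / c ^+ 2) * z ^+ 6.
  by apply: h2 => t ht; apply: osc_mid; lra.
move: h1; rewrite osc_primitive0 osc_primitive_pi subr0 => h1 {}h2.
have := ler_normD (pi * mass s J - osc_primitive s J (z ^+ 3)) (osc_primitive s J (z ^+ 3)).
rewrite subrK normrM (gtr0_norm (pi_gt0 R)).
have : `|mass s J| <= pi * `|mass s J| by rewrite ler_peMl //; lra.
lra.
Qed.

Section Lattice2.
Hypothesis osc_mid : forall theta t : R, 0 <= t <= pi ->
  `|osc s theta t| <= K * z ^+ 8 + K * expR (- (c * sin t ^+ 2 / z ^+ 8)).

Lemma osc_below_pihalf theta (t : R) : 0 <= t <= pi / 2 ->
  `|osc s theta t| <= K * z ^+ 8 + K * expR (- (c / 16 * t ^+ 2 / z ^+ 8)).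
Proof.
move=> ht; have pi1 := pihalf_ge1 R.
apply: le_trans (osc_mid _ _) _; first by lra.
rewrite lerD2l ler_wpM2l // ler_expR lerN2 ler_pM2r ?invr_gt0 ?exprn_gt0 //; last by case/andP: z01.
have := sin_ge_quarter ht => h.
have : (t / 4) ^+ 2 <= sin t ^+ 2 by rewrite lerXn2r // ?nnegrE; lra.
have -> : c / 16 * t ^+ 2 = c * (t / 4) ^+ 2 by field.
by rewrite ler_pM2l.
Qed.

Lemma exp_sin_above_pihalf (t : R) : pi / 2 <= t <= pi ->
  expR (- (c * sin t ^+ 2 / z ^+ 8)) <= expR (- (c / 16 * (pi - t) ^+ 2 / z ^+ 8)).
Proof.
move=> ht.
rewrite ler_expR lerN2 ler_pM2r ?invr_gt0 ?exprn_gt0 //; last by case/andP: z01.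
have -> : sin t = sin (pi - t) by rewrite sinB sinpi cospi; ring.
have : 0 <= pi - t <= pi / 2 by lra.
move: (pi - t : R) => u u01; have h := sin_ge_quarter u01.
have : (u / 4) ^+ 2 <= sin u ^+ 2 by rewrite lerXn2r // ?nnegrE; lra.
have -> : c / 16 * u ^+ 2 = c * (u / 4) ^+ 2 by field.
by rewrite ler_pM2l.
Qed.

(** Decay in sin t gives nothing at pi. There |cos(t/2)| <= pi - t helps, available because the
    masses at J and J - 1 are averaged. *)
Lemma mass2_bound J :
  `|(mass s J + mass s (J - 1)) / 2| <=
  (2 * C + 6 * K + K / (c / 16) ^+ 2 + K / (c / 16)) * z ^+ 6.
Proof.
have pi2 := pihalf_lt2 R; have pi1 := pihalf_ge1 R.
have /andP[z30 z31] := cut_le1.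
have c16 : 0 < c / 16 by rewrite divr_gt0.
pose P := osc_primitive2 s J.
pose P' (t : R) := cos (t / 2) * osc s (- (t * J%:~R) + t / 2) t.
have dP (t : R) : is_derive t 1 P (P' t) := is_derive_osc_primitive2 s J t.
have bP (t : R) : `|P' t| <= `|osc s (- (t * J%:~R) + t / 2) t|.
  by rewrite normrM ler_piMl // cos_max.
have h1 : `|P (z ^+ 3) - P 0| <= 2 * C * z ^+ 6.
  apply: (piece_low z01 C0 (fun t _ => dP t)) => t ht.
  by apply: le_trans (bP t) _; apply: osc_low.
have h2 : `|P (pi / 2) - P (z ^+ 3)| <= (4 * K + K / (c / 16) ^+ 2) * z ^+ 6.
  apply: (piece_mid z01 K0 c16 _ (fun t _ => dP t)) => [|t ht]; first by lra.
  by apply: le_trans (bP t) _; apply: osc_below_pihalf; lra.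
have h3 : `|P pi - P (pi / 2)| <= (2 * K + K / (c / 16)) * z ^+ 6.
  apply: (piece_high_smooth z01 _ K0 c16 (fun t _ => dP t)) => [|t ht]; first by lra.
  have tpi : 0 <= t <= pi by lra.
  have hc : `|cos (t / 2)| <= pi - t.
    have := @cos_lipschitz R (t / 2) (pi / 2 - t / 2).
    rewrite [t / 2 + _]addrC subrK cos_pihalf sub0r normrN => H.
    by apply: le_trans (H _) _; lra.
  rewrite /P' normrM.
  apply: le_trans (ler_wpM2l (normr_ge0 _) (osc_mid _ tpi)) _.
  rewrite mulrDr; apply: lerD.
    by rewrite ler_piMl ?cos_max // mulr_ge0 // exprn_ge0 // ltW //; case/andP: z01.
  rewrite mulrCA -[leRHS]mulrA ler_wpM2l //; apply: ler_pM => //.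
  exact: exp_sin_above_pihalf.
have P0 : P 0 = 0 by rewrite /P /osc_primitive2 !osc_primitive0 addr0 mulr0.
have Ppi : P pi = pi * ((mass s J + mass s (J - 1)) / 2).
  by rewrite /P /osc_primitive2 !osc_primitive_pi; ring.
have : `|(mass s J + mass s (J - 1)) / 2| <= pi * `|(mass s J + mass s (J - 1)) / 2|.
  by rewrite ler_peMl //; lra.
rewrite -{1}(gtr0_norm (pi_gt0 R)) -normrM -Ppi.
have -> : P pi = (P pi - P (pi / 2)) + ((P (pi / 2) - P (z ^+ 3)) + (P (z ^+ 3) - P 0)).
  by rewrite P0; ring.
move/le_trans; apply; apply: le_trans (ler_normD _ _) _.
have := ler_normD (P (pi / 2) - P (z ^+ 3)) (P (z ^+ 3) - P 0).
lra.
Qed.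

(** A single mass brings no factor vanishing at pi, so decay at rate kappa has to supply the
    smallness of the last piece. *)
Lemma mass_bound_lattice2 (kappa : R) J : 0 <= kappa ->
  (forall theta t : R, 0 <= t <= pi ->
    `|osc s theta t| <= K * z ^+ 8 + K * expR (- (kappa * (1 - cos t)))) ->
  `|mass s J| <=
  (2 * C + 8 * K + K / (c / 16) ^+ 2) * z ^+ 6 +
  (K + K / (c / 32)) * expR (- (kappa / 2)) * z ^+ 4.
Proof.
move=> ka0 osc_kappa.
have pi2 := pihalf_lt2 R; have pi1 := pihalf_ge1 R.
have /andP[z30 z31] := cut_le1.
have c16 : 0 < c / 16 by rewrite divr_gt0.
have c32 : 0 < c / 32 by rewrite divr_gt0.
pose P := osc_primitive s J.
pose P' (t : R) := osc s (- (t * J%:~R)) t.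
have dP (t : R) : is_derive t 1 P (P' t) := is_derive_osc_primitive s J t.
have h1 : `|P (z ^+ 3) - P 0| <= 2 * C * z ^+ 6.
  by apply: (piece_low z01 C0 (fun t _ => dP t)) => t ht; apply: osc_low.
have h2 : `|P (pi / 2) - P (z ^+ 3)| <= (4 * K + K / (c / 16) ^+ 2) * z ^+ 6.
  apply: (piece_mid z01 K0 c16 _ (fun t _ => dP t)) => [|t ht]; first by lra.
  by apply: osc_below_pihalf; lra.
have h3 : `|P pi - P (pi / 2)| <=
    4 * K * z ^+ 6 + (K + K / (c / 32)) * expR (- (kappa / 2)) * z ^+ 4.
  apply: (piece_high_rough z01 _ K0 (expR_ge0 _) c32 (fun t _ => dP t)) => [|t ht]; first by lra.
  have tpi : 0 <= t <= pi by lra.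
  have b1 : `|P' t| - K * z ^+ 8 <= K * expR (- (c / 16 * (pi - t) ^+ 2 / z ^+ 8)).
    rewrite lerBlDl; apply: le_trans (osc_mid _ tpi) _; rewrite lerD2l ler_wpM2l //.
    exact: exp_sin_above_pihalf.
  (* On [pi/2, pi] one has 1 - cos t >= 1. *)
  have b2 : `|P' t| - K * z ^+ 8 <= K * expR (- kappa).
    rewrite lerBlDl; apply: le_trans (osc_kappa _ _ tpi) _; rewrite lerD2l ler_wpM2l //.
    rewrite ler_expR lerN2 ler_peMr //.
    have : 0 <= cos (pi - t) by apply: cos_ge0_pihalf; lra.
    by rewrite cosB cospi sinpi mul0r addr0 mulN1r; lra.
  rewrite -lerBlDl -mulrA -expRD.
  set X := c / 16 * (pi - t) ^+ 2 / z ^+ 8 in b1.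
  have -> : c / 32 * (pi - t) ^+ 2 / z ^+ 8 = X / 2.
    rewrite /X; move: (pi - t) => u; field; rewrite gt_eqF //; by case/andP: z01.
  (* min(exp(-X), exp(-kappa)) <= exp(-(X + kappa)/2): both exponents are halved, hence c/32 and
     kappa/2. *)
  have [kX|/ltW kX] := leP kappa X.
    by apply: le_trans b1 _; rewrite ler_wpM2l // ler_expR; lra.
  by apply: le_trans b2 _; rewrite ler_wpM2l // ler_expR; lra.
have P0 : P 0 = 0 by rewrite /P osc_primitive0.
have Ppi : P pi = pi * mass s J by rewrite /P osc_primitive_pi.
have : `|mass s J| <= pi * `|mass s J| by rewrite ler_peMl //; lra.
rewrite -{1}(gtr0_norm (pi_gt0 R)) -normrM -Ppi.
have -> : P pi = (P pi - P (pi / 2)) + ((P (pi / 2) - P (z ^+ 3)) + (P (z ^+ 3) - P 0)).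
  by rewrite P0; ring.
move/le_trans; apply; apply: le_trans (ler_normD _ _) _.
have := ler_normD (P (pi / 2) - P (z ^+ 3)) (P (z ^+ 3) - P 0).
lra.
Qed.

End Lattice2.
End MassBounds.

(** * The truncated Poisson law *)

Section TruncatedPoisson.
Local Open Scope classical_set_scope.
Variables (R : realType) (lam : R).
Hypothesis lam0 : 0 <= lam.
Local Notation pmf := (Defs.poisson_pmf lam).

Lemma is_derive_bigsum (I : Type) (r : seq I) (P : pred I) (h : I -> R -> R)
    (dh : I -> R) (t : R) :
  (forall i, is_derive t 1 (h i) (dh i)) ->
  is_derive t 1 (fun u => \sum_(i <- r | P i) h i u) (\sum_(i <- r | P i) dh i).
Proof.
move=> dhi; elim: r => [|i r IH].
  rewrite big_nil; rewrite (_ : (fun u => _) = cst 0); first exact: is_derive_cst.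
  by apply/funext => u; rewrite big_nil.
rewrite big_cons; case: ifPn => Pi.
  rewrite (_ : (fun u => _) = h i + (fun u => \sum_(j <- r | P j) h j u)).
    exact: is_deriveD.
  by apply/funext => u; rewrite big_cons Pi.
rewrite (_ : (fun u => _) = (fun u => \sum_(j <- r | P j) h j u)) //.
by apply/funext => u; rewrite big_cons (negbTE Pi).
Qed.

Lemma poisson_pmf_ge0 k : 0 <= pmf k.
Proof. by apply: divr_ge0 => //; apply: mulr_ge0; rewrite ?expR_ge0 ?exprn_ge0. Qed.

Lemma poisson_pmfS k : k.+1%:R * pmf k.+1 = lam * pmf k.
Proof.
rewrite /Defs.poisson_pmf factS natrM exprS.
have : k`!%:R != 0 :> R by rewrite pnatr_eq0 -lt0n fact_gt0.
have : k.+1%:R != 0 :> R by rewrite pnatr_eq0.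
by move: (k.+1%:R) (k`!%:R) => a b a0 b0; field; rewrite ?a0 ?b0.
Qed.

Lemma poisson_sum_series n :
  \sum_(k < n) pmf k = expR (- lam) * series (exp_coeff lam) n.
Proof.
rewrite /series /= big_mkord big_distrr; apply: eq_bigr => k _ /=.
by rewrite /Defs.poisson_pmf exp_coeffE /= mulrA mulrAC.
Qed.

Lemma poisson_sum_cvg : (fun n : nat => \sum_(k < n) pmf k) @ \oo --> (1 : R).
Proof.
rewrite (_ : (fun n : nat => _) = (fun n => expR (- lam) * series (exp_coeff lam) n)).
  rewrite -(expRxMexpNx_1 lam) mulrC; apply: cvgM; first exact: cvg_cst.
  exact: is_cvg_series_exp_coeff.
by apply/funext => n; exact: poisson_sum_series.
Qed.

Lemma poisson_sum_le1 n : \sum_(k < n) pmf k <= 1.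
Proof.
have := poisson_sum_cvg => h; rewrite -(cvg_lim _ h) //.
apply: (@nondecreasing_cvgn_le R (fun n : nat => \sum_(k < n) pmf k)).
  apply/nondecreasing_seqP => m; rewrite big_ord_recr /= lerDl.
  exact: poisson_pmf_ge0.
by apply/cvg_ex; exists 1.
Qed.

Lemma poisson_pmf_cvg0 : (fun n : nat => pmf n) @ \oo --> (0 : R).
Proof.
have h1 : (fun n : nat => \sum_(k < n.+1) pmf k - \sum_(k < n) pmf k) @ \oo --> (1 - 1 : R).
  by apply: cvgB; [rewrite (@cvg_shiftS R (fun n => \sum_(k < n) pmf k)) |]; exact: poisson_sum_cvg.
rewrite -(subrr 1); apply: cvg_trans h1; apply: near_eq_cvg; near=> n.
by rewrite big_ord_recr /= addrAC subrr add0r.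
Unshelve. all: by end_near. Qed.

(** The missing mass is the discrepancy of the characteristic functions at 0; N pmf N is the
    boundary term in Stein's identity. The lower bound n0 lets the truncation pass any given
    integer. *)
Lemma poisson_truncation (eps : R) (n0 : nat) : 0 < eps ->
  exists2 N : nat, (n0 <= N)%N &
    1 - eps <= \sum_(k < N) pmf k /\ N%:R * pmf N <= eps.
Proof.
move=> e0.
(* N pmf N equals lam pmf (N-1), so it suffices to have pmf (N-1) <= eps/(lam + 1). *)
have e1 : 0 < eps / (lam + 1) by rewrite divr_gt0 // ltr_wpDl.
have [N1 _ h1] : \forall n \near \oo, pmf n <= eps / (lam + 1).
  have := @cvgr_le _ _ _ _ _ _ poisson_pmf_cvg0 _ e1; exact.
have em : 1 - eps < 1 by lra.
have [N2 _ h2] : \forall n \near \oo, 1 - eps <= \sum_(k < n) pmf k.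
  have := @cvgr_ge _ _ _ _ _ _ poisson_sum_cvg _ em; exact.
exists (n0 + N1 + N2).+1; first by lia.
split; first by apply: h2 => /=; lia.
rewrite poisson_pmfS; have := h1 (n0 + N1 + N2)%N.
move=> /(_ _) h; apply: le_trans (ler_wpM2l lam0 (h _)) _ => /=; first by lia.
rewrite mulrCA -[leRHS]mulr1; apply: ler_wpM2l; first exact: ltW.
by rewrite ler_pdivrMr ?mul1r ?ltr_wpDl // lerDl.
Qed.

(* Poisson analogue of Stein's identity; the last term is the truncation defect. *)
Lemma poisson_stein (f : nat -> R) N :
  \sum_(k < N) k%:R * pmf k * f k =
  lam * (\sum_(k < N) pmf k * f k.+1) - N%:R * pmf N * f N.
Proof.
elim: N => [|N IH]; first by rewrite !big_ord0; ring.
by rewrite !big_ord_recr /= IH poisson_pmfS; ring.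
Qed.

Definition poisson_trig N (theta t : R) : R :=
  \sum_(k < N) pmf k * cos (theta + t * k%:R).

(** The full law has squared modulus exp(-2 lam (1 - cos t)), so its product with A would stay equal
    to 1. Truncation makes the product drift by at most 4 ep exp(4 lam) per unit of t; for t <= 4
    the hypothesis caps the drift at 3, hence the product at 4, whose square root is the constant
    2. *)
Lemma poisson_trig_decay N (theta t : R) : 0 <= t <= 4 ->
  16 * (N%:R * pmf N) * expR (4 * lam) <= 3 ->
  `|poisson_trig N theta t| <= 2 * expR (- (lam * (1 - cos t))).
Proof.
move=> /andP[t0 t4]; set ep := N%:R * pmf N => hep.
have ep0 : 0 <= ep by rewrite mulr_ge0 ?ler0n ?poisson_pmf_ge0.
pose X (u : R) := \sum_(k < N) pmf k * cos (0 + u * k%:R).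
pose Y (u : R) := \sum_(k < N) pmf k * sin (0 + u * k%:R).
have dX (u : R) : is_derive u 1 X (- lam * (sin u * X u + cos u * Y u) + ep * sin (0 + u * N%:R)).
  have -> : - lam * (sin u * X u + cos u * Y u) + ep * sin (0 + u * N%:R) =
      \sum_(k < N) pmf k * - (k%:R * sin (0 + u * k%:R)).
    transitivity (- \sum_(k < N) k%:R * pmf k * sin (0 + u * k%:R)); last first.
      by rewrite -sumrN; apply: eq_bigr => k _; ring.
    rewrite (poisson_stein (fun k => sin (0 + u * k%:R))) -/ep.
    have -> : \sum_(k < N) pmf k * sin (0 + u * k.+1%:R) = sin u * X u + cos u * Y u.
      rewrite /X /Y !big_distrr -big_split; apply: eq_bigr => k _ /=.
      have -> : 0 + u * k.+1%:R = (0 + u * k%:R) + u by rewrite -natr1; ring.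
      by rewrite sinD; ring.
    ring.
  apply: (@is_derive_bigsum _ _ xpredT (fun (k : 'I_N) u => pmf k * cos (0 + u * k%:R))) => k.
  by apply: is_deriveZ; apply: is_derive_cos_affine.
have dY (u : R) : is_derive u 1 Y (lam * (cos u * X u - sin u * Y u) - ep * cos (0 + u * N%:R)).
  have -> : lam * (cos u * X u - sin u * Y u) - ep * cos (0 + u * N%:R) =
      \sum_(k < N) pmf k * (k%:R * cos (0 + u * k%:R)).
    transitivity (\sum_(k < N) k%:R * pmf k * cos (0 + u * k%:R)); last first.
      by apply: eq_bigr => k _; ring.
    rewrite (poisson_stein (fun k => cos (0 + u * k%:R))) -/ep.
    have -> : \sum_(k < N) pmf k * cos (0 + u * k.+1%:R) = cos u * X u - sin u * Y u.
      rewrite /X /Y !big_distrr -sumrB; apply: eq_bigr => k _ /=.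
      have -> : 0 + u * k.+1%:R = (0 + u * k%:R) + u by rewrite -natr1; ring.
      by rewrite cosD; ring.
    ring.
  apply: (@is_derive_bigsum _ _ xpredT (fun (k : 'I_N) u => pmf k * sin (0 + u * k%:R))) => k.
  by apply: is_deriveZ; apply: is_derive_sin_affine.
have bound (g : R -> R) : (forall x, `|g x| <= 1) -> forall u : R,
    `|\sum_(k < N) pmf k * g (0 + u * k%:R)| <= 1.
  move=> g1 u; apply: le_trans (ler_norm_sum _ _ _) _.
  apply: le_trans (poisson_sum_le1 N); apply: ler_sum => k _.
  by rewrite normrM ger0_norm ?poisson_pmf_ge0 // ler_piMr ?poisson_pmf_ge0.
have bX := bound _ (@cos_max R); have bY := bound _ (@sin_max R).
pose A (u : R) := expR (2 * lam * (1 - cos u)).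
have dA (u : R) : is_derive u 1 A (A u * (2 * lam * sin u)).
  have h : is_derive u 1 (fun u : R => 2 * lam * (1 - cos u)) (2 * lam * sin u).
    by apply: is_derive_eq; rewrite /GRing.scale /=; ring.
  by apply: is_derive_eq.
have Ale (u : R) : A u <= expR (4 * lam).
  rewrite ler_expR -subr_ge0 (_ : _ - _ = 2 * lam * (cos u - -1)); last by ring.
  by rewrite !mulr_ge0 // subr_ge0 cos_geN1.
have := @derive_norm_le R (fun u => A u * (X u ^+ 2 + Y u ^+ 2))
  (fun u => 4 * ep * expR (4 * lam) * u)
  (fun u => A u * (2 * ep * (X u * sin (0 + u * N%:R) - Y u * cos (0 + u * N%:R))))
  (fun=> 4 * ep * expR (4 * lam)) 0 t t0.
rewrite mulr0 subr0 => H.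
have {}H : `|A t * (X t ^+ 2 + Y t ^+ 2) - A 0 * (X 0 ^+ 2 + Y 0 ^+ 2)|
    <= 4 * ep * expR (4 * lam) * t.
  apply: H => [u _|u _|u _].
  - have d1 := dX u; have d2 := dY u; have d3 := dA u.
    by apply: is_derive_eq; rewrite /GRing.scale /=; ring.
  - by apply: is_derive_eq; rewrite /GRing.scale /=; ring.
  - rewrite normrM (ger0_norm (expR_ge0 _)) mulrC.
    apply: ler_pM (normr_ge0 _) (expR_ge0 _) _ (Ale u).
    have -> : 4 * ep = 2 * ep * 2 by ring.
    have e2 : 0 <= 2 * ep by exact: mulr_ge0.
    rewrite normrM (ger0_norm e2); apply: ler_wpM2l => //.
    apply: le_trans (ler_normB _ _) _; rewrite !normrM.
    have := bX u; have := bY u; rewrite -/(X u) -/(Y u) => y1 x1.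
    have s1 := sin_max (0 + u * N%:R); have c1 := cos_max (0 + u * N%:R).
    have : `|X u| * `|sin (0 + u * N%:R)| <= 1 * 1 by apply: ler_pM.
    have : `|Y u| * `|cos (0 + u * N%:R)| <= 1 * 1 by apply: ler_pM.
    lra.
have A0 : A 0 = 1 by rewrite /A cos0 subrr mulr0 expR0.
have XY0 : X 0 ^+ 2 + Y 0 ^+ 2 <= 1.
  have -> : Y 0 = 0 by rewrite /Y big1 // => k _; rewrite mul0r addr0 sin0 mulr0.
  rewrite expr0n addr0; have := bX 0; rewrite -/(X 0) => h.
  by rewrite -real_normK ?num_real // expr_le1.
have {H} : A t * (X t ^+ 2 + Y t ^+ 2) <= 4.
  have := ler_norm (A t * (X t ^+ 2 + Y t ^+ 2) - A 0 * (X 0 ^+ 2 + Y 0 ^+ 2)).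
  rewrite A0 mul1r in H * => h.
  have : 4 * ep * expR (4 * lam) * t <= 4 * ep * expR (4 * lam) * 4.
    by apply: ler_wpM2l => //; apply: mulr_ge0; [exact: mulr_ge0 | exact: expR_ge0].
  lra.
rewrite -ler_pdivlMl ?expR_gt0 // => XYt.
have -> : poisson_trig N theta t = cos theta * X t - sin theta * Y t.
  rewrite /X /Y !big_distrr -sumrB; apply: eq_bigr => k _ /=.
  by rewrite cosD add0r; ring.
rewrite -(@ler_pXn2r _ 2) ?nnegrE ?normr_ge0 ?mulr_ge0 ?expR_ge0 // real_normK ?num_real //.
have -> : (2 * expR (- (lam * (1 - cos t)))) ^+ 2 = (A t)^-1 * 4.
  by rewrite exprMn -expRM_natl /A -expRN mulrC; congr (expR _ * _); ring.
apply: le_trans XYt.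
have := cos2Dsin2 theta; move: (cos theta) (sin theta) (X t) (Y t) => c s x y cs.
have := sqr_ge0 (s * x + c * y).
have -> : x ^+ 2 + y ^+ 2 = (c ^+ 2 + s ^+ 2) * (x ^+ 2 + y ^+ 2) by rewrite cs mul1r.
nra.
Qed.

(** The phase theta - u lam centres the law. [e] collects the second order Taylor remainder of a
    unit jump in Stein's identity and the truncation term. *)
Lemma poisson_ode N (theta : R) : exists e : R -> R,
  (forall t : R, is_derive t 1 (fun u => poisson_trig N (theta - u * lam) u)
     (- lam * t * poisson_trig N (theta - t * lam) t + e t)) /\
  (forall t : R, 0 <= t -> `|e t| <= lam * t ^+ 2 / 2 + N%:R * pmf N).
Proof.
set ep := N%:R * pmf N.
have ep0 : 0 <= ep by rewrite mulr_ge0 ?ler0n ?poisson_pmf_ge0.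
pose f (t : R) (k : nat) : R := sin (theta + t * (k%:R - lam)).
pose c (t : R) (k : nat) : R := cos (theta + t * (k%:R - lam)).
have gE (t : R) : poisson_trig N (theta - t * lam) t = \sum_(k < N) pmf k * c t k.
  by apply: eq_bigr => k _; rewrite /c; congr (_ * cos _); ring.
exists (fun t => - lam * (\sum_(k < N) pmf k * (f t k.+1 - f t k - t * c t k)) + ep * f t N).
split=> t.
  have -> : (fun u => poisson_trig N (theta - u * lam) u) = (fun u => \sum_(k < N) pmf k * c u k).
    by apply/funext.
  rewrite gE.
  have -> : - lam * t * (\sum_(k < N) pmf k * c t k) +
      (- lam * (\sum_(k < N) pmf k * (f t k.+1 - f t k - t * c t k)) + ep * f t N) =
      \sum_(k < N) pmf k * - ((k%:R - lam) * f t k).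
    have -> : \sum_(k < N) pmf k * - ((k%:R - lam) * f t k) =
        - (\sum_(k < N) k%:R * pmf k * f t k) + lam * \sum_(k < N) pmf k * f t k.
      by rewrite -sumrN big_distrr -big_split; apply: eq_bigr => k _ /=; ring.
    rewrite (poisson_stein (f t)) -/ep.
    have -> : \sum_(k < N) pmf k * (f t k.+1 - f t k - t * c t k) =
        \sum_(k < N) pmf k * f t k.+1 - \sum_(k < N) pmf k * f t k -
        t * \sum_(k < N) pmf k * c t k.
      by rewrite big_distrr -!sumrB; apply: eq_bigr => k _ /=; ring.
    ring.
  apply: (@is_derive_bigsum _ _ xpredT (fun (k : 'I_N) u => pmf k * c u k)) => k.
  by apply: is_deriveZ; apply: is_derive_cos_affine.
move=> t0; apply: le_trans (ler_normD _ _) _; apply: lerD; last first.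
  by rewrite normrM ger0_norm // ler_piMr // sin_max.
rewrite mulNr normrN normrM ger0_norm // -mulrA ler_wpM2l //.
apply: le_trans (ler_norm_sum _ _ _) _.
apply: (@le_trans _ _ (\sum_(k < N) pmf k * (t ^+ 2 / 2))).
  apply: ler_sum => k _; rewrite normrM ger0_norm ?poisson_pmf_ge0 //.
  rewrite ler_wpM2l ?poisson_pmf_ge0 // /f /c -natr1.
  have -> : theta + t * (k%:R + 1 - lam) = theta + t * (k%:R - lam) + t by ring.
  exact: sin_taylor2.
by rewrite -big_distrl /= ler_piMl ?poisson_sum_le1 // divr_ge0 // sqr_ge0.
Qed.

End TruncatedPoisson.

(** * Stars of potential edges *)

Section Stars.
Variable n : nat.
Implicit Types (u v w : 'I_n) (e : {set 'I_n}) (E : {set {set 'I_n}}).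

Definition star v : {set {set 'I_n}} := [set e in edges n | v \in e].

Lemma star_sub v : star v \subset edges n.
Proof. by apply/subsetP => e; rewrite inE => /andP[]. Qed.

Lemma card_edges : #|edges n| = 'C(n, 2).
Proof. by rewrite -[n in RHS]card_ord -card_draws; apply: eq_card => e; rewrite !inE. Qed.

Lemma pair_edge u v : u != v -> [set u; v] \in edges n.
Proof. by move=> uv; rewrite inE cards2 uv. Qed.

Lemma edgeP e v : e \in edges n -> v \in e -> exists2 w, w != v & e = [set v; w].
Proof.
rewrite inE => /cards2P[a [b [ab ->]]]; rewrite !inE => /orP[] /eqP ->.
  by exists b => //; rewrite eq_sym.
by exists a => //; rewrite setUC.
Qed.

Lemma pair_inj v w w' : w != v -> w' != v -> [set v; w] = [set v; w'] -> w = w'.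
Proof.
move=> wv w'v /setP /(_ w); rewrite !inE eqxx orbT (negbTE wv) /=.
by move=> /esym /eqP.
Qed.

Definition fan v (X : {set 'I_n}) : {set {set 'I_n}} := [set [set v; w] | w in X].

Lemma card_fan v (X : {set 'I_n}) : v \notin X -> #|fan v X| = #|X|.
Proof.
move=> vX; rewrite card_in_imset // => w w' wX w'X.
by apply: pair_inj; apply: contraNneq vX => <-.
Qed.

Lemma starE v : star v = fan v (~: [set v]).
Proof.
apply/setP => e; rewrite inE; apply/andP/imsetP => [[eE ve]|[w wv ->]].
  by have [w wv ->] := edgeP eE ve; exists w; rewrite // !inE.
rewrite !inE in wv; rewrite set21 pair_edge //; by rewrite eq_sym.
Qed.

Lemma card_star v : #|star v| = n.-1.
Proof. by rewrite starE card_fan ?cardsC1 ?card_ord // !inE eqxx. Qed.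

Lemma starI u v : u != v -> star u :&: star v = [set [set u; v]].
Proof.
move=> uv; apply/setP => e; rewrite !inE; apply/andP/eqP => [|->].
  move=> [/andP[eE ue] /andP[_ ve]].
  have eE' : e \in edges n by rewrite inE.
  have [w wu eq] := edgeP eE' ue.
  move: ve; rewrite eq !inE eq_sym (negbTE uv) /= => /eqP ->; done.
by rewrite cards2 uv !inE !eqxx orbT.
Qed.

Lemma isolatedE E : E \subset edges n ->
  Defs.isolated E = (\sum_v (E :&: star v == set0))%N.
Proof.
move=> sE; rewrite /Defs.isolated -sum1_card big_mkcond /=.
apply: eq_bigr => v _.
(* The set in [isolated] is a classical one; membership passes through [set_mem] and [mem_set]. *)
have -> : (v \in classical_sets.mkset (fun v : 'I_n => [forall e in E, v \notin e])) =
    (E :&: star v == set0).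
  apply/idP/eqP => [/classical_sets.set_mem /= /forall_inP h|/setP h].
    apply/setP => e; rewrite !inE; apply/negP => /andP[eE /andP[_ ve]].
    by have := h _ eE; rewrite ve.
  apply: classical_sets.mem_set => /=; apply/forall_inP => e eE.
  have := h e; rewrite in_setI eE in_set0 inE /= => /negbT.
  by rewrite (subsetP sE).
by case: eqP.
Qed.

End Stars.

(** * Gain of isolated vertices when a star is removed, and its moments *)

Section Stein.
Variables (R : realType) (n : nat) (p : R).
Hypothesis p01 : 0 <= p <= 1.
Implicit Types (u v w : 'I_n) (e : {set 'I_n}) (E : {set {set 'I_n}}).
Local Notation Ex := (bern p (edges n)).
Local Notation star := (@star n).

Definition niso E : R := \sum_v (E :&: star v == set0)%:R.

Definition iso_prob : R := (1 - p) ^+ n.-1.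
Definition pendant_prob : R := p * (1 - p) ^+ n.-2.
Local Notation pi_ := iso_prob.
Local Notation a_ := pendant_prob.

Lemma nisoE E : E \subset edges n -> (Defs.isolated E)%:R = niso E.
Proof. by move=> sE; rewrite isolatedE // natr_sum. Qed.

Definition pendant u v E : bool := E :&: star u == [set [set u; v]].

(* The number of vertices that become isolated when v loses all its edges. *)
Definition gain v E : R :=
  (E :&: star v != set0)%:R + \sum_(u | u != v) (pendant u v E)%:R.

Lemma niso_remove_star v E : E \subset edges n ->
  niso (E :\: star v) = niso E + gain v E.
Proof.
move=> sE; rewrite /niso /gain (bigD1 v) //= [in RHS](bigD1 v) //=.
have -> : (E :\: star v) :&: star v = set0.
  by rewrite setIDAC -setIDA setDv setI0.
rewrite eqxx addrACA -big_split /=; congr (_ + _).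
  by case: eqP => _ /=; rewrite ?addr0 ?add0r.
apply: eq_bigr => u uv; rewrite /pendant setIDAC setD_eq0.
have [->|/set0Pn[e]] := eqVneq (E :&: star u) set0.
  rewrite sub0set eq_sym (_ : _ == set0 = false) ?addr0 //.
  by apply/negbTE/set0Pn; exists [set u; v]; rewrite inE.
rewrite add0r => eA; congr (_%:R); congr nat_of_bool.
(* A non-isolated u becomes isolated exactly when all its edges lie in [star v], and by [starI] the
   edge {u, v} is the only candidate. *)
apply/idP/eqP => [sA|->]; last first.
  by rewrite sub1set; have := set11 [set u; v]; rewrite -(starI uv) => /setIP[].
apply/eqP; rewrite eqEsubset.
have sA' : E :&: star u \subset [set [set u; v]].
  by rewrite -(starI uv) subsetI subsetIr sA.
rewrite sA' sub1set; have := subsetP sA' _ eA; rewrite inE => /eqP <-; exact: eA.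
Qed.

Lemma sum_pendant u E : E \subset edges n ->
  \sum_(v | v != u) (pendant u v E)%:R = (#|E :&: star u| == 1%N)%:R :> R.
Proof.
move=> sE; rewrite /pendant; case: (boolP (#|E :&: star u| == 1%N)) => [/cards1P[e Ae]|].
  have eA : e \in E :&: star u by rewrite Ae inE.
  move: eA; rewrite inE => /andP[eE]; rewrite inE => /andP[eD ue].
  have [w wu eq] := edgeP eD ue.
  rewrite (bigD1 w) //= Ae eq eqxx big1 ?addr0 // => v /andP[vu vw].
  case: eqP => // /set1_inj h; case/negP: vw; apply/eqP; exact: pair_inj (esym h).
move=> h; rewrite big1 // => v vu; case: eqP => // Ae.
by rewrite Ae cards1 in h.
Qed.

(** The sum of the gains seen from the vertex that becomes isolated, a vertex of degree one being
    pendant at exactly one v. In this form one more edge affects only two summands. *)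
Definition total_gain E : R :=
  \sum_u ((E :&: star u != set0)%:R + (#|E :&: star u| == 1%N)%:R).

Lemma sum_gain E : E \subset edges n -> \sum_v gain v E = total_gain E.
Proof.
move=> sE; rewrite /gain /total_gain !big_split /=; congr (_ + _).
rewrite (exchange_big_dep xpredT) //=; apply: eq_bigr => u _.
rewrite -sum_pendant //; by apply: eq_bigl => v; rewrite eq_sym.
Qed.

Lemma bern_iso v : Ex (fun E => (E :&: star v == set0)%:R) = pi_.
Proof. by rewrite bern_trace ?star_sub ?sub0set // cards0 card_star expr0 mul1r subn0. Qed.

Lemma bern_not_iso v : Ex (fun E => (E :&: star v != set0)%:R) = 1 - pi_.
Proof.
rewrite (@eq_bern _ _ _ _ _ (fun E => 1 - (E :&: star v == set0)%:R)).
  by rewrite bernB bern_cst bern_iso.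
by move=> E _; case: eqP => _ /=; rewrite ?subrr ?subr0.
Qed.

Lemma mean_niso : Ex niso = n%:R * pi_.
Proof.
rewrite /niso bern_sum (eq_bigr (fun=> pi_)) => [|v _]; last exact: bern_iso.
by rewrite sumr_const card_ord mulr_natl.
Qed.

Lemma bern_pendant u v : u != v -> Ex (fun E => (pendant u v E)%:R) = a_.
Proof.
move=> uv; rewrite /pendant bern_trace ?star_sub //.
  by rewrite cards1 card_star expr1 subn1.
by rewrite -(starI uv) subsetIl.
Qed.

(** The union of two stars has 2n - 3 edges; two are prescribed present and the other 2n - 5
    absent. *)
Lemma bern_pendant2 u u' v : u != v -> u' != v -> u != u' ->
  Ex (fun E => (pendant u v E)%:R * (pendant u' v E)%:R) <=
  p ^+ 2 * (1 - p) ^+ (2 * n - 5).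
Proof.
move=> uv u'v uu'; set U := star u :|: star u'.
set S := [set [set u; v]; [set u'; v]].
have SU : S \subset U.
  rewrite /S /U setUSS // ?sub1set.
  - by rewrite -sub1set -(starI uv) subsetIl.
  - by rewrite -sub1set -(starI u'v) subsetIl.
have UD : U \subset edges n by rewrite subUset !star_sub.
have cU : #|U| = (2 * n - 3)%N.
  rewrite cardsU !card_star (starI uu') cards1; lia.
have cS : #|S| = 2%N.
  rewrite cards2; case: eqP => // h.
  have := uu'; rewrite (pair_inj (v := v) uv u'v) ?eqxx //.
  by rewrite setUC h setUC.
have -> : p ^+ 2 * (1 - p) ^+ (2 * n - 5) = p ^+ #|S| * (1 - p) ^+ (#|U| - #|S|).
  by rewrite cS cU; congr (_ * _ ^+ _); lia.
rewrite -(bern_trace p UD SU); apply: ler_bern => // E _; rewrite /pendant -natrM mulnb ler_nat.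
case: (boolP (_ && _)) => // /andP[/eqP h /eqP h'].
by rewrite /U setIUr h h' eqxx.
Qed.

(** For a binomial variable with k + 1 trials and success probability 1 - x, being 1 is less likely
    than being positive. *)
Lemma binomial_one_le (x : R) k : 0 <= x <= 1 ->
  k.+1%:R * (1 - x) * x ^+ k <= 1 - x ^+ k.+1.
Proof.
move=> /andP[x0 x1]; elim: k => [|k IH]; first by rewrite expr0 expr1; lra.
have h : 0 <= (1 - x) * (1 - x ^+ k.+1) by rewrite mulr_ge0 ?subr_ge0 ?exprn_ile1.
have := ler_wpM2l x0 IH.
by rewrite -(natr1 k.+1) !exprS in h *; move: (x ^+ k) (k.+1%:R) h => y m; nra.
Qed.

(** The mean gain at a vertex. It is also the ratio of the variance of W to its mean, by
    [varW_eq]. *)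
Definition var_ratio : R := (1 - pi_) + n.-1%:R * a_.

Lemma iso_prob01 : 0 <= pi_ <= 1.
Proof.
have hp := p01.
by apply/andP; split; [apply: exprn_ge0 | apply: exprn_ile1]; lra.
Qed.

Lemma pendant_prob_ge0 : 0 <= a_.
Proof. by have hp := p01; apply: mulr_ge0; [| apply: exprn_ge0]; lra. Qed.

Lemma pendant_mean_le : n.-1%:R * a_ <= 1 - pi_.
Proof.
have hp := p01; rewrite /a_ /pi_; case: n => [|[|m]] /=; rewrite ?mul0r ?expr0 ?subrr //.
have := @binomial_one_le (1 - p) m; rewrite opprB addrCA subrr addr0 mulrA.
by apply; lra.
Qed.

Lemma mean_total_gain : Ex total_gain = n%:R * var_ratio.
Proof.
rewrite (@eq_bern _ _ _ _ _ (fun E => \sum_v gain v E)); last first.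
  by move=> E /sum_gain ->.
rewrite bern_sum (eq_bigr (fun=> var_ratio)).
  by rewrite sumr_const card_ord mulr_natl.
move=> v _; rewrite /gain bernD bern_sum /var_ratio; congr (_ + _).
  exact: bern_not_iso.
rewrite (eq_bigr (fun=> a_)) => [|u uv]; last by rewrite bern_pendant.
by rewrite sumr_const cardC1 card_ord mulr_natl.
Qed.

Lemma gain_ge0 v E : 0 <= gain v E.
Proof. by rewrite addr_ge0 ?ler0n // sumr_ge0. Qed.

(** The number L of pendant neighbours of v satisfies E L^2 <= 2 E L: for fixed u, the pairs (u, u')
    with u' <> u contribute no more than the diagonal pair. *)
Lemma gain_sqr_le v : Ex (fun E => gain v E ^+ 2) <= 4 * var_ratio.
Proof.
have hp := p01; pose L E : R := \sum_(u | u != v) (pendant u v E)%:R.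
have hL : Ex (fun E => L E ^+ 2) <= 2 * (n.-1%:R * a_).
  rewrite (@eq_bern _ _ _ _ _ (fun E => \sum_(u | u != v) \sum_(u' | u' != v)
      (pendant u v E)%:R * (pendant u' v E)%:R)); last first.
    move=> E _; rewrite /L expr2 big_distrl /=; apply: eq_bigr => u _.
    by rewrite big_distrr.
  rewrite bern_sum; apply: (@le_trans _ _ (\sum_(u | u != v) 2 * a_)); last first.
    by rewrite sumr_const cardC1 card_ord -mulr_natl; lra.
  apply: ler_sum => u uv; rewrite bern_sum (bigD1 u) //=.
  have -> : 2 * a_ = a_ + a_ by ring.
  apply: lerD.
    rewrite -(bern_pendant uv) le_eqVlt; apply/orP; left; apply/eqP.
    by apply: eq_bern => E _; case: (pendant _ _ _); rewrite ?mulr1 ?mulr0.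
  apply: (@le_trans _ _ (\sum_(u' | (u' != v) && (u' != u)) p ^+ 2 * (1 - p) ^+ (2 * n - 5))).
    by apply: ler_sum => u' /andP[u'v u'u]; apply: bern_pendant2 => //; rewrite eq_sym.
  rewrite sumr_const.
  have -> : #|[pred u' | (u' != v) && (u' != u)]| = (n - 2)%N.
    have := cardsC [set v; u]; rewrite cards2 eq_sym uv card_ord => h.
    rewrite -[RHS]/(n - 2)%N -[in RHS]h addKn; apply: eq_card => w.
    by rewrite !inE negb_or.
  case: (ltnP n 3) => n3.
    have -> : (n - 2 = 0)%N by lia.
    by rewrite mulr0n pendant_prob_ge0.
  rewrite /a_ -mulr_natl.
  have -> : (2 * n - 5 = n.-2 + (n - 3))%N by lia.
  rewrite exprD expr2.
  (* Once [a_] is factored out, the remaining (n-2) p (1-p)^(n-3) is the probability that a binomial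
     variable with n - 2 trials equals 1. *)
  have := @binomial_one_le (1 - p) (n - 3).
  have -> : (n - 3).+1 = (n - 2)%N by lia.
  have -> : 1 - (1 - p) = p by ring.
  move=> h; have {}h : (n - 2)%:R * p * (1 - p) ^+ (n - 3) <= 1.
    apply: le_trans (h _) _; first by lra.
    by rewrite lerBlDr lerDl exprn_ge0 //; lra.
  have := ler_wpM2l pendant_prob_ge0 h; rewrite /a_; lra.
have pi01 := iso_prob01; have a0 := pendant_prob_ge0.
apply: (@le_trans _ _ (Ex (fun E => 2 * (E :&: star v != set0)%:R + 2 * L E ^+ 2))).
  apply: ler_bern => // E _; rewrite /gain -/(L E).
  by have := sqr_ge0 ((E :&: star v != set0)%:R - L E); case: (_ != _) => /=; nra.
rewrite bernD !bernZ.
rewrite bern_not_iso.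
rewrite /var_ratio; lra.
Qed.

End Stein.

(** * Stein's identity and the differential equation for W *)

Section SteinODE.
Variables (R : realType) (n : nat) (p : R).
Hypothesis p01 : 0 <= p <= 1.
Implicit Types (u v w : 'I_n) (e : {set 'I_n}) (E : {set {set 'I_n}}).
Local Notation Ex := (bern p (edges n)).
Local Notation star := (@star n).
Local Notation niso := (@niso R n).
Local Notation pi_ := (iso_prob n p).
Local Notation a_ := (pendant_prob n p).

(** Only the two endpoints of e see a change in their star. *)
Lemma vertex_stat_lipschitz (X : {set 'I_n})
    (g : 'I_n -> {set {set 'I_n}} -> R) (B : R) e E :
  (forall u A, 0 <= g u A <= B) -> e \in edges n ->
  `|\sum_(u in X) g u ((e |: E) :&: star u) - \sum_(u in X) g u (E :&: star u)| <= 2 * B.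
Proof.
move=> gB eD; rewrite -sumrB; apply: le_trans (ler_norm_sum _ _ _) _.
apply: (@le_trans _ _ (\sum_(u in X) (u \in e)%:R * B)).
  apply: ler_sum => u _; case: (boolP (u \in e)) => ue; last first.
    rewrite setIUl (_ : [set e] :&: star u = set0) ?set0U ?subrr ?normr0 ?mul0r //.
    apply/setP => f; rewrite !inE; apply/negP => /andP[/eqP -> /andP[_]].
    by apply/negP.
  rewrite mul1r ler_norml; have := gB u ((e |: E) :&: star u).
  have := gB u (E :&: star u); lra.
have B0 : 0 <= B.
  move: eD; rewrite inE => /cards2P[x _].
  by have /andP[h1 h2] := gB x set0; apply: le_trans h1 h2.
rewrite -big_distrl /= ler_wpM2r // -natr_sum ler_nat.
move: eD; rewrite inE => /eqP <-; rewrite -sum1_card [in leqRHS]big_mkcond /=.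
rewrite big_mkcond /=; by apply: leq_sum => u _; case: (u \in X).
Qed.

Lemma card_edges2 : (2 * #|edges n| = n * n.-1)%N.
Proof.
rewrite card_edges; case: n => [|m]; first by rewrite bin_small.
by rewrite -mul_bin_diag bin1.
Qed.

Lemma edges_pi_le : 2 * #|edges n|%:R * p * pi_ <= n%:R * var_ratio n p.
Proof.
have /andP[p0 p1] := p01; have pi01 := iso_prob01 n p01; have a0 := pendant_prob_ge0 n p01.
rewrite -[2]/(2%:R) -natrM card_edges2 natrM -!mulrA ler_wpM2l // /var_ratio.
apply: (@le_trans _ _ (n.-1%:R * a_)); last by lra.
rewrite ler_wpM2l // /pendant_prob ler_wpM2l // /iso_prob.
by apply: ler_wiXn2l; lra || lia.
Qed.

Definition niso_var : R := pi_ * (n%:R * var_ratio n p).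
Local Notation V := niso_var.

Lemma niso_var_ge0 : 0 <= V.
Proof.
have pi01 := iso_prob01 n p01; have a0 := pendant_prob_ge0 n p01.
have h : 0 <= n.-1%:R * a_ by exact: mulr_ge0.
apply: mulr_ge0; first by case/andP: pi01.
by apply: mulr_ge0 => //; rewrite /var_ratio; lra.
Qed.

(** Efron-Stein with Lipschitz constant 4 gives 16 |D| p. One factor [pi_] turns 2 |D| p into at
    most n times [var_ratio], by [edges_pi_le]; the other completes V. *)
Lemma var_total_gain :
  pi_ ^+ 2 * Ex (fun E => (total_gain R E - Ex (@total_gain R n)) ^+ 2) <= 8 * V.
Proof.
have /andP[p0 p1] := p01; have pi01 := iso_prob01 n p01.
have lip e E : e \in edges n -> e \notin E -> E \subset edges n ->
    `|total_gain R (e |: E) - total_gain R E| <= 4.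
  move=> eD _ _.
  have := @vertex_stat_lipschitz setT
    (fun _ A => (A != set0)%:R + (#|A| == 1%N)%:R) 2 e E _ eD.
  rewrite /total_gain !big_set /= => H.
  rewrite (_ : 4 = 2 * 2 :> R); last by ring.
  by apply: H => u A; case: (_ != _); case: (_ == _) => /=; lra.
have h4 : 0 <= 4 :> R by [].
have := bern_var_lipschitz p01 h4 lip.
set v := Ex _ => hv.
have pi2 : 0 <= pi_ ^+ 2 by exact: sqr_ge0.
apply: le_trans (ler_wpM2l pi2 hv) _.
have := edges_pi_le; rewrite /niso_var.
have /andP[pi0 _] := pi01.
move=> h; have := ler_wpM2l pi0 h; lra.
Qed.

Lemma niso_stein (f : R -> R) :
  Ex (fun E => niso E * f (niso E)) =
  pi_ * \sum_v Ex (fun E => f (niso E + gain R v E)).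
Proof.
rewrite (@eq_bern _ _ _ _ _ (fun E => \sum_v (E :&: star v == set0)%:R * f (niso (E :\: star v)))).
  rewrite bern_sum big_distrr; apply: eq_bigr => v _ /=.
  (* Isolation of v depends on [star v] alone, hence is independent of the graph with that star
     removed. *)
  rewrite (bern_trace_indep p (fun E => f (niso E)) (star_sub v) (sub0set _)).
  rewrite cards0 card_star expr0 mul1r subn0; congr (_ * _).
  by apply: eq_bern => E sE; rewrite niso_remove_star.
move=> E sE; rewrite {1}/niso big_distrl; apply: eq_bigr => v _ /=.
case: eqP => Ev; rewrite ?mul0r // !mul1r; congr (f (_ _)).
by apply/esym/setDidPl; rewrite -setI_eq0 Ev.
Qed.

Lemma meanW_eq : meanW n p = n%:R * pi_.
Proof.
rewrite -(mean_niso n p); apply: eq_bigr => E; rewrite powersetE => sE.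
by rewrite /gnp_weight nisoE.
Qed.

(** Stein's identity for f(x) = x - mu, where only the mean gain survives. *)
Lemma varW_eq : varW n p = V.
Proof.
transitivity (Ex (fun E => (niso E - n%:R * pi_) ^+ 2)).
  apply: eq_bigr => E; rewrite powersetE => sE.
  by rewrite /gnp_weight nisoE // meanW_eq.
set mu := n%:R * pi_.
transitivity (Ex (fun E => niso E * (niso E - mu)) - mu * Ex (fun E => niso E - mu)).
  by rewrite -bernZ -bernB; apply: eq_bern => E _; ring.
rewrite (niso_stein (fun x => x - mu)) bernB bern_cst mean_niso -/mu subrr mulr0 subr0.
rewrite /niso_var -mean_total_gain //; congr (_ * _).
transitivity (\sum_v Ex (fun E => gain R v E)).
  by apply: eq_bigr => v _; rewrite bernB bern_cst bernD mean_niso -/mu addrAC subrr add0r.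
by rewrite -bern_sum; apply: eq_bern => E sE; rewrite sum_gain.
Qed.

(** [e] has two sources. The Taylor remainder t^2 gain^2 / 2, with [gain_sqr_le], gives 2 V t^2. The
    fluctuation of the total gain about its mean, with Cauchy-Schwarz and [var_total_gain], gives
    sqrt(8V) t <= 3 sqrt(V) t. *)
Lemma niso_ode (theta : R) : exists e : R -> R,
  (forall t : R, is_derive t 1
     (fun t => Ex (fun E => cos (theta + t * (niso E - n%:R * pi_))))
     (- V * t * Ex (fun E => cos (theta + t * (niso E - n%:R * pi_))) + e t)) /\
  (forall t : R, 0 <= t -> `|e t| <= 2 * V * t ^+ 2 + 3 * Num.sqrt V * t).
Proof.
set mu := n%:R * pi_.
have /andP[p0 p1] := p01; have /andP[pi0 pi1] := iso_prob01 n p01.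
pose f (t w : R) := sin (theta + t * (w - mu)).
pose c (t w : R) := cos (theta + t * (w - mu)).
have der (t : R) : is_derive t 1 (fun t => Ex (fun E => c t (niso E)))
    (- Ex (fun E => (niso E - mu) * f t (niso E))).
  rewrite -bernN; apply: is_derive_bigsum => E; apply: is_deriveZ.
  exact: is_derive_cos_affine.
exists (fun t => V * t * Ex (fun E => c t (niso E)) - Ex (fun E => (niso E - mu) * f t (niso E))).
split=> t.
  have := der t; congr (is_derive _ _ _ _); rewrite -/(c t _).
  by rewrite /c; ring.
move=> t0.
pose rho v E := f t (niso E + gain R v E) - f t (niso E) - t * gain R v E * c t (niso E).
have rho_le v E : `|rho v E| <= t ^+ 2 / 2 * gain R v E ^+ 2.
  rewrite /rho /f /c.
  have -> : theta + t * (niso E + gain R v E - mu) =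
     theta + t * (niso E - mu) + t * gain R v E by ring.
  apply: le_trans (sin_taylor2 _ _) _; first by rewrite mulr_ge0 // gain_ge0.
  by rewrite exprMn; lra.
set M := Ex (@total_gain R n).
have VE : V = pi_ * M by rewrite /niso_var -mean_total_gain.
have eE : V * t * Ex (fun E => c t (niso E)) - Ex (fun E => (niso E - mu) * f t (niso E)) =
    - (pi_ * t * Ex (fun E => (total_gain R E - M) * c t (niso E))) -
    pi_ * \sum_v Ex (rho v).
  have -> : Ex (fun E => (niso E - mu) * f t (niso E)) =
      Ex (fun E => niso E * f t (niso E)) - mu * Ex (fun E => f t (niso E)).
    by rewrite -bernZ -bernB; apply: eq_bern => E _; ring.
  rewrite (niso_stein (f t)).
  have -> : \sum_v Ex (fun E => f t (niso E + gain R v E)) =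
      n%:R * Ex (fun E => f t (niso E)) + t * Ex (fun E => total_gain R E * c t (niso E)) +
      \sum_v Ex (rho v).
    have -> : Ex (fun E => total_gain R E * c t (niso E)) =
       \sum_v Ex (fun E => gain R v E * c t (niso E)).
      by rewrite -bern_sum; apply: eq_bern => E sE; rewrite -sum_gain // big_distrl.
    have -> : n%:R * Ex (fun E => f t (niso E)) = \sum_(v : 'I_n) Ex (fun E => f t (niso E)).
      by rewrite sumr_const card_ord mulr_natl.
    rewrite big_distrr -!big_split; apply: eq_bigr => v _ /=.
    by rewrite -bernZ -!bernD; apply: eq_bern => E _; rewrite /rho; ring.
  have -> : Ex (fun E => (total_gain R E - M) * c t (niso E)) =
      Ex (fun E => total_gain R E * c t (niso E)) - M * Ex (fun E => c t (niso E)).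
    by rewrite -bernZ -bernB; apply: eq_bern => E _; ring.
  by rewrite VE /mu; ring.
rewrite eE; apply: le_trans (ler_normB _ _) _; rewrite normrN addrC; apply: lerD.
  rewrite normrM ger0_norm //.
  apply: (@le_trans _ _ (pi_ * (n%:R * (2 * t ^+ 2 * var_ratio n p)))); last first.
    by rewrite /niso_var; lra.
  rewrite ler_wpM2l //; apply: le_trans (ler_norm_sum _ _ _) _.
  rewrite mulr_natl -[X in _ *+ X](card_ord n) -sumr_const; apply: ler_sum => v _.
  apply: le_trans (ler_norm_bern _ _ p01) _.
  apply: (@le_trans _ _ (Ex (fun E => t ^+ 2 / 2 * gain R v E ^+ 2))).
    by apply: ler_bern => // E _.
  rewrite bernZ; have := gain_sqr_le p01 v; have := sqr_ge0 t => t2.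
  have t22 : 0 <= t ^+ 2 / 2 by lra.
  by move/(ler_wpM2l t22); lra.
rewrite normrM ger0_norm ?mulr_ge0 // mulrAC ler_wpM2r //.
set B := Ex (fun E => (total_gain R E - M) * _).
have hB : B ^+ 2 <= Ex (fun E => (total_gain R E - M) ^+ 2).
  apply: le_trans (bern_sqr_le _ _ p01) _; apply: ler_bern => // E _.
  rewrite exprMn ler_piMr ?sqr_ge0 //.
  by rewrite -real_normK ?num_real // expr_le1 // cos_max.
rewrite -(@ler_pXn2r _ 2) ?nnegrE ?mulr_ge0 ?sqrtr_ge0 ?normr_ge0 //.
rewrite !exprMn real_normK ?num_real // sqr_sqrtr ?niso_var_ge0 //.
have := var_total_gain; rewrite -/M.
have := ler_wpM2l (sqr_ge0 pi_) hB; have := niso_var_ge0; lra.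
Qed.

End SteinODE.

(** * Second moment of a count of avoided sets *)

Section AvoidVariance.
Variables (R : realType) (T I : finType) (p : R) (D : {set T}).
Variables (Dv : I -> {set T}) (V : {set I}) (k : nat).
Hypotheses (p01 : 0 <= p < 1) (sD : forall i, i \in V -> Dv i \subset D)
  (cD : forall i, i \in V -> #|Dv i| = k)
  (iD : forall i j, i \in V -> j \in V -> i != j -> (#|Dv i :&: Dv j| <= 1)%N).

Lemma bern_avoid (S : {set T}) : S \subset D ->
  bern p D (fun E => (E :&: S == set0)%:R) = (1 - p) ^+ #|S|.
Proof. by move=> SD; rewrite bern_trace ?sub0set // cards0 expr0 mul1r subn0. Qed.

Lemma avoid_mean :
  bern p D (avoid_count R Dv V) = #|V|%:R * (1 - p) ^+ k.
Proof.
rewrite /avoid_count bern_sum (eq_bigr (fun=> (1 - p) ^+ k)).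
  by rewrite sumr_const mulr_natl.
by move=> i iV; rewrite bern_avoid ?sD // cD.
Qed.

(** Two sets sharing at most one element are both avoided with probability at most (1-p)^(2k-1), an
    excess factor 1/(1-p) over independence; this produces m^2 p/(1-p), and the diagonal produces
    m. *)
Lemma avoid_variance (m : R) : m = #|V|%:R * (1 - p) ^+ k ->
  bern p D (fun E => (avoid_count R Dv V E - m) ^+ 2) <= m + m ^+ 2 * (p / (1 - p)).
Proof.
move=> mE; have /andP[p0 p1] := p01.
have q0 : 0 < 1 - p by lra.
rewrite {1}mE -avoid_mean bern_var avoid_mean -mE.
suff : bern p D (fun E => avoid_count R Dv V E ^+ 2) <= m + m ^+ 2 / (1 - p).
  have -> : m ^+ 2 / (1 - p) = m ^+ 2 * (p / (1 - p)) + m ^+ 2 by field; rewrite gt_eqF.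
  lra.
rewrite (@eq_bern _ _ _ _ _ (fun E => \sum_(i in V) \sum_(j in V)
   (E :&: (Dv i :|: Dv j) == set0)%:R)); last first.
  move=> E _; rewrite /avoid_count expr2 big_distrl /=; apply: eq_bigr => i _.
  rewrite big_distrr; apply: eq_bigr => j _ /=.
  by rewrite -natrM mulnb setIUr setU_eq0.
rewrite bern_sum.
have -> : m + m ^+ 2 / (1 - p) = \sum_(i in V) ((1 - p) ^+ k + #|V|%:R * ((1 - p) ^+ (2 * k) / (1 - p))).
  rewrite sumr_const -[RHS]mulr_natl mE mul2n -addnn exprD; field.
  by rewrite gt_eqF.
apply: ler_sum => i iV; rewrite bern_sum (bigD1 i) //=; apply: lerD.
  by rewrite setUid bern_avoid ?sD // cD.
rewrite mulr_natl -sumr_const big_mkcond [leRHS]big_mkcond /=; apply: ler_sum => j _.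
case: (boolP (j \in V)) => jV //=; case: eqP => [_|/eqP ji] /=.
  by rewrite divr_ge0 ?exprn_ge0 // ltW.
rewrite bern_avoid ?subUset ?sD // ler_pdivlMr // -exprSr.
apply: ler_wiXn2l; [lra | lra |].
rewrite cardsU !cD //; have := iD iV jV; rewrite eq_sym ji => /(_ isT); lia.
Qed.

Lemma avoid_lower (m : R) : 0 < m -> m = #|V|%:R * (1 - p) ^+ k ->
  bern p D (fun E => (avoid_count R Dv V E < m / 2)%R%:R) <= 4 * (m^-1 + p / (1 - p)).
Proof.
move=> m0 mE; have /andP[p0 p1] := p01.
have p01' : 0 <= p <= 1 by lra.
apply: le_trans (bern_chebyshev p01' m0 _) _; first by rewrite avoid_mean.
rewrite ler_pdivrMr ?exprn_gt0 // -mulrA ler_wpM2l //.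
apply: le_trans (avoid_variance mE) _.
have q0 : 1 - p != 0 by rewrite gt_eqF // subr_gt0.
by rewrite le_eqVlt; apply/orP; left; apply/eqP; field; rewrite q0 gt_eqF.
Qed.

(** Averages a decay bound whose exponent N is itself random: the trivial bound 1 serves where N is
    small. *)
Lemma ler_bern_threshold (F : {set T} -> R) (N : {set T} -> R) (c m : R) :
  (forall E : {set T}, E \subset D -> F E <= 1) ->
  (forall E : {set T}, E \subset D -> F E <= expR (- (c * N E))) -> 0 <= c ->
  bern p D F <= bern p D (fun E => (N E < m)%R%:R) + expR (- (c * m)).
Proof.
move=> F1 FN c0; have /andP[p0 p1] := p01.
have p01' : 0 <= p <= 1 by lra.
rewrite -[X in _ + X](bern_cst p D) -bernD; apply: ler_bern => // E ED.
case: ltP => h /=; first by rewrite ler_wpDr ?expR_ge0 ?F1.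
rewrite add0r; apply: le_trans (FN E ED) _.
by rewrite ler_expR lerN2 ler_wpM2l.
Qed.

End AvoidVariance.

(** * Decay from jumps of size one *)

Section BipartiteDecay.
Variables (R : realType) (n : nat) (p : R) (A : {set 'I_n}).
Hypothesis p01 : 0 <= p < 1.
Implicit Types (u v w : 'I_n) (e : {set 'I_n}) (E : {set {set 'I_n}}) (X : {set 'I_n}).
Local Notation star := (@star n).
Local Notation niso := (@niso R n).

(** Edges are revealed in three stages. Those with no endpoint in A ([inner]) determine the active
    vertices X; then the edges at A outside [cross X] determine the free vertices of A; the edges of
    [cross X] come last and only decide which free vertices stay isolated. *)
Definition touching : {set {set 'I_n}} := [set e in edges n | [exists v in A, v \in e]].
Definition inner : {set {set 'I_n}} := edges n :\: touching.
Definition active E : {set 'I_n} := [set u in ~: A | E :&: star u != set0].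
Definition cross X : {set {set 'I_n}} := \bigcup_(v in A) fan v X.

Lemma star_touching v : v \in A -> star v \subset touching.
Proof.
move=> vA; apply/subsetP => e; rewrite !inE => /andP[-> ve] /=.
by apply/exists_inP; exists v.
Qed.

Lemma inner_star v E : v \in A -> E \subset inner -> E :&: star v = set0.
Proof.
move=> vA sE; apply: disjoint_setI0; apply: disjointW sE (star_touching vA) _.
by rewrite -setI_eq0 /inner setIDAC -setIDA setDv setI0.
Qed.

Lemma fan_sub_star v X : v \notin X -> fan v X \subset star v.
Proof.
move=> vX; apply/subsetP => e /imsetP[w wX ->].
rewrite inE set21 andbT; apply: pair_edge; by apply: contraNneq vX => ->.
Qed.

Lemma cross_sub X : X \subset ~: A -> cross X \subset touching.
Proof.
move=> XA; apply/bigcupsP => v vA; apply: subset_trans (star_touching vA).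
by apply: fan_sub_star; apply/negP => /(subsetP XA); rewrite inE vA.
Qed.

Lemma cross_star v X : X \subset ~: A -> v \in A -> cross X :&: star v = fan v X.
Proof.
move=> XA vA; apply/setP => e; rewrite in_setI; apply/andP/idP => [[]|ef]; last first.
  split; first by apply/bigcupP; exists v.
  by apply: (subsetP (fan_sub_star _)) ef; apply/negP => /(subsetP XA); rewrite inE vA.
move=> /bigcupP[v' v'A /imsetP[w wX ->]]; rewrite inE => /andP[_].
rewrite !inE => /orP[/eqP ->|/eqP vw]; first by apply/imsetP; exists w.
by have := subsetP XA _ wX; rewrite -vw inE vA.
Qed.

Lemma fan_disjoint v v' X : X \subset ~: A -> v \in A -> v' \in A -> v != v' ->
  [disjoint fan v X & fan v' X].
Proof.
move=> XA vA v'A vv'; rewrite -setI_eq0; apply/eqP/setP => e; rewrite !inE.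
apply/negP => /andP[/imsetP[w wX ->] /imsetP[w' w'X h]].
have : v \in [set v'; w'] by rewrite -h set21.
rewrite !inE (negbTE vv') /= => /eqP vw.
by have := subsetP XA _ w'X; rewrite -vw inE vA.
Qed.

Lemma cross_star_outside u X : X \subset ~: A -> u \notin A ->
  cross X :&: star u != set0 -> u \in X.
Proof.
move=> XA uA /set0Pn[e]; rewrite in_setI => /andP[/bigcupP[v vA /imsetP[w wX ->]]].
rewrite inE => /andP[_]; rewrite !inE => /orP[/eqP uv|/eqP -> //].
by rewrite uv vA in uA.
Qed.

Definition free_vertices E : {set 'I_n} := [set v in A | E :&: star v == set0].

(** An edge of [cross X] ends outside A at a vertex of X, which [EB] already keeps from being
    isolated. So the last stage acts on A only, where a vertex counts exactly if it is free and its
    fan is avoided. *)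
Lemma niso_bipartite EB E0 E1 (X := active EB) :
  EB \subset inner -> E0 \subset touching :\: cross X -> E1 \subset cross X ->
  niso (EB :|: (E0 :|: E1)) =
  \sum_(u | u \notin A) ((EB :|: E0) :&: star u == set0)%:R +
  avoid_count R (fun v => fan v X) (free_vertices E0) E1.
Proof.
move=> sB s0 s1; have XA : X \subset ~: A by apply/subsetP => u; rewrite inE => /andP[].
rewrite /niso (bigID (mem A)) /= addrC; congr (_ + _).
  apply: eq_bigr => u uA; rewrite setUA [in LHS]setIUl setU_eq0.
  case: (eqVneq (E1 :&: star u) set0) => [_|h]; first by rewrite andbT.
  have uX : u \in X.
    apply: cross_star_outside uA _ => //; apply: contraNneq h => h.
    by rewrite -subset0 -h setSI.
  move: uX; rewrite inE => /andP[_ /negbTE EBu].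
  by rewrite andbF setIUl setU_eq0 EBu.
rewrite /avoid_count /free_vertices [LHS]big_mkcond [RHS]big_mkcond /=; apply: eq_bigr => v _.
rewrite inE; case: (boolP (v \in A)) => vA //=.
rewrite !setIUl (inner_star vA sB) set0U setU_eq0.
rewrite -(cross_star XA vA) setIA (setIidPl s1).
by case: (_ == set0).
Qed.

Lemma active_le_card E : (#|active E| <= n.-1 \/ #|A| = 0)%N.
Proof.
case: (posnP #|A|) => [->|A0]; [by right | left].
apply: leq_trans (subset_leq_card (_ : active E \subset ~: A)) _.
  by apply/subsetP => u; rewrite inE => /andP[].
by have := cardsC A; rewrite card_ord; lia.
Qed.

(** The exposed parts of two stars share at most one edge, so [avoid_lower] bounds the probability
    of having fewer than m/2 free vertices. Otherwise the last stage is a binomial variable with at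
    least m/2 trials. *)
Lemma bipartite_decay_given (theta t : R) EB (X := active EB) :
  (0 < #|A|)%N -> EB \subset inner ->
  `|bern p touching (fun E => cos (theta + t * niso (EB :|: E)))| <=
  4 * ((#|A|%:R * iso_prob n p)^-1 + p / (1 - p)) +
  expR (- ((#|A|%:R * iso_prob n p) / 2 * (1 - (1 - p) ^+ #|X|) * (1 - cos t))).
Proof.
move=> A0 sB; have /andP[p0 p1] := p01.
have p01' : 0 <= p <= 1 by lra.
have q0 : 0 < 1 - p by lra.
have XA : X \subset ~: A by apply/subsetP => u; rewrite inE => /andP[].
set q := (1 - p) ^+ #|X|.
have qpos : 0 < q by exact: exprn_gt0.
have q1 : q <= 1 by apply: exprn_ile1; lra.
have Xn : (#|X| <= n.-1)%N.
  by have [//|A00] := active_le_card EB; rewrite A00 in A0.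
set k := (n.-1 - #|X|)%N.
have sX := cross_sub XA.
have -> : touching = (touching :\: cross X) :|: cross X.
  by rewrite setUC -{1}(setID touching (cross X)) (setIidPr sX).
have dX : [disjoint touching :\: cross X & cross X].
  by rewrite -setI_eq0 setIDAC -setIDA setDv setI0.
rewrite bern_split //.
pose Dv v := (touching :\: cross X) :&: star v.
have cDv v : v \in A -> #|Dv v| = k.
  move=> vA; have -> : Dv v = star v :\: fan v X.
    rewrite /Dv setIDAC (setIidPr (star_touching vA)) -(cross_star XA vA).
    by rewrite setDIr setDv setU0.
  have vX : v \notin X by apply/negP => /(subsetP XA); rewrite inE vA.
  by rewrite cardsD (setIidPr (fan_sub_star vX)) card_star card_fan.
have iDv v v' : v \in A -> v' \in A -> v != v' -> (#|Dv v :&: Dv v'| <= 1)%N.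
  move=> _ _ vv'; rewrite -(cards1 [set v; v']) -(starI vv'); apply: subset_leq_card.
  by apply: setISS; rewrite subsetIr.
set m := #|A|%:R * (1 - p) ^+ k.
have A0R : 0 < #|A|%:R :> R by rewrite ltr0n.
have m0 : 0 < m by rewrite mulr_gt0 ?exprn_gt0.
(* Avoiding first the exposed edges and then the fan is being isolated: the exponents k and |X| add
   up to n - 1, so the random size of X drops out. *)
have mq : m * q = #|A|%:R * iso_prob n p.
  by rewrite /m /q -mulrA -exprD /k subnK.
apply: le_trans (ler_norm_bern _ _ p01') _.
set c := (1 - cos t) * (q * (1 - q)).
have c0 : 0 <= c.
  apply: mulr_ge0; first by rewrite subr_ge0 cos_le1.
  by apply: mulr_ge0; [exact: ltW | lra].
apply: le_trans (@ler_bern_threshold _ _ p _ p01 _ (avoid_count R Dv A) c (m / 2) _ _ c0) _.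
- move=> E0 _; apply: le_trans (ler_norm_bern _ _ p01') _.
  rewrite -[leRHS](bern_cst p (cross X)); apply: ler_bern => // E1 _; exact: cos_max.
- move=> E0 s0.
  set W0 := \sum_(u | u \notin A) ((EB :|: E0) :&: star u == set0)%:R : R.
  rewrite (@eq_bern _ _ _ _ _ (fun E1 => cos ((theta + t * W0) +
      t * avoid_count R (fun v => fan v X) (free_vertices E0) E1))); last first.
    by move=> E1 s1; rewrite niso_bipartite // -/W0; congr cos; ring.
  have fA v : v \in free_vertices E0 -> v \in A by rewrite inE => /andP[].
  apply: le_trans (@bern_cos_decay R _ _ (fun v => fan v X) p t _ (free_vertices E0) (cross X) #|X| p01' _ _ _) _.
  + move=> v /fA vA; rewrite -(cross_star XA vA); exact: subsetIl.
  + move=> v /fA vA; rewrite card_fan //.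
    by apply/negP => /(subsetP XA); rewrite inE vA.
  + by move=> v v' /fA vA /fA v'A; apply: fan_disjoint.
  rewrite -/q ler_expR lerN2 /c.
  have -> : avoid_count R Dv A E0 = #|free_vertices E0|%:R.
    rewrite /avoid_count -sum1_card natr_sum [LHS]big_mkcond [RHS]big_mkcond /=.
    apply: eq_bigr => v _; rewrite inE /Dv setIA (setIidPl s0).
    by case: (v \in A) => //=; case: (_ == _).
  by rewrite le_eqVlt; apply/orP; left; apply/eqP; ring.
apply: lerD.
  have sDv v : v \in A -> Dv v \subset touching :\: cross X by move=> _; apply: subsetIl.
  apply: le_trans (avoid_lower p01 sDv cDv iDv m0 erefl) _.
  rewrite ler_wpM2l // lerD2r lef_pV2 ?posrE //.
    by rewrite -mq ler_piMr // ltW.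
  by rewrite -mq mulr_gt0.
by rewrite ler_expR lerN2 -mq /c le_eqVlt; apply/orP; left; apply/eqP; field.
Qed.

Definition active_mean : R := #|~: A|%:R * (1 - (1 - p) ^+ #|~: A|.-1).

Lemma inner_star_outside u : u \notin A -> inner :&: star u = fan u (~: A :\ u).
Proof.
move=> uA; apply/setP => e; rewrite !inE; apply/andP/imsetP.
  move=> [/andP[h eD] /andP[_ ue]].
  have eE : e \in edges n by rewrite inE.
  have [w wu eq] := edgeP eE ue; exists w => //.
  rewrite !inE wu /=; apply/negP => wA; case/negP: h.
  by rewrite eD /=; apply/exists_inP; exists w => //; rewrite eq set22.
move=> [w]; rewrite !inE => /andP[wu wA] ->.
have -> : #|[set u; w]| == 2%N by rewrite cards2 (eq_sym u) wu.
rewrite set21 /= !andbT; split=> //.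
apply/negP => /exists_inP[v vA]; rewrite !inE => /orP[] /eqP h; move: vA.
  by rewrite h (negbTE uA).
by rewrite h (negbTE wA).
Qed.

Lemma card_active E : #|active E|%:R = \sum_(u in ~: A) (E :&: star u != set0)%:R :> R.
Proof.
rewrite -sum1_card natr_sum [LHS]big_mkcond [RHS]big_mkcond /=; apply: eq_bigr => u _.
by rewrite in_set; case: (u \in ~: A) => //=; case: (_ == _).
Qed.

Lemma active_lower : 0 < active_mean ->
  bern p inner (fun E => (#|active E|%:R < active_mean / 2)%R%:R) <=
  8 * n%:R ^+ 2 * p / active_mean ^+ 2.
Proof.
move=> b0; have /andP[p0 p1] := p01; have p01' : 0 <= p <= 1 by lra.
have sI : inner \subset edges n by apply: subsetDl.
have mean : active_mean = bern p inner (fun E => #|active E|%:R).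
  rewrite (@eq_bern _ _ _ _ _ (fun E => \sum_(u in ~: A) (E :&: star u != set0)%:R)); last first.
    by move=> E _; exact: card_active.
  rewrite bern_sum (eq_bigr (fun=> 1 - (1 - p) ^+ #|~: A|.-1)).
    by rewrite sumr_const /active_mean mulr_natl.
  move=> u; rewrite inE => uA.
  rewrite (@eq_bern _ _ _ _ _ (fun E => 1 - (E :&: (inner :&: star u) == set0)%:R)); last first.
    move=> E sE; rewrite setIA (setIidPl sE).
    by case: eqP => _ /=; rewrite ?subrr ?subr0.
  rewrite bernB bern_cst bern_avoid ?subsetIl // inner_star_outside // card_fan.
    by have := cardsD1 u (~: A); rewrite inE uA => ->.
  by rewrite !inE eqxx.
apply: le_trans (bern_chebyshev p01' b0 mean) _.
rewrite ler_pM2r ?invr_gt0 ?exprn_gt0 //.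
have h2 : 0 <= 2 :> R by [].
rewrite {1}mean; apply: le_trans (ler_wpM2l _ (bern_var_lipschitz p01' h2 _)) _ => //.
  move=> e E eI _ _; rewrite !card_active -[2]mulr1.
  apply: (@vertex_stat_lipschitz R n _ (fun _ B => (B != set0)%:R)).
    by move=> u B; case: (_ != _) => /=; rewrite ?lexx ?ler01.
  by apply: (subsetP sI).
(* Chebyshev's 4 times the Efron-Stein bound 2^2 |inner| p is 16 |inner| p, at most 8 n^2 p. *)
have : (2 * #|inner| <= n * n)%N.
  apply: (@leq_trans (n * n.-1)); last by rewrite leq_mul2l leq_pred orbT.
  by rewrite -card_edges2 leq_mul2l subset_leq_card.
rewrite -(ler_nat R) !natrM => h.
have : 2 * #|inner|%:R * p <= n%:R * n%:R * p by exact: ler_wpM2r.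
by rewrite expr2; lra.
Qed.

(* Only the jumps of size one enter here: a vertex of A that is free so far is
   isolated or not according to its edges towards vertices already known to be
   non-isolated. *)
Lemma niso_decay1 (theta t eta : R) : (0 < #|A|)%N -> 0 < active_mean ->
  (forall k : nat, active_mean / 2 <= k%:R -> eta <= 1 - (1 - p) ^+ k) ->
  `|bern p (edges n) (fun E => cos (theta + t * niso E))| <=
  8 * n%:R ^+ 2 * p / active_mean ^+ 2 +
  4 * ((#|A|%:R * iso_prob n p)^-1 + p / (1 - p)) +
  expR (- ((#|A|%:R * iso_prob n p) / 2 * eta * (1 - cos t))).
Proof.
move=> A0 b0 heta; have /andP[p0 p1] := p01; have p01' : 0 <= p <= 1 by lra.
have -> : edges n = inner :|: touching.
  rewrite /inner setUC -{1}(setID (edges n) touching) (setIidPr _) //.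
  by apply/subsetP => e; rewrite inE => /andP[].
rewrite bern_split; last by rewrite -setI_eq0 /inner setIDAC -setIDA setDv setI0.
apply: le_trans (ler_norm_bern _ _ p01') _.
set a := #|A|%:R * iso_prob n p.
have a0 : 0 <= a by rewrite mulr_ge0 // exprn_ge0 //; lra.
set b := 4 * _; set ex := expR _.
have b00 : 0 <= b.
  by rewrite mulr_ge0 // addr_ge0 ?invr_ge0 // divr_ge0 // subr_ge0 ltW.
(* If fewer than half the expected number of vertices are active, the cosine mean is bounded by 1,
   and [active_lower] pays for it. *)
apply: (@le_trans _ _ (bern p inner (fun E => (#|active E|%:R < active_mean / 2)%R%:R + (b + ex)))).
  apply: ler_bern => // EB sB; case: ltP => h /=.
    apply: (@le_trans _ _ 1); last by rewrite lerDl addr_ge0 // expR_ge0.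
    apply: le_trans (ler_norm_bern _ _ p01') _.
    rewrite -[leRHS](bern_cst p touching); apply: ler_bern => // E1 _; exact: cos_max.
  rewrite add0r; apply: le_trans (bipartite_decay_given _ _ A0 sB) _.
  rewrite lerD2l ler_expR lerN2 ler_wpM2r ?subr_ge0 ?cos_le1 //.
  by rewrite ler_wpM2l ?divr_ge0 // heta.
rewrite bernD bern_cst addrA lerD2r lerD2r; exact: active_lower.
Qed.

End BipartiteDecay.

(** * Decay from jumps of size two *)

Section IsolatedEdges.
Variables (R : realType) (n : nat).
Implicit Types (u v w : 'I_n) (e f : {set 'I_n}) (C E G : {set {set 'I_n}}).
Local Notation star := (@star n).
Local Notation niso := (@niso R n).

(** The single-edge components of the graph C. *)
Definition lone C : {set {set 'I_n}} :=
  [set e in C | [forall f in C, (f == e) || [disjoint e & f]]].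

Lemma loneP C e f v : e \in lone C -> f \in C -> v \in e -> v \in f -> f = e.
Proof.
rewrite inE => /andP[_ /forall_inP h] fC ve vf; have /orP[/eqP //|d] := h _ fC.
by have := disjointFr d ve; rewrite vf.
Qed.

Lemma lone_sub C : lone C \subset C.
Proof. by apply/subsetP => e; rewrite inE => /andP[]. Qed.

(** In E alone all endpoints of lone edges are isolated. Each lone edge kept in G removes its two
    endpoints from the count, and |G| is |lone C| minus the number of avoided singletons. *)
Lemma niso_lone C E G : C \subset edges n -> E \subset C :\: lone C ->
  G \subset lone C ->
  niso (E :|: G) = niso E - 2 * #|lone C|%:R +
    2 * avoid_count R (fun e => [set e]) (lone C) G.
Proof.
move=> sC sE sG.
have -> : niso E - 2 * #|lone C|%:R + 2 * avoid_count R (fun e => [set e]) (lone C) G =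
    niso E - \sum_(e in G) #|e|%:R.
  rewrite -addrA; congr (_ + _).
  have -> : \sum_(e in G) #|e|%:R = \sum_(e in lone C) 2 * (e \in G)%:R :> R.
    rewrite [RHS](bigID (mem G)) /= [X in _ + X]big1 ?addr0; last first.
      by move=> e /andP[_ /negbTE ->]; rewrite mulr0.
    apply: eq_big => [e|e eG].
      by case: (boolP (e \in G)) => [/(subsetP sG) ->|]; rewrite ?andbF.
    rewrite eG mulr1; congr (_%:R).
    have := subsetP sC _ (subsetP (lone_sub C) _ (subsetP sG _ eG)).
    by rewrite inE => /eqP.
  rewrite /avoid_count -big_distrr /= -sum1_card natr_sum -mulrN -mulrDr -mulrN.
  congr (_ * _); rewrite addrC -sumrB -sumrN; apply: eq_bigr => e _.
  rewrite (_ : (G :&: [set e] == set0) = (e \notin G)).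
    by case: (e \in G) => /=; ring.
  by rewrite setI_eq0 disjoint_sym disjoints1.
have -> : \sum_(e in G) #|e|%:R = \sum_v \sum_(e in G) (v \in e)%:R :> R.
  rewrite exchange_big; apply: eq_bigr => e _ /=.
  by rewrite -sum1_card natr_sum big_mkcond /=; apply: eq_bigr => v _; case: (v \in e).
rewrite /niso -sumrB; apply: eq_bigr => v _; rewrite setIUl setU_eq0.
have [/set0Pn[e]|] := boolP (G :&: star v != set0).
  rewrite in_setI inE => /andP[eG /andP[_ ve]].
  have eL := subsetP sG _ eG.
  have -> : (E :&: star v == set0) = true.
    apply/eqP/setP => f; rewrite in_setI !inE; apply/negP => /andP[fE /andP[_ vf]].
    have := subsetP sE _ fE; rewrite inE => /andP[fL fC].
    by move: fL; rewrite (loneP eL fC ve vf) eL.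
  rewrite (bigD1 e) //= ve big1 ?addr0.
    rewrite (_ : _ == set0 = false) ?subrr //.
    apply/negbTE/set0Pn; exists e; rewrite in_setI eG inE ve andbT.
    by apply: (subsetP sC); apply: (subsetP (lone_sub C)).
  move=> f /andP[fG fe]; case: (boolP (v \in f)) => // vf; case/negP: fe.
  apply/eqP; apply: loneP eL _ ve vf.
  by apply: (subsetP (lone_sub C)); apply: (subsetP sG).
rewrite negbK => /eqP G0; rewrite G0 eqxx andbT big1 ?subr0 // => e eG.
case: (boolP (v \in e)) => // ve; have : e \in G :&: star v.
  rewrite in_setI eG inE ve andbT.
  by apply: (subsetP sC); apply: (subsetP (lone_sub C)); apply: (subsetP sG).
by rewrite G0 inE.
Qed.

Lemma lone_decay (theta t : R) C : C \subset edges n ->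
  `|bern (2^-1) C (fun E => cos (theta + t * niso E))| <=
  expR (- (2^-1 * sin t ^+ 2 * #|lone C|%:R)).
Proof.
move=> sC; have h01 : 0 <= (2^-1 : R) <= 1 by lra.
have CE : (C :\: lone C) :|: lone C = C.
  by rewrite setUC -{1}(setIidPr (lone_sub C)) setID.
rewrite -{1}CE.
rewrite bern_split; last by rewrite -setI_eq0 setIDAC -setIDA setDv setI0.
apply: le_trans (ler_norm_bern _ _ h01) _.
rewrite -[leRHS](bern_cst (2^-1) (C :\: lone C)); apply: ler_bern => // E sE.
rewrite (@eq_bern _ _ _ _ _ (fun G => cos ((theta + t * (niso E - 2 * #|lone C|%:R)) +
    (t *+ 2) * avoid_count R (fun e => [set e]) (lone C) G))); last first.
  by move=> G sG; rewrite (niso_lone sC sE sG) -mulr_natl; congr cos; ring.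
apply: le_trans (@bern_cos_decay R _ _ (fun e => [set e]) (2^-1) (t *+ 2) _ (lone C) (lone C) 1 h01 _ _ _) _.
- by move=> e eL; rewrite sub1set.
- by move=> e _; rewrite cards1.
- by move=> e f _ _ ef; rewrite disjoints1 inE.
(* Jumps of size two mean angle 2t, and with fair coins (1 - cos 2t)/4 = sin^2 t / 2. *)
rewrite ler_expR lerN2 cos_mulr2n cos2sin2 expr1 le_eqVlt; apply/orP; left.
by apply/eqP; rewrite -mulr_natl; field.
Qed.

(** A new edge can only add itself, and it spoils at most one lone edge at each of its endpoints,
    since lone edges are pairwise disjoint. *)
Lemma lone_card_lipschitz f C : f \in edges n -> f \notin C -> C \subset edges n ->
  `|#|lone (f |: C)|%:R - #|lone C|%:R| <= 2 :> R.
Proof.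
move=> fD fC sC.
have up : lone (f |: C) \subset f |: lone C.
  apply/subsetP => e; rewrite !inE => /andP[/orP[->//|eC] /forall_inP h].
  rewrite eC; apply/orP; right; apply/forall_inP => g gC; apply: h.
  by rewrite inE gC orbT.
pose K := [set e in lone C | ~~ [disjoint e & f]].
have down : lone C \subset lone (f |: C) :|: K.
  apply/subsetP => e eL; rewrite in_setU orbC [e \in K]inE eL /=.
  case: (boolP [disjoint e & f]) => //= ef; move: eL; rewrite !inE => /andP[eC /forall_inP h].
  rewrite eC orbT /=; apply/forall_inP => g; rewrite !inE => /orP[/eqP ->|/h //].
  by rewrite ef orbT.
have cK : (#|K| <= 2)%N.
  move: fD; rewrite inE => /eqP <-; rewrite -!sum1_card.
  apply: (@leq_trans (\sum_(e in K) \sum_(v in f) (v \in e))).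
    apply: leq_sum => e; rewrite inE => /andP[_ /pred0Pn[v /= /andP[ve vf]]].
    by rewrite (bigD1 v) //= ve.
  rewrite exchange_big; apply: leq_sum => v _ /=.
  case: (pickP (fun e => (e \in K) && (v \in e))) => [e /andP[eK ve]|h].
    rewrite (bigD1 e) //= ve big1 // => g /andP[gK ge]; apply/eqP; rewrite eqb0.
    apply/negP => vg; case/negP: ge; apply/eqP.
    move: eK gK; rewrite [e \in K]inE [g \in K]inE => /andP[eL _] /andP[gL _].
    by apply: loneP eL _ ve vg; apply: (subsetP (lone_sub C)).
  by rewrite big1 // => e eK; have := h e; rewrite eK /= => ->.
have u1 : (#|lone (f |: C)| <= #|lone C| + 1)%N.
  apply: leq_trans (subset_leq_card up) _; rewrite cardsU1 addnC leq_add2l.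
  by case: (_ \notin _).
have u2 : (#|lone C| <= #|lone (f |: C)| + 2)%N.
  apply: leq_trans (subset_leq_card down) _; apply: leq_trans (leq_card_setU _ _) _.
  by rewrite leq_add2l.
move: u1 u2; rewrite -!(ler_nat R) !natrD ler_norml => u1 u2.
by apply/andP; split; lra.
Qed.

(** An edge is lone iff it is the only one present in the union of the stars of its endpoints. This
    union has 2n - 3 edges, so 2n - 4 must be absent. *)
Lemma lone_mean (r : R) : (1 < n)%N ->
  bern r (edges n) (fun C => #|lone C|%:R) =
  #|edges n|%:R * (r * (1 - r) ^+ (2 * n - 4)).
Proof.
move=> n1.
rewrite (@eq_bern _ _ _ _ _ (fun C => \sum_(e in edges n)
   (C :&: [set f in edges n | ~~ [disjoint e & f]] == [set e])%:R)); last first.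
  move=> C sC; rewrite -sum1_card natr_sum [LHS]big_mkcond [RHS]big_mkcond /=.
  apply: eq_bigr => e _; case: (boolP (e \in edges n)) => eD; last first.
    by rewrite ifN // inE negb_and (contra (subsetP sC e)).
  have ee : ~~ [disjoint e & e].
    move: eD; rewrite inE -setI_eq0 setIid => /eqP h; apply/eqP => e0.
    by rewrite e0 cards0 in h.
  rewrite -[1]/(1%N%:R) -[0]/(0%N%:R) -(fun_if (fun k : nat => k%:R : R)); congr (_%:R).
  suff -> : (e \in lone C) = (C :&: [set f in edges n | ~~ [disjoint e & f]] == [set e]).
    by case: (_ == _).
  apply/idP/eqP => [eL|/setP h].
    apply/setP => f; rewrite in_set1 in_setI inE; apply/idP/eqP => [/and3P[fC _]|->].
      by move=> /pred0Pn[v /= /andP[ve vf]]; apply: loneP eL fC ve vf.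
    by rewrite (subsetP (lone_sub C) _ eL) eD ee.
  have := h e; rewrite in_set1 eqxx in_setI => /andP[eC _].
  rewrite inE eC; apply/forall_inP => f fC; have := h f.
  rewrite in_set1 in_setI inE fC (subsetP sC _ fC) /= => <-.
  by rewrite orNb.
rewrite bern_sum (eq_bigr (fun=> r * (1 - r) ^+ (2 * n - 4))).
  by rewrite sumr_const mulr_natl.
move=> e eD; have := eD; rewrite inE => /cards2P[u [v [uv eE]]].
have tE : [set f in edges n | ~~ [disjoint e & f]] = star u :|: star v.
  apply/setP => f; rewrite !inE -andb_orr; congr (_ && _).
  rewrite eE; apply/pred0Pn/orP => [[w /= /andP[]]|].
    by rewrite !inE => /orP[] /eqP ->; [left | right].
  by case=> h; [exists u | exists v]; rewrite /= !inE eqxx ?orbT.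
have eS : [set e] \subset star u :|: star v.
  by rewrite sub1set !inE eE set21 cards2 uv.
rewrite tE bern_trace ?subUset ?star_sub // cards1 expr1.
rewrite cardsU !card_star (starI uv) cards1; congr (_ * _ ^+ _); lia.
Qed.

(* Thinning G(n, 2p) by a fair coin gives G(n, p), and every isolated edge of
   the denser graph changes the count by two according to its coin. *)
Lemma niso_decay2 (p theta t : R) (m := #|edges n|%:R * (2 * p * (1 - 2 * p) ^+ (2 * n - 4))) :
  (1 < n)%N -> 0 <= 2 * p <= 1 -> 0 < m ->
  `|bern p (edges n) (fun E => cos (theta + t * niso E))| <=
  32 * #|edges n|%:R * p / m ^+ 2 + expR (- (4^-1 * m * sin t ^+ 2)).
Proof.
move=> n1 p2 m0; have -> : p = 2 * p * 2^-1 by field.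
rewrite bern_thin.
have mE : m = bern (2 * p) (edges n) (fun C => #|lone C|%:R) by rewrite lone_mean.
apply: le_trans (ler_norm_bern _ _ p2) _.
apply: (@le_trans _ _ (bern (2 * p) (edges n)
   (fun C => (#|lone C|%:R < m / 2)%R%:R + expR (- (4^-1 * m * sin t ^+ 2))))).
  apply: ler_bern => // C sC; case: ltP => h /=.
    apply: (@le_trans _ _ 1); last by rewrite lerDl expR_ge0.
    have h01 : 0 <= (2^-1 : R) <= 1 by lra.
    apply: le_trans (ler_norm_bern _ _ h01) _.
    rewrite -[leRHS](bern_cst (2^-1) C); apply: ler_bern => // E1 _; exact: cos_max.
  rewrite add0r; apply: le_trans (lone_decay _ _ sC) _.
  rewrite ler_expR lerN2; have s0 := sqr_ge0 (sin t).
  have := ler_wpM2l s0 h; lra.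
rewrite bernD bern_cst lerD2r.
(* At edge probability 2p, Chebyshev's 4 times the Efron-Stein bound 2^2 |edges| 2p is 32 |edges|
   p. *)
apply: le_trans (bern_chebyshev p2 m0 mE) _.
rewrite ler_pM2r ?invr_gt0 ?exprn_gt0 // {1}mE.
have h2 : 0 <= 2 :> R by [].
apply: le_trans (ler_wpM2l _ (bern_var_lipschitz p2 h2 _)) _ => //.
  by move=> e C; apply: lone_card_lipschitz.
by lra.
Qed.

End IsolatedEdges.

(** * The signed measure comparing W with the translated Poisson law *)

Section Charge.
Local Open Scope classical_set_scope.
Variables (R : realType) (n : nat) (p : R).
Hypothesis p01 : 0 <= p <= 1.
Local Notation Ex := (bern p (edges n)).
Local Notation niso := (@niso R n).
Local Notation V := (niso_var n p).
Local Notation mu := (n%:R * iso_prob n p).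
Local Notation lam := (tp_param mu V).
Local Notation sh := (tp_shift mu V).

Definition isolated_law : seq (R * int) :=
  [seq (gnp_weight p E, (Defs.isolated E)%:Z) | E <- enum (powerset (edges n))].

Definition neg_tp_law (N : nat) : seq (R * int) :=
  [seq (- Defs.poisson_pmf lam k, k%:Z + sh) | k <- iota 0 N].

(** Law of W, with one atom per graph, minus the translated Poisson law truncated to N atoms. *)
Definition charge N := isolated_law ++ neg_tp_law N.

Lemma tp_param_shift : lam = mu - sh%:~R.
Proof. by rewrite /tp_param; ring. Qed.

(** lam - V is the fractional part gamma, the price of translating by an integer; the means agree
    exactly by [tp_param_shift]. *)
Lemma tp_param_bounds : V <= lam <= V + 1.
Proof.
rewrite /tp_param /tp_shift; have := Num.Theory.floor_itv (mu - V).
set f := (Num.floor _)%:~R; rewrite intrD => h; lra.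
Qed.

Lemma osc_charge N theta t : osc (charge N) theta t =
  Ex (fun E => cos (theta + t * niso E)) - poisson_trig lam N (theta + t * sh%:~R) t.
Proof.
rewrite /osc big_cat /=; congr (_ + _).
  rewrite big_map big_enum /=; apply: eq_bigr => E; rewrite powersetE => sE.
  by rewrite /gnp_weight /= -nisoE.
rewrite big_map /= -{1}(subn0 N) -/(index_iota 0 N) big_mkord -sumrN; apply: eq_bigr => k _ /=.
by rewrite intrD mulNr; congr (- (_ * cos _)); ring.
Qed.

(** Both centred characteristic functions satisfy nearly the same equation. For the majorant 4 (u +
    z^4), and with 1/z^4 = sqrt V, Gronwall allows errors up to 4 + 4 V u^2 + 4 sqrt(V) u; they sum
    to at most 3 V u^2 + 3 sqrt(V) u + 1 + u, the last term coming from lam - V. *)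
Lemma osc_charge_low N (z : R) theta t : 0 < z <= 1 -> V * z ^+ 8 = 1 ->
  1 - z ^+ 4 <= \sum_(k < N) Defs.poisson_pmf lam k ->
  N%:R * Defs.poisson_pmf lam N <= 1 -> 0 <= t ->
  `|osc (charge N) theta t| <= 4 * (t + z ^+ 4).
Proof.
move=> /andP[z0 z1] Vz tail trunc t0.
have z80 : 0 < z ^+ 8 by exact: exprn_gt0.
have z40 : 0 < z ^+ 4 by exact: exprn_gt0.
have z41 : z ^+ 4 <= 1 by apply: exprn_ile1 => //; exact: ltW.
have VE : V = (z ^+ 8)^-1 by rewrite -[LHS]mulr1 -(mulfV (lt0r_neq0 z80)) mulrA Vz mul1r.
have sVE : Num.sqrt V = (z ^+ 4)^-1.
  by rewrite VE (exprM z 4 2) -exprVn sqrtr_sqr ger0_norm // invr_ge0 ltW.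
have V1 : 1 <= V by rewrite VE invf_ge1 // exprn_ile1 // ltW.
have /andP[lV lV1] := tp_param_bounds.
have lam0 : 0 <= lam by lra.
(* The phase is frozen at the end point t, so that at u = t it undoes the centring and leaves theta
   + t W. *)
set th := theta + t * mu.
have [eW [dW bW]] := niso_ode n p01 th.
have [eZ [dZ bZ]] := poisson_ode lam0 N th.
pose gZ (u : R) := poisson_trig lam N (th - u * lam) u.
pose gW (u : R) := Ex (fun E => cos (th + u * (niso E - mu))).
pose D (u : R) := gW u - gZ u.
have -> : osc (charge N) theta t = D t.
  rewrite osc_charge /D /gW /gZ; congr (_ - poisson_trig _ _ _ _).
    by apply: eq_bern => E _; congr cos; rewrite /th; ring.
  by rewrite /th tp_param_shift; ring.
have gZ1 u : `|gZ u| <= 1.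
  apply: le_trans (ler_norm_sum _ _ _) _; apply: le_trans (poisson_sum_le1 lam0 N).
  apply: ler_sum => k _; rewrite normrM ger0_norm ?poisson_pmf_ge0 //.
  by rewrite ler_piMr ?poisson_pmf_ge0 // cos_max.
apply: (@gronwall_linear R D (fun u => eW u - eZ u + (lam - V) * u * gZ u)
  (fun u => 4 * (u + z ^+ 4)) (fun=> 4) V t) => //; first by lra.
- move=> u _; have h1 := dW u; have h2 := dZ u.
  apply: is_derive_eq; rewrite -/(gW u) -/(gZ u) /D; ring.
- move=> u _; apply: is_derive_eq; rewrite /GRing.scale /=; ring.
- move=> u /andP[u0 _].
  apply: le_trans (ler_normD _ _) _; apply: le_trans (lerD (ler_normB _ _) (lexx _)) _.
  have b1 := bW u u0; have b2 := bZ u u0.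
  have b3 : `|(lam - V) * u * gZ u| <= u.
    rewrite normrM -[leRHS]mulr1; apply: ler_pM => //.
    by rewrite normrM !ger0_norm ?subr_ge0 // ler_piMl //; lra.
  have b4 : V * u * (4 * (u + z ^+ 4)) = 4 * (V * u ^+ 2) + 4 * Num.sqrt V * u.
    rewrite sVE mulrDr; have -> : (z ^+ 4)^-1 = V * z ^+ 4.
      by rewrite VE; field; rewrite gt_eqF.
    ring.
  have b5 : u <= Num.sqrt V * u.
    by rewrite ler_peMl // sVE invf_ge1.
  have b6 : lam * u ^+ 2 / 2 <= V * u ^+ 2.
    have : lam * u ^+ 2 <= (2 * V) * u ^+ 2 by rewrite ler_wpM2r ?sqr_ge0 //; lra.
    lra.
  have b7 : 0 <= V * u ^+ 2 by rewrite mulr_ge0 ?sqr_ge0 //; lra.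
  lra.
- rewrite /D /gW /gZ add0r.
  have -> : Ex (fun E => cos (th + 0 * (niso E - mu))) = cos th.
    by rewrite (@eq_bern _ _ _ _ _ (fun=> cos th)) ?bern_cst // => E _; rewrite mul0r addr0.
  have -> : poisson_trig lam N (th - 0 * lam) 0 = cos th * \sum_(k < N) Defs.poisson_pmf lam k.
    rewrite /poisson_trig big_distrr; apply: eq_bigr => k _ /=.
    by rewrite !mul0r addr0 subr0 mulrC.
  have s1 := poisson_sum_le1 lam0 N.
  have s2 : 0 <= 1 - \sum_(k < N) Defs.poisson_pmf lam k by rewrite subr_ge0.
  rewrite -[X in X - _]mulr1 -mulrBr normrM (ger0_norm s2).
  apply: (@le_trans _ _ (1 * (1 - \sum_(k < N) Defs.poisson_pmf lam k))).
    by apply: ler_wpM2r => //; exact: cos_max.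
  lra.
Qed.

(** A forward difference at j is the point mass at j + 1. The truncation level depends on j, which
    is harmless since the final bounds do not depend on N. *)
Lemma mass_charge (j : int) : exists N0, forall N, (N0 <= N)%N ->
  mass (charge N) (j + 1) =
  Delta (distW n p) j - Delta (distTP mu V) j.
Proof.
exists (absz (j + 1 - sh)%R).+1 => N hN.
rewrite /mass big_cat /=; congr (_ + _).
  rewrite big_map /= big_enum_cond /= /Delta /distW.
  rewrite [X in X - _](bigID (fun E => ((Defs.isolated E)%:Z <= j)%R)) /=.
  rewrite [X in X + _ - _](eq_bigl (fun E => (E \in powerset (edges n)) && ((Defs.isolated E)%:Z <= j)%R)).
    rewrite addrAC subrr add0r; apply: eq_bigl => E; rewrite -andbA; congr (_ && _).
    by apply/idP/idP => h; lia.
  by move=> E; rewrite -andbA; congr (_ && _); apply/idP/idP => h; lia.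
rewrite big_map /= /Delta /distTP.
have sumE (q : nat) : (q < N)%N ->
    \sum_(k <- iota 0 N | k%:Z + sh == q%:Z + sh) - Defs.poisson_pmf lam k = - Defs.poisson_pmf lam q.
  move=> qN; rewrite -{1}(subn0 N) -/(index_iota 0 N) big_mkord (bigD1 (Ordinal qN)) //=.
  rewrite big1 ?addr0 // => k /andP[/eqP /addIr [kq] /negP []].
  by apply/eqP/val_inj.
case: (lerP sh (j + 1)) => h1; last first.
  rewrite ifF ?subr0 ?oppr0; last by apply/negbTE; rewrite -ltNge; lia.
  by rewrite big1 // => k /eqP kj; exfalso; lia.
case: (lerP sh j) => h2.
  have -> : absz (j + 1 - sh)%R = (absz (j - sh)%R).+1 by lia.
  rewrite [in RHS]big_ord_recr /= addrAC subrr add0r -sumE; last by lia.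
  by apply: eq_bigl => k; congr (_ == _); lia.
have jE : j + 1 = sh by lia.
rewrite jE subrr absz0 big_ord_recr big_ord0 /= add0r subr0 -sumE; last by lia.
by apply: eq_bigl => k; congr (_ == _); lia.
Qed.

Lemma charge_truncation (z : R) (N0 : nat) : 0 < z <= 1 -> V * z ^+ 8 = 1 ->
  exists2 N, (N0 <= N)%N &
    (forall theta t, 0 <= t -> `|osc (charge N) theta t| <= 4 * (t + z ^+ 4)) /\
    (forall theta t, 0 <= t <= pi ->
      `|osc (charge N) theta t| <= `|Ex (fun E => cos (theta + t * niso E))| +
         2 * expR (- (V * (1 - cos t)))).
Proof.
move=> z01 Vz; have /andP[z0 z1] := z01.
have V0 := niso_var_ge0 n p01.
have /andP[lV lV1] := tp_param_bounds.
have lam0 : 0 <= lam by lra.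
(* z^4 serves the comparison near 0; exp(-4 lam)/8 makes 16 N pmf N exp(4 lam) at most 2, within the
   3 allowed by [poisson_trig_decay]. *)
pose eps := Num.min (z ^+ 4) (8^-1 * expR (- (4 * lam))).
have eps0 : 0 < eps by rewrite lt_min exprn_gt0 ?mulr_gt0 ?expR_gt0.
have epsz : eps <= z ^+ 4 by rewrite ge_min lexx.
have epsE : eps <= 8^-1 * expR (- (4 * lam)) by rewrite ge_min lexx orbT.
have z41 : z ^+ 4 <= 1 by apply: exprn_ile1 => //; exact: ltW.
have [N hN [h1 h2]] := poisson_truncation lam0 N0 eps0.
exists N => //; split=> theta t ht.
  by apply: osc_charge_low => //; lra.
rewrite osc_charge; apply: le_trans (ler_normB _ _) _; rewrite lerD2l.
have pi2 := pihalf_lt2 R.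
apply: le_trans (poisson_trig_decay lam0 _ _ _) _; first by lra.
  have e4 : 0 <= expR (4 * lam) := expR_ge0 _.
  have hh : N%:R * Defs.poisson_pmf lam N <= 8^-1 * expR (- (4 * lam)) by lra.
  have hE : expR (- (4 * lam)) * expR (4 * lam) = 1 by rewrite -expRD addNr expR0.
  by have := ler_wpM2r e4 hh; rewrite -[leRHS]mulrA hE; lra.
rewrite ler_wpM2l // ler_expR lerN2 ler_wpM2r // subr_ge0; exact: cos_le1.
Qed.

Lemma dloc_le (m : nat) (F G : int -> R) (B : R) :
  (forall j, `|Delta (Fbar m F) j - Delta (Fbar m G) j| <= B) -> `|dloc m F G| <= B.
Proof.
move=> h; rewrite /dloc; set S := (X in sup X).
have S0 : S !=set0 by exists `|Delta (Fbar m F) 0 - Delta (Fbar m G) 0|; exists 0.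
have ubS : ubound S B by move=> _ [j _ <-].
rewrite ger0_norm; first exact: ge_sup.
apply: le_trans (normr_ge0 (Delta (Fbar m F) 0 - Delta (Fbar m G) 0)) _.
by apply: ub_le_sup; [exists B | exists 0].
Qed.

Lemma Delta_Fbar1 (F : int -> R) j : Delta (Fbar 1 F) j = Delta F j.
Proof. by rewrite /Delta /Fbar !big_ord_recr !big_ord0 /= !subr0 !add0r !divr1. Qed.

Lemma Delta_Fbar2 (F : int -> R) j :
  Delta (Fbar 2 F) j = (Delta F j + Delta F (j - 1)) / 2.
Proof.
rewrite /Delta /Fbar !big_ord_recr !big_ord0 /= !subr0 !add0r.
by rewrite subrK addrK; ring.
Qed.

Section DlocBounds.
Variables (z K c : R).
Hypotheses (z01 : 0 < z <= 1) (Vz : V * z ^+ 8 = 1) (K0 : 0 <= K) (c0 : 0 < c).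

Lemma niso_var_eighth_root : V = (z ^+ 8)^-1.
Proof.
have /andP[z0 _] := z01.
by rewrite -[LHS]mulr1 -(mulfV (lt0r_neq0 (exprn_gt0 8 z0))) mulrA Vz mul1r.
Qed.

(** The Poisson part accounts for the 2 in K + 2, and for 1/32 through 1 - cos t >= t^2/32 on
    [0, pi]. *)
Lemma dloc1_bound :
  (forall theta t : R, 0 <= t <= pi ->
    `|Ex (fun E => cos (theta + t * niso E))| <=
       K * z ^+ 8 + K * expR (- (c * t ^+ 2 / z ^+ 8))) ->
  `|dloc 1 (distW n p) (distTP (meanW n p) (varW n p))| <=
  (2 * 4 + 4 * (K + 2) + (K + 2) / (Num.min c (1 / 32)) ^+ 2) * z ^+ 6.
Proof.
set K' := K + 2; set c' := Num.min _ _; move=> decay; rewrite meanW_eq varW_eq //; apply: dloc_le => j.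
rewrite !Delta_Fbar1; have [N0 hN0] := mass_charge j.
have [N hN [h1 h2]] := charge_truncation N0 z01 Vz.
have /andP[z0 z1] := z01.
have z80 : 0 < z ^+ 8 by exact: exprn_gt0.
have c'0 : 0 < c' by rewrite lt_min c0 divr_gt0.
have K'0 : 0 <= K' by rewrite addr_ge0.
rewrite -(hN0 N hN); apply: (mass_bound z01 _ K'0 c'0) => // [theta t /andP[t0 _]|theta t ht].
  exact: h1.
apply: le_trans (h2 theta t ht) _; apply: le_trans (lerD (decay theta t ht) (lexx _)) _.
have e1 : expR (- (c * t ^+ 2 / z ^+ 8)) <= expR (- (c' * t ^+ 2 / z ^+ 8)).
  rewrite ler_expR lerN2 ler_pM2r ?invr_gt0 // ler_wpM2r ?sqr_ge0 //.
  by rewrite ge_min lexx.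
have e2 : expR (- (V * (1 - cos t))) <= expR (- (c' * t ^+ 2 / z ^+ 8)).
  rewrite ler_expR lerN2 niso_var_eighth_root mulrC ler_pM2l ?invr_gt0 //.
  apply: le_trans (one_sub_cos_ge ht); rewrite mulrC ler_wpM2l ?sqr_ge0 //.
  by rewrite ge_min mul1r lexx orbT.
rewrite /K' !mulrDl -!addrA lerD2l.
have := ler_wpM2l K0 e1; have : 0 <= 2 * z ^+ 8 by rewrite mulr_ge0 // ltW.
lra.
Qed.

Section Lattice2.
Hypothesis decay2 : forall theta t : R, 0 <= t <= pi ->
    `|Ex (fun E => cos (theta + t * niso E))| <=
       K * z ^+ 8 + K * expR (- (c * sin t ^+ 2 / z ^+ 8)).
Local Notation K' := (K + 2).
Local Notation c' := (Num.min c (1 / 2)).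

(** Here the Poisson part is compared through 1 - cos t >= sin^2 t / 2, hence the 1/2 in [c']. *)
Lemma charge_decay2 N :
  (forall theta t, 0 <= t <= pi ->
      `|osc (charge N) theta t| <= `|Ex (fun E => cos (theta + t * niso E))| +
         2 * expR (- (V * (1 - cos t)))) ->
  forall theta t : R, 0 <= t <= pi ->
  `|osc (charge N) theta t| <= K' * z ^+ 8 + K' * expR (- (c' * sin t ^+ 2 / z ^+ 8)).
Proof.
have /andP[z0 z1] := z01; have z80 : 0 < z ^+ 8 by exact: exprn_gt0.
move=> h2 theta t ht.
apply: le_trans (h2 theta t ht) _; apply: le_trans (lerD (decay2 theta ht) (lexx _)) _.
have e1 : expR (- (c * sin t ^+ 2 / z ^+ 8)) <= expR (- (c' * sin t ^+ 2 / z ^+ 8)).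
  rewrite ler_expR lerN2 ler_pM2r ?invr_gt0 // ler_wpM2r ?sqr_ge0 //.
  by rewrite ge_min lexx.
have e2 : expR (- (V * (1 - cos t))) <= expR (- (c' * sin t ^+ 2 / z ^+ 8)).
  rewrite ler_expR lerN2 niso_var_eighth_root mulrC ler_pM2l ?invr_gt0 //.
  apply: le_trans (one_sub_cos_ge_sin2 t); rewrite mulrC ler_wpM2l ?sqr_ge0 //.
  by rewrite ge_min mul1r lexx orbT.
rewrite !mulrDl -!addrA lerD2l.
have := ler_wpM2l K0 e1; have : 0 <= 2 * z ^+ 8 by rewrite mulr_ge0 // ltW.
lra.
Qed.

Lemma dloc2_bound :
  `|dloc 2 (distW n p) (distTP (meanW n p) (varW n p))| <=
  (2 * 4 + 6 * K' + K' / (c' / 16) ^+ 2 + K' / (c' / 16)) * z ^+ 6.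
Proof.
rewrite meanW_eq varW_eq //; apply: dloc_le => j; rewrite !Delta_Fbar2.
have [N0 hN0] := mass_charge j; have [N1 hN1] := mass_charge (j - 1).
have [N hN [h1 h2]] := charge_truncation (maxn N0 N1) z01 Vz.
have c'0 : 0 < c' by rewrite lt_min c0 divr_gt0.
have K'0 : 0 <= K' by rewrite addr_ge0.
have := @mass2_bound R z (charge N) 4 K' c' z01 _ K'0 c'0 _ (charge_decay2 h2) (j + 1).
rewrite (hN0 N) ?(leq_trans (leq_maxl _ _) hN) // addrK -[X in mass _ X](subrK 1 j).
rewrite (hN1 N) ?(leq_trans (leq_maxr _ _) hN) // => H.
rewrite -mulrBl opprD addrACA; apply: H => // theta t /andP[t0 _]; exact: h1.
Qed.

(** kappa <= V ensures that the Poisson part decays at rate kappa as well. *)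
Lemma dloc1_bound_lattice2 (kappa : R) : 0 <= kappa <= V ->
  (forall theta t : R, 0 <= t <= pi ->
    `|Ex (fun E => cos (theta + t * niso E))| <=
       K * z ^+ 8 + K * expR (- (kappa * (1 - cos t)))) ->
  `|dloc 1 (distW n p) (distTP (meanW n p) (varW n p))| <=
  (2 * 4 + 8 * K' + K' / (c' / 16) ^+ 2) * z ^+ 6 +
  (K' + K' / (c' / 32)) * expR (- (kappa / 2)) * z ^+ 4.
Proof.
move=> /andP[ka0 kaV] decay1.
rewrite meanW_eq varW_eq //; apply: dloc_le => j; rewrite !Delta_Fbar1.
have [N0 hN0] := mass_charge j.
have [N hN [h1 h2]] := charge_truncation N0 z01 Vz.
have /andP[z0 z1] := z01; have z80 : 0 < z ^+ 8 by exact: exprn_gt0.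
have c'0 : 0 < c' by rewrite lt_min c0 divr_gt0.
have K'0 : 0 <= K' by rewrite addr_ge0.
rewrite -(hN0 N hN).
apply: (@mass_bound_lattice2 R z (charge N) 4 K' c' z01 _ K'0 c'0 _ (charge_decay2 h2)) => //.
  by move=> theta t /andP[t0 _]; exact: h1.
move=> theta t ht.
apply: le_trans (h2 theta t ht) _; apply: le_trans (lerD (decay1 theta t ht) (lexx _)) _.
have e2 : expR (- (V * (1 - cos t))) <= expR (- (kappa * (1 - cos t))).
  by rewrite ler_expR lerN2 ler_wpM2r // subr_ge0 cos_le1.
rewrite !mulrDl -!addrA lerD2l.
have : 0 <= 2 * z ^+ 8 by rewrite mulr_ge0 // ltW.
lra.
Qed.

End Lattice2.
End DlocBounds.
End Charge.

(** * Elementary bounds on powers, exponentials and bipartitions *)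

Section ElementaryBounds.
Local Open Scope classical_set_scope.
Variable R : realType.
Implicit Types (p y : R) (k : nat).

Lemma expr_one_sub_le p k : 0 <= p <= 1 -> (1 - p) ^+ k <= expR (- (k%:R * p)).
Proof.
move=> /andP[p0 p1]; rewrite -mulrN expRM_natl; apply: lerXn2r.
- by rewrite nnegrE subr_ge0.
- by rewrite nnegrE expR_ge0.
- exact: expR_ge1Dx.
Qed.

Lemma expr_one_sub_ge p k : 0 <= p <= 1 / 2 ->
  expR (- (k%:R * p + 2 * k%:R * p ^+ 2)) <= (1 - p) ^+ k.
Proof.
move=> /andP[p0 p1].
have -> : - (k%:R * p + 2 * k%:R * p ^+ 2) = k%:R * - (p + 2 * p ^+ 2) by ring.
rewrite expRM_natl; apply: lerXn2r; rewrite ?nnegrE ?expR_ge0 //; first by lra.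
rewrite expRN -[leRHS]invrK lef_pV2 ?posrE ?expR_gt0 ?invr_gt0 //; last by lra.
apply: le_trans (expR_ge1Dx _); rewrite -div1r ler_pdivrMr; last by lra.
(* (1 + p + 2p^2) (1 - p) = 1 + p^2 (1 - 2p), which is at least 1. *)
have : 0 <= p ^+ 2 * (1 - 2 * p) by rewrite mulr_ge0 ?sqr_ge0 //; lra.
by rewrite !exprS expr0; lra.
Qed.

Lemma bernoulli_ineq p k : 0 <= p <= 1 -> 1 - k%:R * p <= (1 - p) ^+ k.
Proof.
move=> /andP[p0 p1]; elim: k => [|k IH]; first by rewrite mul0r subr0 expr0.
have h : 0 <= k%:R * p ^+ 2 by rewrite mulr_ge0 ?sqr_ge0.
have q0 : 0 <= 1 - p by lra.
have := ler_wpM2l q0 IH; rewrite -natr1 exprS; move: h; rewrite expr2; lra.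
Qed.

Lemma one_sub_expRN_ge y : 0 <= y <= 1 -> y / 2 <= 1 - expR (- y).
Proof.
move=> /andP[y0 y1]; rewrite lerBrDr -lerBrDl expRN.
rewrite -div1r ler_pdivrMr ?expR_gt0 //.
have := expR_ge1Dx y; have := expR_gt0 y => e0 e1.
have h : (1 - y / 2) * (1 + y) <= (1 - y / 2) * expR y by apply: ler_wpM2l => //; lra.
have : 0 <= y * (1 - y) by rewrite mulr_ge0 //; lra.
lra.
Qed.

(** A binomial variable of mean at least y is positive with probability at least y/2; y stays below
    1 so that 1 - exp(-y) remains comparable to y. *)
Lemma one_sub_expr_ge p y k : 0 <= p <= 1 -> 0 <= y <= 1 -> y <= k%:R * p ->
  y / 2 <= 1 - (1 - p) ^+ k.
Proof.
move=> hp hy yk; apply: le_trans (one_sub_expRN_ge hy) _.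
rewrite lerD2l lerN2; apply: le_trans (expr_one_sub_le k hp) _.
by rewrite ler_expR lerN2.
Qed.

Lemma mul_expRN_le1 y : y * expR (- y) <= 1.
Proof.
rewrite expRN ler_pdivrMr ?expR_gt0 // mul1r.
by apply: le_trans (expR_ge1Dx y); lra.
Qed.

Lemma balanced_bipartition (n : nat) : (4 <= n)%N -> exists A : {set 'I_n},
  [/\ (0 < #|A|)%N, n%:R / 3 <= #|A|%:R :> R, n%:R / 2 <= #|~: A|%:R :> R &
      n%:R / 4 <= #|~: A|.-1%:R :> R].
Proof.
move=> n4; have [A cA] : exists A : {set 'I_n}, #|A| = n./2.
  exists [set v in take n./2 (enum 'I_n)].
  rewrite cardsE; have /card_uniqP -> : uniq (take n./2 (enum 'I_n)).
    by rewrite take_uniq // enum_uniq.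
  by rewrite size_takel // size_enum_ord; lia.
have cB : #|~: A| = (n - n./2)%N by rewrite cardsCs setCK card_ord cA.
have h3 : (n <= 3 * #|A|)%N by lia.
have h2 : (n <= 2 * #|~: A|)%N by lia.
have h4 : (n <= 4 * #|~: A|.-1)%N by lia.
exists A; split; first by lia.
- by move: h3; rewrite -(ler_nat R) natrM; lra.
- by move: h2; rewrite -(ler_nat R) natrM; lra.
- by move: h4; rewrite -(ler_nat R) natrM; lra.
Qed.

Lemma natr_gt0_of_ge4 (n : nat) : (4 <= n)%N -> 0 < n%:R :> R /\ (2 <= n)%N.
Proof. by move=> n4; rewrite ltr0n; lia. Qed.

Lemma powR_eighth_root (V : R) : 1 <= V -> exists2 z, 0 < z <= 1 & V * z ^+ 8 = 1 /\
  V `^ (- (3 / 4)) = z ^+ 6.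
Proof.
move=> V1; have V0 : 0 < V by lra.
exists (V `^ (- (1 / 8))).
  rewrite powR_gt0 //=; rewrite -[leRHS](powRr0 V); apply: ler_powR => //; lra.
rewrite -!powR_mulrn ?powR_ge0 // -!powRrM; split; last by (congr (_ `^ _); field).
rewrite -[X in X * _](powRr1 (ltW V0)) -powRD; last by rewrite (gt_eqF V0) implybT.
by rewrite (_ : 1 + - (1 / 8) * 8%:R = 0) ?powRr0 //; lra.
Qed.

End ElementaryBounds.

(** * Variance and decay for fixed n and p in the two regimes *)

Section FixedSize.
Local Open Scope classical_set_scope.
Variables (R : realType) (n : nat) (p : R).
Local Notation Ex := (bern p (edges n)).
Local Notation niso := (@niso R n).
Local Notation V := (niso_var n p).
Local Notation pi_ := (iso_prob n p).
Local Notation r_ := (var_ratio n p).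

Lemma var_ratio_bounds : 0 <= p <= 1 -> 1 - pi_ <= r_ <= 2 * (1 - pi_).
Proof.
move=> p01; have := pendant_mean_le n p01; have := pendant_prob_ge0 n p01 => a0.
have h : 0 <= n.-1%:R * pendant_prob n p by exact: mulr_ge0.
by rewrite /var_ratio => h2; lra.
Qed.

Lemma predn_ge_half : (2 <= n)%N -> n%:R / 2 <= n.-1%:R :> R.
Proof.
move=> n2; have : (n <= 2 * n.-1)%N by lia.
by rewrite -(ler_nat R) natrM; lra.
Qed.

Section Intermediate.
Variable c0 : R.
Hypotheses (n4 : (4 <= n)%N) (p2 : 0 <= p <= 1 / 2) (c01 : 0 < c0 <= 1)
  (c0n : c0 <= n%:R * p) (np2 : n%:R * p ^+ 2 <= 4).

(** n p^2 <= 4 caps the second order term 2 n p^2 of [expr_one_sub_ge] at 8, hence exp(-8). The 2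
    pays for one factor 1 - p >= 1/2. *)
Lemma iso_prob_bounds : expR (- 8) * expR (- (n%:R * p)) <= pi_ <= 2 * expR (- (n%:R * p)).
Proof.
have hp := p2; have hnp := np2.
have p01 : 0 <= p <= 1 by lra.
have q0 : 0 < 1 - p by lra.
have nE : (1 - p) ^+ n = pi_ * (1 - p).
  by rewrite /iso_prob -exprSr prednK //; apply: leq_trans n4.
apply/andP; split.
  apply: (@le_trans _ _ ((1 - p) ^+ n)).
    apply: le_trans (expr_one_sub_ge n p2); rewrite -expRD ler_expR; lra.
  rewrite nE ler_piMr //; last by lra.
  by case/andP: (iso_prob01 n p01).
have := expr_one_sub_le n p01; rewrite nE => h.
have /andP[pi0 _] := iso_prob01 n p01.
have : pi_ * (1 / 2) <= pi_ * (1 - p) by apply: ler_wpM2l => //; lra.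
lra.
Qed.

Lemma one_sub_iso_prob_ge : c0 / 4 <= 1 - pi_.
Proof.
have hp := p2; have hc := c01; have hcn := c0n.
have -> : c0 / 4 = (c0 / 2) / 2 by field.
apply: one_sub_expr_ge; [lra | lra |].
have n2 : (2 <= n)%N by apply: leq_trans n4.
have /andP[p0 _] := p2.
have := ler_wpM2r p0 (predn_ge_half n2); lra.
Qed.

Lemma niso_var_bounds :
  expR (- 8) * c0 / 4 * (n%:R * expR (- (n%:R * p))) <= V <=
  4 * (n%:R * expR (- (n%:R * p))).
Proof.
have hp := p2; have p01 : 0 <= p <= 1 by lra.
have /andP[l u] := iso_prob_bounds.
have /andP[rl ru] := var_ratio_bounds p01.
have g := one_sub_iso_prob_ge; have hc := c01.
have /andP[pi0 pi1] := iso_prob01 n p01.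
have e0 : 0 <= expR (- 8) * expR (- (n%:R * p)) :> R by rewrite mulr_ge0 ?expR_ge0.
have n0 : 0 <= n%:R :> R by [].
have r0 : 0 <= r_ by lra.
have VE : V = n%:R * (pi_ * r_) by rewrite /niso_var; ring.
have h1 : expR (- 8) * expR (- (n%:R * p)) * (c0 / 4) <= pi_ * r_ by apply: ler_pM => //; lra.
have h2 : pi_ * r_ <= 2 * expR (- (n%:R * p)) * 2 by apply: ler_pM => //; lra.
have := ler_wpM2l n0 h1; have := ler_wpM2l n0 h2; rewrite -VE; lra.
Qed.

(** When np >= c0, typically at least n c0/32 vertices are active, and a free vertex is joined to
    one of them with probability at least c0^2/64. The exceptional events cost O(p + 1/V). *)
Lemma niso_decay_intermediate (theta t : R) : 1 <= V -> 0 <= t <= pi ->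
  `|Ex (fun E => cos (theta + t * niso E))| <=
   ((2 * 64 * 64) / c0 ^+ 2 + 56) * V^-1 + expR (- (c0 ^+ 2 / (96 * 256) * t ^+ 2 * V)).
Proof.
move=> V1 ht; have hp := p2; have p01 : 0 <= p <= 1 by lra.
have /andP[p0 _] := p2.
have p01' : 0 <= p < 1 by lra.
have V0 : 0 < V by lra.
have /andP[c00 c0le] := c01.
have [n0 n2] := natr_gt0_of_ge4 R n4.
have [A [A0 a3 b2 b4]] := balanced_bipartition R n4.
have om : c0 / 8 <= 1 - (1 - p) ^+ #|~: A|.-1.
  have -> : c0 / 8 = c0 / 4 / 2 by field.
  apply: one_sub_expr_ge => //; first by lra.
  by have := ler_wpM2r p0 b4; have := c0n; lra.
have am : n%:R * c0 / 16 <= active_mean p A.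
  have -> : n%:R * c0 / 16 = n%:R / 2 * (c0 / 8) by field.
  by apply: ler_pM => //; lra.
have am0 : 0 < active_mean p A.
  by apply: lt_le_trans am; rewrite divr_gt0 // mulr_gt0.
have eta (k : nat) : active_mean p A / 2 <= k%:R -> c0 ^+ 2 / 64 <= 1 - (1 - p) ^+ k.
  move=> hk; have -> : c0 ^+ 2 / 64 = c0 ^+ 2 / 32 / 2 by field.
  have c2 : c0 ^+ 2 <= 1 by rewrite expr_le1 // ltW.
  have c20 : 0 <= c0 ^+ 2 by exact: sqr_ge0.
  apply: one_sub_expr_ge => //; first by lra.
  have h1 : n%:R * c0 / 32 <= k%:R by lra.
  have := ler_wpM2r p0 h1; have := ler_wpM2l (ltW c00) c0n; rewrite expr2; lra.
have /andP[rl ru] := var_ratio_bounds p01.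
have /andP[pi0 pi1] := iso_prob01 n p01.
have npi : V / 2 <= n%:R * pi_.
  have : n%:R * pi_ * r_ <= n%:R * pi_ * 2.
    by apply: ler_wpM2l; [exact: mulr_ge0 | lra].
  by rewrite /niso_var; lra.
have api : V / 6 <= #|A|%:R * pi_.
  by have := ler_wpM2r pi0 a3; lra.
(* V <= 4 n exp(-np) and np exp(-np) <= 1, so errors of order p are of order 1/V. *)
have pV : p <= 4 * V^-1.
  rewrite ler_pdivlMr //; have /andP[_ Vu] := niso_var_bounds.
  have := ler_wpM2l p0 Vu; have := mul_expRN_le1 (n%:R * p); lra.
have VV0 : 0 < V^-1 by rewrite invr_gt0.
apply: le_trans (niso_decay1 p01' theta t A0 am0 eta) _.
apply: lerD.
  have t1 : 8 * n%:R ^+ 2 * p / active_mean p A ^+ 2 <= (2 * 64 * 64) / c0 ^+ 2 * V^-1.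
    apply: (@le_trans _ _ (8 * n%:R ^+ 2 * p / (n%:R * c0 / 16) ^+ 2)).
      apply: ler_wpM2l; first by rewrite !mulr_ge0 // sqr_ge0.
      have nc0 : 0 < n%:R * c0 / 16 by rewrite divr_gt0 // mulr_gt0.
      rewrite lef_pV2 ?posrE ?exprn_gt0 //; apply: lerXn2r => //; rewrite nnegrE; exact: ltW.
    have -> : 8 * n%:R ^+ 2 * p / (n%:R * c0 / 16) ^+ 2 = (32 * 64) / c0 ^+ 2 * p.
      by field; rewrite !gt_eqF.
    have c2 : 0 <= (32 * 64) / c0 ^+ 2 by rewrite divr_ge0 // sqr_ge0.
    by have := ler_wpM2l c2 pV; lra.
  have t2 : (#|A|%:R * pi_)^-1 <= 6 * V^-1.
    have -> : 6 * V^-1 = (V / 6)^-1 by field; rewrite gt_eqF.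
    have V6 : 0 < V / 6 by rewrite divr_gt0.
    by rewrite lef_pV2 ?posrE // (lt_le_trans V6 api).
  have t3 : p / (1 - p) <= 2 * p.
    rewrite ler_pdivrMr; last by lra.
    have : 0 <= p * (1 - 2 * p) by rewrite mulr_ge0 //; lra.
    lra.
  lra.
rewrite ler_expR lerN2.
have t5 := one_sub_cos_ge ht.
have c2 : 0 <= c0 ^+ 2 by exact: sqr_ge0.
have t20 : 0 <= t ^+ 2 by exact: sqr_ge0.
have -> : c0 ^+ 2 / (96 * 256) * t ^+ 2 * V = (V / 6 / 2 * (c0 ^+ 2 / 64)) * (t ^+ 2 / 32) by field.
apply: ler_pM => //; [ | lra |].
  by rewrite mulr_ge0 // ?divr_ge0 // ltW.
by apply: ler_wpM2r; [lra | lra].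
Qed.

End Intermediate.

Section Sparse.
Hypotheses (n4 : (4 <= n)%N) (p0 : 0 < p) (np8 : n%:R * p <= 1 / 8).

Lemma sparse_p : p <= 1 / 8.
Proof.
have : 1 <= n%:R :> R by rewrite ler1n; apply: leq_trans n4.
by have := np8; have := p0 => h1 h2 h3; have := ler_wpM2r (ltW h1) h3; lra.
Qed.

Lemma sparse_pi : 1 / 2 <= (1 - p) ^+ n.-1 /\ 1 / 2 <= (1 - p) ^+ n.-2.
Proof.
have hp := sparse_p; have h0 := p0.
have p01 : 0 <= p <= 1 by lra.
have sm k : (k <= n)%N -> 1 / 2 <= (1 - p) ^+ k.
  move=> kn; apply: le_trans (bernoulli_ineq k p01).
  have : k%:R * p <= n%:R * p by apply: ler_wpM2r; [lra | rewrite ler_nat].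
  by have := np8; lra.
by split; apply: sm; [exact: leq_pred | exact: leq_trans (leq_pred _) (leq_pred _)].
Qed.

Lemma niso_var_sparse : n%:R ^+ 2 * p / 8 <= V <= 2 * (n%:R ^+ 2 * p).
Proof.
have hp := sparse_p; have h0 := p0; have h8 := np8.
have p01 : 0 <= p <= 1 by lra.
have [s1 s2] := sparse_pi.
have /andP[rl ru] := var_ratio_bounds p01.
have /andP[pi0 pi1] := iso_prob01 n p01.
have n2 : (2 <= n)%N by apply: leq_trans n4.
have n0 : 0 <= n%:R :> R by [].
have VE : V = n%:R * (pi_ * r_) by rewrite /niso_var; ring.
have rlow : n%:R * p / 4 <= r_.
  rewrite /var_ratio; have : n%:R / 2 * (p * (1 / 2)) <= n.-1%:R * pendant_prob n p.
    apply: ler_pM; [by lra | by lra | exact: predn_ge_half |].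
    by apply: ler_wpM2l => //; lra.
  lra.
have rup : r_ <= 2 * (n%:R * p).
  have : 1 - n%:R * p <= pi_.
    apply: le_trans (bernoulli_ineq n.-1 p01).
    have : n.-1%:R * p <= n%:R * p by apply: ler_wpM2r; [lra | rewrite ler_nat leq_pred].
    lra.
  lra.
have np0 : 0 <= n%:R * p by rewrite mulr_ge0 // ltW.
have h1 : 1 / 2 * (n%:R * p / 4) <= pi_ * r_ by apply: ler_pM => //; lra.
have h2 : pi_ * r_ <= 1 * (2 * (n%:R * p)) by apply: ler_pM => //; lra.
have := ler_wpM2l n0 h1; have := ler_wpM2l n0 h2; rewrite -VE expr2; lra.
Qed.

(** A vertex of A meets one of the order n^2 p active vertices with probability of order (np)^2;
    with order n free vertices the exponent is of order n^3 p^2. *)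
Lemma niso_decay_sparse1 (theta t : R) : 1 <= V ->
  `|Ex (fun E => cos (theta + t * niso E))| <=
   (65 * 64) * V^-1 + expR (- (n%:R ^+ 3 * p ^+ 2 / (3 * 256) * (1 - cos t))).
Proof.
move=> V1; have hp := sparse_p; have h0 := p0; have h8 := np8.
have p0' := ltW p0.
have p01 : 0 <= p <= 1 by lra.
have p01' : 0 <= p < 1 by lra.
have V0 : 0 < V by lra.
have [n0 n2] := natr_gt0_of_ge4 R n4.
have [A [A0 a3 b2 b4]] := balanced_bipartition R n4.
have np0 : 0 < n%:R * p by rewrite mulr_gt0.
have om : n%:R * p / 8 <= 1 - (1 - p) ^+ #|~: A|.-1.
  have -> : n%:R * p / 8 = n%:R * p / 4 / 2 by field.
  apply: one_sub_expr_ge => //; first by lra.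
  by have := ler_wpM2r p0' b4; lra.
have am : n%:R ^+ 2 * p / 16 <= active_mean p A.
  have -> : n%:R ^+ 2 * p / 16 = n%:R / 2 * (n%:R * p / 8) by field.
  by apply: ler_pM => //; lra.
have n2p0 : 0 < n%:R ^+ 2 * p by rewrite mulr_gt0 // exprn_gt0.
have am0 : 0 < active_mean p A by apply: lt_le_trans am; rewrite divr_gt0.
have eta (k : nat) : active_mean p A / 2 <= k%:R -> (n%:R * p) ^+ 2 / 64 <= 1 - (1 - p) ^+ k.
  move=> hk; have -> : (n%:R * p) ^+ 2 / 64 = (n%:R * p) ^+ 2 / 32 / 2 by field.
  have c2 : (n%:R * p) ^+ 2 <= 1 by rewrite expr_le1 //; lra.
  have c20 : 0 <= (n%:R * p) ^+ 2 by exact: sqr_ge0.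
  apply: one_sub_expr_ge => //; first by lra.
  have h1 : n%:R ^+ 2 * p / 32 <= k%:R by lra.
  by have := ler_wpM2r p0' h1; rewrite exprMn; lra.
have [s1 _] := sparse_pi.
have /andP[Vl Vu] := niso_var_sparse.
have VV0 : 0 < V^-1 by rewrite invr_gt0.
(* This absorbs the errors 1/n and p <= 1/n into 1/V. *)
have Vn : V <= n%:R.
  have h : n%:R * (n%:R * p) <= n%:R * (1 / 8) by apply: ler_wpM2l => //; exact: ltW.
  by move: Vu; rewrite expr2; lra.
have nV : n%:R^-1 <= V^-1 by rewrite lef_pV2 ?posrE.
have api : n%:R / 6 <= #|A|%:R * pi_.
  have -> : n%:R / 6 = n%:R / 3 * (1 / 2) :> R by field.
  by apply: ler_pM => //; lra.
apply: le_trans (niso_decay1 p01' theta t A0 am0 eta) _.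
apply: lerD.
  have t1 : 8 * n%:R ^+ 2 * p / active_mean p A ^+ 2 <= (64 * 64) * V^-1.
    apply: (@le_trans _ _ (8 * n%:R ^+ 2 * p / (n%:R ^+ 2 * p / 16) ^+ 2)).
      apply: ler_wpM2l; first by rewrite !mulr_ge0 // sqr_ge0.
      have nc0 : 0 < n%:R ^+ 2 * p / 16 by rewrite divr_gt0.
      rewrite lef_pV2 ?posrE ?exprn_gt0 //; apply: lerXn2r => //; rewrite nnegrE; exact: ltW.
    have -> : 8 * n%:R ^+ 2 * p / (n%:R ^+ 2 * p / 16) ^+ 2 = (64 * 64) * (2 * (n%:R ^+ 2 * p))^-1.
      by field; rewrite !gt_eqF.
    rewrite ler_wpM2l // lef_pV2 ?posrE // mulr_gt0 //.
  have t2 : (#|A|%:R * pi_)^-1 <= 6 * n%:R^-1.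
    have -> : 6 * n%:R^-1 = (n%:R / 6)^-1 :> R by field; rewrite gt_eqF.
    have V6 : 0 < n%:R / 6 :> R by rewrite divr_gt0.
    by rewrite lef_pV2 ?posrE // (lt_le_trans V6 api).
  have t3 : p / (1 - p) <= 2 * p.
    rewrite ler_pdivrMr; last by lra.
    have : 0 <= p * (1 - 2 * p) by rewrite mulr_ge0 //; lra.
    lra.
  have t4 : p <= n%:R^-1 by rewrite -div1r ler_pdivlMr // mulrC; lra.
  lra.
rewrite ler_expR lerN2.
apply: ler_wpM2r; first by rewrite subr_ge0 cos_le1.
have -> : n%:R ^+ 3 * p ^+ 2 / (3 * 256) = n%:R / 6 / 2 * ((n%:R * p) ^+ 2 / 64) by field.
apply: ler_wpM2r; last by lra.
by rewrite divr_ge0 // sqr_ge0.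
Qed.

(** The mean number m of lone edges of G(n, 2p) is at least n^2 p/4 >= V/8, so the exponent m/4 is
    at least V/32. *)
Lemma niso_decay_sparse2 (theta t : R) : 1 <= V ->
  `|Ex (fun E => cos (theta + t * niso E))| <=
   (8 * 64) * V^-1 + expR (- (1 / 32 * sin t ^+ 2 * V)).
Proof.
move=> V1; have hp := sparse_p; have h0 := p0; have h8 := np8.
have p2 : 0 <= 2 * p <= 1 by lra.
have V0 : 0 < V by lra.
have [n0 n2] := natr_gt0_of_ge4 R n4.
have n2p0 : 0 < n%:R ^+ 2 * p by rewrite mulr_gt0 // exprn_gt0.
have /andP[Vl Vu] := niso_var_sparse.
have eE : #|edges n|%:R = n%:R * n.-1%:R / 2 :> R.
  have := congr1 (fun k : nat => k%:R : R) (card_edges2 n).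
  by rewrite !natrM => h; lra.
have el : n%:R ^+ 2 / 4 <= #|edges n|%:R :> R.
  rewrite eE; have := ler_wpM2l (ltW n0) (predn_ge_half n2); rewrite expr2; lra.
have eu : #|edges n|%:R <= n%:R ^+ 2 / 2 :> R.
  have h : n%:R * n.-1%:R <= n%:R * n%:R :> R.
    by apply: ler_wpM2l; [exact: ltW | rewrite ler_nat leq_pred].
  by rewrite eE expr2; lra.
(* Bernoulli's inequality loses at most 4np, which is at most 1/2 by [np8]. *)
have q2 : 1 / 2 <= (1 - 2 * p) ^+ (2 * n - 4).
  apply: le_trans (bernoulli_ineq _ p2).
  have : (2 * n - 4)%:R * p <= (2 * n)%:R * p.
    by apply: ler_wpM2r; [exact: ltW | rewrite ler_nat leq_subr].
  rewrite natrM; lra.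
set m := #|edges n|%:R * (2 * p * (1 - 2 * p) ^+ (2 * n - 4)).
have ml : n%:R ^+ 2 * p / 4 <= m.
  have -> : n%:R ^+ 2 * p / 4 = n%:R ^+ 2 / 4 * (2 * p * (1 / 2)) by field.
  have g1 : 0 <= n%:R ^+ 2 / 4 :> R by rewrite divr_ge0 // sqr_ge0.
  have g2 : 0 <= 2 * p * (1 / 2) by lra.
  have g3 : 2 * p * (1 / 2) <= 2 * p * (1 - 2 * p) ^+ (2 * n - 4) by apply: ler_wpM2l => //; lra.
  exact: ler_pM g1 g2 el g3.
have m0 : 0 < m by apply: lt_le_trans ml; rewrite divr_gt0.
apply: le_trans (niso_decay2 theta t n2 p2 m0) _; rewrite -/m.
apply: lerD.
  apply: (@le_trans _ _ (16 * (n%:R ^+ 2 * p) / (n%:R ^+ 2 * p / 4) ^+ 2)).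
    apply: ler_pM; [ | by rewrite invr_ge0 sqr_ge0 | |].
    - by rewrite !mulr_ge0 // ltW.
    - have := ler_wpM2r (ltW p0) eu; lra.
    - have h4 : 0 < n%:R ^+ 2 * p / 4 by rewrite divr_gt0.
      rewrite lef_pV2 ?posrE ?exprn_gt0 //; apply: lerXn2r => //; rewrite nnegrE; exact: ltW.
  have -> : 16 * (n%:R ^+ 2 * p) / (n%:R ^+ 2 * p / 4) ^+ 2 = (8 * 64) * (2 * (n%:R ^+ 2 * p))^-1.
    by field; rewrite !gt_eqF.
  by rewrite ler_wpM2l // lef_pV2 ?posrE // mulr_gt0.
rewrite ler_expR lerN2.
have -> : 1 / 32 * sin t ^+ 2 * V = (1 / 32 * V) * sin t ^+ 2 by ring.
apply: ler_wpM2r; [exact: sqr_ge0 | lra].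
Qed.

End Sparse.
End FixedSize.

(** * Rates with constants uniform in n and p *)

Section Rates.
Local Open Scope classical_set_scope.
Variable R : realType.

Lemma inv_of_eighth_root (V z : R) : 0 < z -> V * z ^+ 8 = 1 -> V^-1 = z ^+ 8 /\ V = (z ^+ 8)^-1.
Proof.
move=> z0 Vz; have z80 : z ^+ 8 != 0 by rewrite expf_neq0 // gt_eqF.
have VE : V = (z ^+ 8)^-1 by rewrite -[LHS]mulr1 -(mulfV z80) mulrA Vz mul1r.
by split=> //; rewrite VE invrK.
Qed.

Lemma dloc1_intermediate (c0 : R) : 0 < c0 <= 1 -> exists2 C : R, 0 < C &
  forall (n : nat) (p : R), (4 <= n)%N -> 0 <= p <= 1 / 2 ->
    c0 <= n%:R * p -> n%:R * p ^+ 2 <= 4 -> 1 <= niso_var n p ->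
    `|dloc 1 (distW n p) (distTP (meanW n p) (varW n p))| <=
    C * varW n p `^ (- (3 / 4)).
Proof.
move=> c01; have /andP[c00 c0le] := c01.
pose K : R := 2 * 64 * 64 / c0 ^+ 2 + 56; pose c : R := c0 ^+ 2 / (96 * 256).
have K1 : 1 <= K.
  have : 0 <= 2 * 64 * 64 / c0 ^+ 2 by rewrite divr_ge0 ?sqr_ge0.
  by rewrite /K; lra.
have cpos : 0 < c by apply: divr_gt0; [exact: exprn_gt0 | lra].
exists (2 * 4 + 4 * (K + 2) + (K + 2) / (Num.min c (1 / 32)) ^+ 2).
  have : 0 <= (K + 2) / (Num.min c (1 / 32)) ^+ 2 by rewrite divr_ge0 ?sqr_ge0 //; lra.
  by move=> h; lra.
move=> n p n4 p2 c0n np2 V1.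
have p01 : 0 <= p <= 1 by lra.
have [z z01 [Vz powE]] := powR_eighth_root V1.
have /andP[z0 z1] := z01; have [ViE VE] := inv_of_eighth_root z0 Vz.
rewrite [X in X `^ _]varW_eq // powE; apply: dloc1_bound => //; first by lra.
move=> theta t ht.
apply: le_trans (niso_decay_intermediate n4 p2 c01 c0n np2 theta V1 ht) _.
rewrite ViE VE -/K -/c; apply: lerD => //.
by rewrite ler_peMl ?expR_ge0.
Qed.

Lemma sparse_rates : exists2 C : R, 0 < C &
  forall (n : nat) (p : R), (4 <= n)%N -> 0 < p -> n%:R * p <= 1 / 8 ->
    1 <= niso_var n p ->
    `|dloc 1 (distW n p) (distTP (meanW n p) (varW n p))| <=
      C * (Num.sqrt (varW n p) * (n%:R * p `^ (3 / 4)))^-1 /\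
    `|dloc 2 (distW n p) (distTP (meanW n p) (varW n p))| <=
      C * varW n p `^ (- (3 / 4)).
Proof.
pose K : R := 65 * 64; pose c : R := 1 / 32.
have K1 : 1 <= K by rewrite /K; lra.
have cpos : 0 < c by rewrite divr_gt0.
have c'0 : 0 < Num.min c (1 / 2) by rewrite lt_min cpos divr_gt0.
set c' := Num.min c (1 / 2) in c'0.
have K'0 : 0 <= K + 2 by lra.
pose C2 := 2 * 4 + 6 * (K + 2) + (K + 2) / (c' / 16) ^+ 2 + (K + 2) / (c' / 16).
pose C1 := 2 * 4 + 8 * (K + 2) + (K + 2) / (c' / 16) ^+ 2.
pose C3 := (K + 2) + (K + 2) / (c' / 32).
have g1 : 0 <= (K + 2) / (c' / 16) ^+ 2 by rewrite divr_ge0 ?sqr_ge0.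
have g2 : 0 <= (K + 2) / (c' / 16) by rewrite divr_ge0 // divr_ge0 // ltW.
have g3 : 0 <= (K + 2) / (c' / 32) by rewrite divr_ge0 // divr_ge0 // ltW.
have C10 : 0 < C1 by rewrite /C1; lra.
have C20 : 0 < C2 by rewrite /C2; lra.
have C30 : 0 < C3 by rewrite /C3; lra.
exists (C2 + (2 * C1 + 5 * C3)); first by lra.
move=> n p n4 p0 np8 V1.
have p8 := sparse_p n4 p0 np8.
have p01 : 0 <= p <= 1 by lra.
have [z z01 [Vz powE]] := powR_eighth_root V1.
have /andP[z0 z1] := z01; have [ViE VE] := inv_of_eighth_root z0 Vz.
have [n0 n2] := natr_gt0_of_ge4 R n4.
have decay2 (theta t : R) : 0 <= t <= pi ->
    `|bern p (edges n) (fun E => cos (theta + t * niso R E))| <=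
       K * z ^+ 8 + K * expR (- (c * sin t ^+ 2 / z ^+ 8)).
  move=> ht; apply: le_trans (niso_decay_sparse2 n4 p0 np8 theta t V1) _.
  rewrite ViE VE -/c; apply: lerD.
    by apply: ler_wpM2r; [rewrite exprn_ge0 // ltW | rewrite /K; lra].
  by rewrite ler_peMl ?expR_ge0.
pose kappa : R := n%:R ^+ 3 * p ^+ 2 / (3 * 256).
have decay1 (theta t : R) : 0 <= t <= pi ->
    `|bern p (edges n) (fun E => cos (theta + t * niso R E))| <=
       K * z ^+ 8 + K * expR (- (kappa * (1 - cos t))).
  move=> ht; apply: le_trans (niso_decay_sparse1 n4 p0 np8 theta t V1) _.
  rewrite ViE -/kappa; apply: lerD => //.
  by rewrite ler_peMl ?expR_ge0.
have /andP[Vl Vu] := niso_var_sparse n4 p0 np8.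
have n2p0 : 0 < n%:R ^+ 2 * p by rewrite mulr_gt0 // exprn_gt0.
have kappa_pos : 0 < kappa.
  by apply: divr_gt0; [rewrite mulr_gt0 // exprn_gt0 | lra].
have kappaV : 0 <= kappa <= niso_var n p.
  rewrite (ltW kappa_pos) /=; apply: le_trans Vl; rewrite /kappa.
  have -> : n%:R ^+ 3 * p ^+ 2 = n%:R ^+ 2 * p * (n%:R * p) by ring.
  have : n%:R ^+ 2 * p * (n%:R * p) <= n%:R ^+ 2 * p * 1.
    by apply: ler_wpM2l; [exact: ltW | lra].
  by lra.
have K0 : 0 <= K by lra.
split; last first.
  rewrite [X in X `^ _]varW_eq // powE.
  apply: le_trans (dloc2_bound p01 z01 Vz K0 cpos decay2) _.
  rewrite -/c' -/C2 ler_wpM2r ?exprn_ge0 ?(ltW z0) //; lra.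
have := dloc1_bound_lattice2 p01 z01 Vz K0 cpos decay2 kappaV decay1.
rewrite -/c' -/C1 -/C3 => h; apply: le_trans h _.
rewrite varW_eq //.
(* With q the target 1/(s n p^(3/4)) becomes z^4 / (n q^3), and only integer powers remain. *)
pose q := p `^ (1 / 4).
have q0 : 0 < q by rewrite powR_gt0.
have pE : p = q ^+ 4.
  rewrite /q -powR_mulrn ?powR_ge0 // -powRrM.
  by rewrite (_ : 1 / 4 * 4%:R = 1) ?powRr1 ?ltW //; field.
have p34 : p `^ (3 / 4) = q ^+ 3.
  by rewrite /q -powR_mulrn ?powR_ge0 // -powRrM; congr (_ `^ _); field.
have sVE : Num.sqrt (niso_var n p) = (z ^+ 4)^-1.
  by rewrite VE (exprM z 4 2) -exprVn sqrtr_sqr ger0_norm // invr_ge0 exprn_ge0 // ltW.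
have nq0 : 0 < n%:R * q ^+ 3 by rewrite mulr_gt0 // exprn_gt0.
have z40 : 0 < z ^+ 4 by exact: exprn_gt0.
rewrite sVE p34 invfM invrK.
have pow4_le (a b : R) : 0 <= a -> 0 <= b -> a ^+ 4 <= b ^+ 4 -> a <= b.
  by move=> a0 b0; rewrite ler_pXn2r // nnegrE.
(* s^(-3/2) lies within the target rate: s^(-1/2) n p^(3/4) is of order (np)^(1/2), hence
   bounded. *)
have i1 : z ^+ 2 * (n%:R * q ^+ 3) <= 2.
  apply: pow4_le => //; first by rewrite mulr_ge0 ?exprn_ge0 // ltW.
  have z8 : z ^+ 8 * (n%:R ^+ 2 * q ^+ 4) <= 8.
    have -> : n%:R ^+ 2 * q ^+ 4 = n%:R ^+ 2 * p by rewrite pE.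
    have : z ^+ 8 * (n%:R ^+ 2 * p / 8) <= z ^+ 8 * niso_var n p.
      by apply: ler_wpM2l => //; rewrite exprn_ge0 // ltW.
    by rewrite [_ * niso_var n p]mulrC Vz; lra.
  have -> : (z ^+ 2 * (n%:R * q ^+ 3)) ^+ 4 = z ^+ 8 * (n%:R ^+ 2 * q ^+ 4) * (n%:R * q ^+ 4) ^+ 2 by ring.
  have nq : (n%:R * q ^+ 4) ^+ 2 <= 1.
    rewrite -pE expr_le1 //; last by rewrite mulr_ge0 // ltW.
    by lra.
  have : z ^+ 8 * (n%:R ^+ 2 * q ^+ 4) * (n%:R * q ^+ 4) ^+ 2 <= 8 * 1.
    apply: ler_pM => //; last exact: sqr_ge0.
    by apply: mulr_ge0; [rewrite exprn_ge0 // ltW | rewrite mulr_ge0 // exprn_ge0 // ltW].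
  rewrite (_ : 2 ^+ 4 = 16) ?ler_nat //; [lra | ring].
(* The fourth power of n p^(3/4) is n^3 p^2 times np, that is 768 kappa np. The factor exp(-2 kappa)
   absorbs kappa and leaves 384 <= 5^4. *)
have i2 : expR (- (kappa / 2)) * (n%:R * q ^+ 3) <= 5.
  apply: pow4_le => //; first by rewrite mulr_ge0 ?expR_ge0 // ltW.
  have -> : (expR (- (kappa / 2)) * (n%:R * q ^+ 3)) ^+ 4 =
      expR (- (2 * kappa)) * (n%:R ^+ 3 * p ^+ 2) * (n%:R * p).
    rewrite exprMn -expRM_natl pE; have -> : 4%:R * - (kappa / 2) = - (2 * kappa) by field.
    ring.
  have e1 : expR (- (2 * kappa)) * (n%:R ^+ 3 * p ^+ 2) <= 3 * 128.
    have := mul_expRN_le1 (2 * kappa); rewrite /kappa.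
    set e := expR _; lra.
  have : expR (- (2 * kappa)) * (n%:R ^+ 3 * p ^+ 2) * (n%:R * p) <= 3 * 128 * 1.
    apply: ler_pM => //; last by lra.
      by rewrite mulr_ge0 ?expR_ge0 // mulr_ge0 ?exprn_ge0 // ltW.
    by rewrite mulr_ge0 // ltW.
  rewrite (_ : 5 ^+ 4 = 25 * 25); last by ring.
  lra.
have j1 : z ^+ 6 <= 2 * (z ^+ 4 * (n%:R * q ^+ 3)^-1).
  rewrite mulrA ler_pdivlMr // (_ : z ^+ 6 = z ^+ 4 * z ^+ 2); last by ring.
  by rewrite -mulrA [2 * _]mulrC ler_pM2l.
have j2 : expR (- (kappa / 2)) <= 5 * (n%:R * q ^+ 3)^-1 by rewrite ler_pdivlMr.
have j3 : C1 * z ^+ 6 <= C1 * (2 * (z ^+ 4 * (n%:R * q ^+ 3)^-1)) by apply: ler_wpM2l => //; exact: ltW.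
have j4 : C3 * expR (- (kappa / 2)) * z ^+ 4 <= C3 * (5 * (n%:R * q ^+ 3)^-1) * z ^+ 4.
  by apply: ler_wpM2r; [exact: ltW | apply: ler_wpM2l => //; exact: ltW].
have j5 : 0 <= C2 * (z ^+ 4 * (n%:R * q ^+ 3)^-1).
  by rewrite !mulr_ge0 ?invr_ge0 // ltW.
lra.
Qed.

(** x^2/2 <= exp x <= n; for x = np this bounds n p^2. *)
Lemma ln_dominates (n : nat) (x : R) : (1 <= n)%N -> 0 <= x <= ln n%:R -> x ^+ 2 <= 2 * n%:R.
Proof.
move=> n1 /andP[x0 xl]; have n0 : 0 < n%:R :> R by rewrite ltr0n.
have := expR_ge1Dxn 1 x0; rewrite (_ : 2`!%:R = 2 :> R) // => h.
have : expR x <= n%:R by rewrite -[leRHS]lnK ?posrE // ler_expR.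
lra.
Qed.

End Rates.

(** * The two asymptotic regimes *)

Unset Implicit Arguments.
Local Open Scope classical_set_scope.

Theorem theorem12 (R : realType) (p : nat -> R)
  (hp : forall n, 0 <= p n <= 1) :
  ( (fun n : nat => ln (n%:R : R) - n%:R * p n) @ \oo --> +oo ->
    ( (fun n : nat => n%:R * p n) @ \oo --> +oo \/
      exists c : R, 0 < c /\ ((fun n : nat => n%:R * p n) @ \oo --> c) ) ->
    seq_Theta (fun n => varW n (p n)) (fun n => n%:R * expR (- (n%:R * p n))) /\
    seq_O (fun n => dloc 1 (distW n (p n)) (distTP (meanW n (p n)) (varW n (p n))))
         (fun n => varW n (p n) `^ (- (3 / 4))) ) /\
  ( (fun n : nat => n%:R * p n) @ \oo --> 0 ->
    (fun n : nat => (n ^ 2)%:R * p n) @ \oo --> +oo ->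
    seq_Theta (fun n => varW n (p n)) (fun n => (n ^ 2)%:R * p n) /\
    seq_O (fun n => dloc 1 (distW n (p n)) (distTP (meanW n (p n)) (varW n (p n))))
         (fun n => (Num.sqrt (varW n (p n)) * (n%:R * p n `^ (3 / 4))) ^-1) /\
    seq_O (fun n => dloc 2 (distW n (p n)) (distTP (meanW n (p n)) (varW n (p n))))
         (fun n => varW n (p n) `^ (- (3 / 4))) ).
Proof.
split.
  move=> hln hnp.
  (* Both alternatives are used through an eventual positive lower bound on np. *)
  have [c0 c01 hc0] : exists2 c0 : R, 0 < c0 <= 1 & \forall n \near \oo, c0 <= n%:R * p n.
    case: hnp => [hy|[c [cpos hc]]].
      exists 1; first by rewrite ltr01 lexx.
      by move/cvgryPge: hy; apply.
    exists (Num.min 1 (c / 2)); first by rewrite lt_min ltr01 divr_gt0 //= ge_min lexx.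
    have h : Num.min 1 (c / 2) < c by rewrite gt_min (_ : c / 2 < c) ?orbT //; lra.
    exact: (@cvgr_ge _ _ _ _ _ _ hc _ h).
  have /andP[c00 c0le] := c01.
  pose b : R := expR (- 8) * c0 / 4.
  have b0 : 0 < b by rewrite divr_gt0 // mulr_gt0 ?expR_gt0.
  (* The 0 gives np <= log n, hence n p^2 <= 2 by [ln_dominates]; the other entry gives b n exp(-np)
     >= 1, hence V >= 1 by [niso_var_bounds]. *)
  have hM : \forall n \near \oo, Num.max 0 (ln b^-1) <= ln (n%:R : R) - n%:R * p n.
    by move/cvgryPge: hln; apply.
  have key : \forall n \near \oo, [/\ (8 <= n)%N, c0 <= n%:R * p n &
      Num.max 0 (ln b^-1) <= ln (n%:R : R) - n%:R * p n].
    near=> n; split; near: n; [exact: nbhs_infty_ge | exact: hc0 | exact: hM].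
  have fixed n : [/\ (8 <= n)%N, c0 <= n%:R * p n &
      Num.max 0 (ln b^-1) <= ln (n%:R : R) - n%:R * p n] ->
    [/\ (4 <= n)%N, 0 <= p n <= 1 / 2, n%:R * p n ^+ 2 <= 4 &
        1 <= b * (n%:R * expR (- (n%:R * p n)))].
    move=> [n8 cn]; rewrite ge_max => /andP[l1 l2].
    have /andP[p0 p1] := hp n.
    have n1 : (1 <= n)%N by apply: leq_trans n8.
    have n0 : 0 < n%:R :> R by rewrite ltr0n.
    have n8R : 8 <= n%:R :> R by rewrite (ler_nat R 8).
    have x0 : 0 <= n%:R * p n by rewrite mulr_ge0 // ltW.
    have x2 : (n%:R * p n) ^+ 2 <= 2 * n%:R by apply: ln_dominates => //; lra.
    have np2 : n%:R * p n ^+ 2 <= 2.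
      rewrite -(ler_pM2l n0); have -> : n%:R * (n%:R * p n ^+ 2) = (n%:R * p n) ^+ 2 by ring.
      lra.
    split; [exact: leq_trans n8 | | lra |].
      (* For n >= 8, p > 1/2 would give n p^2 > 2. *)
      rewrite p0 /=; rewrite leNgt; apply/negP => h.
      have h4 : (1 / 2) ^+ 2 < p n ^+ 2 by rewrite ltr_pXn2r // nnegrE; lra.
      have p20 : 0 <= p n ^+ 2 by exact: sqr_ge0.
      have := ler_wpM2r p20 n8R; move: h4; rewrite expr2; lra.
    have -> : n%:R * expR (- (n%:R * p n)) = expR (ln n%:R - n%:R * p n).
      by rewrite expRD lnK // posrE.
    have : expR (ln b^-1) <= expR (ln n%:R - n%:R * p n) by rewrite ler_expR.
    rewrite lnK ?posrE ?invr_gt0 // => h.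
    by rewrite -ler_pdivrMl // mulr1.
  have [C C0 hC] := dloc1_intermediate c01.
  split.
    exists b, 4; split=> //; split=> //.
    apply: filterS key => n hn; have [n4 p2 np2 _] := fixed n hn.
    have [_ cn _] := hn; have p01 := hp n.
    by rewrite varW_eq //; apply/andP; apply: niso_var_bounds.
  exists C; split=> //; apply: filterS key => n hn; have [n4 p2 np2 hV] := fixed n hn.
  have [_ cn _] := hn; apply: hC => //; apply: le_trans hV _.
  by have /andP[] := niso_var_bounds n4 p2 c01 cn np2.
move=> hx hn2p.
have e8 : (0 : R) < 1 / 8 by rewrite divr_gt0.
(* The threshold 8 on n^2 p yields V >= 1, since V >= n^2 p/8. *)
have key : \forall n \near \oo, [/\ (4 <= n)%N, n%:R * p n <= 1 / 8 & 8 <= (n ^ 2)%:R * p n].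
  near=> n; split; near: n; [exact: nbhs_infty_ge | exact: (@cvgr_le _ _ _ _ _ _ hx _ e8) |].
  by move/cvgryPge: hn2p; apply.
have fixed n : [/\ (4 <= n)%N, n%:R * p n <= 1 / 8 & 8 <= (n ^ 2)%:R * p n] ->
    0 < p n /\ 1 <= niso_var n (p n).
  move=> [n4 n8 np]; have /andP[p0 p1] := hp n.
  have ppos : 0 < p n.
    rewrite lt_neqAle p0 andbT; apply/eqP => pE; move: np; rewrite -pE mulr0; lra.
  split=> //; have /andP[+ _] := niso_var_sparse n4 ppos n8.
  rewrite natrX in np; lra.
have [C C0 hC] := sparse_rates R.
split.
  exists (1 / 8), 2; split=> //; split=> //.
  apply: filterS key => n hn; have [ppos V1] := fixed n hn; have [n4 n8 np] := hn.
  rewrite varW_eq // natrX; have /andP[l u] := niso_var_sparse n4 ppos n8.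
  by split=> //; lra.
split; exists C; split=> //; apply: filterS key => n hn;
  have [ppos V1] := fixed n hn; have [n4 n8 np] := hn;
  by have [] := hC n (p n) n4 ppos n8 V1.
Unshelve. all: by end_near. Qed.
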